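(* Let $m,M\in\mathbb{N}\setminus\{0\}$, $M\ge m$. Assume $\lambda_{m-1}<\lambda_m$ if $m>1$, and $\lambda_M<\lambda_{M+1}$. Assume moreover that there is a real number $\underline\lambda_{M+1}$, and set $\overline\lambda_{m-1}:=\lambda_{(m-1)h}$ if $m>1$, such that $$\lambda_{m-1}\le\overline\lambda_{m-1}<\lambda_{mh}\ \text{ when } m>1,\qquad \lambda_{Mh}<\underline\lambda_{M+1}\le\lambda_{M+1}.$$ For $i=m,\dots,M$, let $(\varphi_{ih},\lambda_{ih})\in V_h\times\mathbb{R}_+$ be the discrete eigenpairs and let $\boldsymbol\sigma_{ih}$ be the equilibrated flux reconstructions described in the context. Define $$\eta_{\mathrm{res}}^2:=\sum_{i=m}^M\|\nabla\varphi_{ih}+\boldsymbol\sigma_{ih}\|^2,$$ $$c_h:=\max\left[\Big(\tfrac{\lambda_{mh}}{\overline\lambda_{m-1}}-1\Big)^{-1},\Big(1-\tfrac{\lambda_{Mh}}{\underline\lambda_{M+1}}\Big)^{-1}\right],$$ $$\tilde c_h:=\max\left[(\overline\lambda_{m-1})^{-1/2}\Big(\tfrac{\lambda_{mh}}{\overline\lambda_{m-1}}-1\Big)^{-1},(\underline\lambda_{M+1})^{-1/2}\Big(1-\tfrac{\lambda_{Mh}}{\underline\lambda_{M+1}}\Big)^{-1}\right],$$ where the first term in each $\max$ is discarded if $m=1$. Then $$0\le\sum_{i=m}^M(\lambda_{ih}-\lambda_i)\le\eta^2$$ in each of the following two cases. Case I. Assume that $\|\gamma_h v\|\ne0$ for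 all $v\in\mathrm{Span}\{\varphi_m^0,\dots,\varphi_M^0\}\setminus\{0\}$. Then the bound holds with $$\eta^2:=\big(2c_h^2+2\lambda_{Mh}\tilde c_h^4\eta_{\mathrm{res}}^2\big)\eta_{\mathrm{res}}^2.$$ Case II. Assume that, for $i=m,\dots,M$, the solutions $\zeta_{(ih)}$ of the source problems defined in the context belong to $H^{1+\delta}(\Omega)$ for some $0<\delta\le1$, and that the estimates $$\min_{v_h\in V_h}\|\nabla(\zeta_{(ih)}-v_h)\|\le C_{\mathrm I}h^\delta|\zeta_{(ih)}|_{H^{1+\delta}(\Omega)},\qquad |\zeta_{(ih)}|_{H^{1+\delta}(\Omega)}\le C_{\mathrm S}\|r_{(ih)}\|$$ are satisfied with constants $C_{\mathrm I},C_{\mathrm S}$. Then the bound holds with $$\eta^2:=\big(1+4\lambda_{Mh}c_h^2C_{\mathrm I}^2C_{\mathrm S}^2h^{2\delta}\big)\eta_{\mathrm{res}}^2.$$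
   Context: Continuous problem. $\Omega\subset\mathbb{R}^d$, $d=2,3$, is a polygonal/polyhedral domain with Lipschitz boundary. $(\cdot,\cdot)_\omega$ and $\|\cdot\|_\omega$ are the $L^2(\omega)$ inner product and norm (also for vector fields), the index being dropped when $\omega=\Omega$. $(\lambda_k)_{k\ge1}$ is the nondecreasing sequence of eigenvalues, counted with multiplicity, of the Dirichlet Laplacian $-\Delta$ on $L^2(\Omega)$, with $L^2$-orthonormal eigenvectors $\varphi_k^0\in H^1_0(\Omega)$ forming a basis of $L^2(\Omega)$: $(\nabla\varphi_k^0,\nabla v)=\lambda_k(\varphi_k^0,v)$ for all $v\in H^1_0(\Omega)$. Discretization. $\mathcal T_h$ belongs to a shape-regular family of matching simplicial meshes of $\Omega$ (the ratio of the diameter of each element to the diameter of its largest inscribed ball is uniformly bounded by $\kappa_{\mathcal T}$); $h$ is the mesh size. $\mathbb{P}_s(\mathcal T_h)$ is the space of piecewise polynomials of total degree at most $s$ on $\mathcal T_h$, without continuity requirement. For $p\ge1$, $V_h:=\mathbb{P}_p(\mathcal T_h)\cap H^1_0(\Omega)$, with $\dim V_h\ge M$. The discrete eigenpairs $(\varphi_{kh},\lambda_{kh})\in V_h\times\mathbb{R}_+$, $1\le k\le\dim V_h$, satisfy $(\varphi_{kh},\varphi_{jh})=\delta_{kj}$, $(\nabla\varphi_{kh},\nabla v_h)=\lambda_{kh}(\varphi_{kh},v_h)$ for all $v_h\in V_h$, and $\lambda_{1h}\le\lambda_{2h}\le\cdots$ (counting multiplicities). The approximate density matrix is $\gamma_hv:=\sum_{i=m}^M(v,\varphi_{ih})\varphi_{ih}$,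 $v\in L^2(\Omega)$. Equilibrated flux reconstruction. $\mathbf V_h:=\{\mathbf v_h\in\mathbf H(\mathrm{div},\Omega):\ \mathbf v_h|_K\in[\mathbb{P}_{p+1}(K)]^d+\mathbb{P}_{p+1}(K)\mathbf x\ \ \forall K\in\mathcal T_h\}$ (Raviart–Thomas–Nédélec space of order $p+1$), $Q_h:=\mathbb{P}_{p+1}(\mathcal T_h)$, and $\Pi_{Q_h}$ is the $L^2(\Omega)$-orthogonal projection onto $Q_h$. $\mathcal V_h$ is the set of mesh vertices, split into interior vertices $\mathcal V_h^{\rm int}$ and boundary vertices $\mathcal V_h^{\rm ext}$. For $\mathbf a\in\mathcal V_h$, $\psi_{\mathbf a}$ is the piecewise affine hat function equal to $1$ at $\mathbf a$ and $0$ at the other vertices, $\omega_{\mathbf a}$ is the open subdomain formed by the elements sharing $\mathbf a$, with outward unit normal $\mathbf n_{\omega_{\mathbf a}}$; $\mathbf V_h(\omega_{\mathbf a})$, $Q_h(\omega_{\mathbf a})$ are the restrictions to $\omega_{\mathbf a}$. For $\mathbf a\in\mathcal V_h^{\rm int}$: $\mathbf V_h^{\mathbf a}:=\{\mathbf v_h\in\mathbf V_h(\omega_{\mathbf a}):\mathbf v_h\cdot\mathbf n_{\omega_{\mathbf a}}=0\text{ on }\partial\omega_{\mathbf a}\}$. For $\mathbf a\in\mathcal V_h^{\rm ext}$: $\mathbf V_h^{\mathbf a}:=\{\mathbf v_h\in\mathbf V_h(\omega_{\mathbf a}):\mathbf v_h\cdot\mathbf n_{\omega_{\mathbf a}}=0\text{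 on }\partial\omega_{\mathbf a}\setminus\partial\Omega\}$. Define $\boldsymbol\sigma_{ih}:=\sum_{\mathbf a\in\mathcal V_h}\boldsymbol\sigma_{ih}^{\mathbf a}\in\mathbf V_h$ (extending by zero outside $\omega_{\mathbf a}$), where $\boldsymbol\sigma_{ih}^{\mathbf a}$ is the minimizer of $\|\psi_{\mathbf a}\nabla\varphi_{ih}+\mathbf v_h\|_{\omega_{\mathbf a}}$ over all $\mathbf v_h\in\mathbf V_h^{\mathbf a}$ with $\nabla\cdot\mathbf v_h=\Pi_{Q_h}(\lambda_{ih}\varphi_{ih}\psi_{\mathbf a}-\nabla\varphi_{ih}\cdot\nabla\psi_{\mathbf a})$. Source problems. $r_{(ih)}\in H^1_0(\Omega)$ is defined by $(\nabla r_{(ih)},\nabla v)=\lambda_{ih}(\varphi_{ih},v)-(\nabla\varphi_{ih},\nabla v)$ for all $v\in H^1_0(\Omega)$, and $\zeta_{(ih)}\in H^1_0(\Omega)$ by $(\nabla\zeta_{(ih)},\nabla v)=(r_{(ih)},v)$ for all $v\in H^1_0(\Omega)$. *)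

(* Defs.v *)
From HB Require Import structures.
From mathcomp Require Import all_boot all_order all_algebra.
From mathcomp Require Import -(notations) multinomials.mpoly.
From mathcomp Require Import all_classical all_reals all_analysis.
Set Implicit Arguments.
Unset Strict Implicit.
Unset Printing Implicit Defensive.
Import Order.TTheory GRing.Theory Num.Theory.
Import numFieldNormedType.Exports.
Local Open Scope classical_set_scope.
Local Open Scope ring_scope.

Definition measure_rV_display : measure_display -> measure_display.
Proof. exact. Qed.

Section measurable_rV.
Context {d : measure_display} {T : measurableType d}.
Variable n : nat.
Let coord_rV (i : 'I_n) (x : 'rV[T]_n) : T := x ord0 i.
Let rV_set0 : g_sigma_preimage coord_rV set0.
Proof. exact: sigma_algebra0. Qed.
Let rV_setC A : g_sigma_preimage coord_rV A -> g_sigma_preimage coord_rV (~` A).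
Proof. exact: sigma_algebraC. Qed.
Let rV_bigcup (F : _^nat) : (forall i, g_sigma_preimage coord_rV (F i)) ->
  g_sigma_preimage coord_rV (\bigcup_i (F i)).
Proof. exact: sigma_algebra_bigcup. Qed.
HB.instance Definition _ := @isMeasurable.Build (measure_rV_display d)
  'rV[T]_n (g_sigma_preimage coord_rV) rV_set0 rV_setC rV_bigcup.
End measurable_rV.


Lemma measurable_coord_rV d (T : measurableType d) n (i : 'I_n) :
  measurable_fun [set: 'rV[T]_n] (fun x : 'rV[T]_n => x ord0 i).
Proof.
move=> _ Y mY; rewrite setTI; apply: sub_sigma_algebra => /=.
rewrite -bigcup_seq/=; exists i => /=; first by rewrite mem_index_enum.
by exists Y => //; rewrite setTI.
Qed.

Lemma measurable_fun_rV d1 d2 (T1 : measurableType d1) (T2 : measurableType d2)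
    n (f : T1 -> 'rV[T2]_n) :
  (forall i, measurable_fun [set: T1] (fun x => f x ord0 i)) ->
  measurable_fun [set: T1] f.
Proof.
move=> mf _ Y mY; rewrite setTI.
suff : g_sigma_preimage (fun (i : 'I_n) (x : 'rV[T2]_n) => x ord0 i) `<=`
    image_set_system setT f measurable.
  by move=> /(_ _ mY); rewrite /image_set_system/= setTI.
apply: smallest_sub; first exact/sigma_algebra_image/sigma_algebra_measurable.
rewrite -bigcup_seq => Z [i _ [A mA <-]]; rewrite /image_set_system/= !setTI.
by have := mf i measurableT A mA; rewrite setTI.
Qed.

Section lebesgue_rV.
Context (R : realType).

Let cons_rV n (p : measurableTypeR R * 'rV[R]_n) : 'rV[R]_n.+1 := row_mx p.1%:M p.2.
Let uncons_rV n (x : 'rV[R]_n.+1) : measurableTypeR R * 'rV[R]_n :=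
  (x ord0 ord0, rsubmx (x : 'rV[R]_(1 + n))).

Let cons_rVK n : cancel (@cons_rV n) (@uncons_rV n).
Proof.
move=> [a v]; rewrite /uncons_rV /cons_rV/= row_mxKr; congr pair.
have := row_mxEl (a%:M : 'M[R]_1) v ord0 ord0; rewrite [RHS]mxE eqxx mulr1n.
by move=> av; rewrite -[RHS]av; apply: (f_equal (row_mx _ _ _)); exact: val_inj.
Qed.

Let measurable_cons_rV n : measurable_fun setT (@cons_rV n).
Proof.
apply: measurable_fun_rV => i.
case: (split_ordP (i : 'I_(1 + n))) => j ->.
  rewrite (_ : (fun _ => _) = fst) //; apply/funext => p.
  by rewrite (row_mxEl p.1%:M p.2 ord0 j) mxE !ord1 eqxx mulr1n.
rewrite (_ : (fun _ => _) = (fun v : 'rV[R]_n => v ord0 j) \o snd).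
  exact: measurableT_comp (measurable_coord_rV j) measurable_snd.
by apply/funext => p; rewrite (row_mxEr p.1%:M p.2 ord0 j).
Qed.

Let measurable_uncons_rV n : measurable_fun setT (@uncons_rV n).
Proof.
apply/measurable_fun_pairP; split; first exact: measurable_coord_rV.
apply: measurable_fun_rV => i.
rewrite (_ : (fun _ => _) = (fun x : 'rV[R]_n.+1 => x ord0 (rshift 1 i))).
  exact: measurable_coord_rV.
by apply/funext => x /=; rewrite mxE.
Qed.

Section prod_rV.
Variables (n : nat) (nu : {sigma_finite_measure set (measurableTypeR R) -> \bar R})
  (mu : {sigma_finite_measure set 'rV[R]_n -> \bar R}).

Definition prod_rV : set 'rV[R]_n.+1 -> \bar R :=
  pushforward (nu \x mu)%E (@cons_rV n).

Let prod0 : prod_rV set0 = 0%E.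
Proof. by rewrite /prod_rV /pushforward preimage_set0 measure0. Qed.

Let prod_ge0 A : (0 <= prod_rV A)%E.
Proof. exact: (measure_ge0 (nu \x mu)%E). Qed.

Let mcons A : measurable A -> measurable (@cons_rV n @^-1` A).
Proof. by move=> mA; rewrite -[X in measurable X]setTI; exact: measurable_cons_rV. Qed.

Let prod_sigma_additive : semi_sigma_additive prod_rV.
Proof.
move=> F mF tF mUF; rewrite /prod_rV /pushforward preimage_bigcup.
apply: measure_semi_sigma_additive.
- by move=> k; exact: mcons.
- apply/trivIsetP => /= i j _ _ ij; rewrite -preimage_setI.
  by move/trivIsetP : tF => /(_ _ _ _ _ ij) ->//; rewrite preimage_set0.
- by rewrite -preimage_bigcup; exact: mcons.
Qed.

HB.instance Definition _ := isMeasure.Build _ _ _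
  prod_rV prod0 prod_ge0 prod_sigma_additive.

Let prod_sigma_finite : sigma_finite setT prod_rV.
Proof.
have /sigma_finiteP[F [TF ndF Foo]] := sigma_finiteT nu.
have /sigma_finiteP[G [TG ndG Goo]] := sigma_finiteT mu.
exists (fun k => @uncons_rV n @^-1` (F k `*` G k)).
  rewrite -preimage_bigcup -[LHS](preimage_setT (@uncons_rV n)).
  congr (_ @^-1` _); rewrite -setXTT TF TG predeqE => -[x y]; split.
    move=> [/= [k _ Fkx] [l _ Gly]]; exists (maxn k l) => //; split.
    - by move: x Fkx; exact/subsetPset/ndF/leq_maxl.
    - by move: y Gly; exact/subsetPset/ndG/leq_maxr.
  by move=> [k _ []/= ? ?]; split; exists k.
move=> k; have [mF Fk] := Foo k; have [mG Gk] := Goo k; split.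
  rewrite -[X in measurable X]setTI.
  by apply: measurable_uncons_rV => //; exact: measurableX.
rewrite /prod_rV /pushforward (_ : _ @^-1` _ = F k `*` G k).
  by rewrite product_measure1E// lte_mul_pinfty// ge0_fin_numE.
by rewrite -comp_preimage (_ : _ \o _ = id)//; apply/funext => p; exact: cons_rVK.
Qed.

HB.instance Definition _ := Measure_isSigmaFinite.Build _ _ _
  prod_rV prod_sigma_finite.

End prod_rV.

(* Lebesgue measure on R^n as an iterated product, transported along
   (a, x) |-> row_mx a x *)
Fixpoint lebesgue_rV n : {sigma_finite_measure set 'rV[R]_n -> \bar R} :=
  match n with
  | 0 => \d_(0 : 'rV[R]_0)
  | n'.+1 => prod_rV lebesgue_measure (lebesgue_rV n')
  end.


End lebesgue_rV.

Section function_spaces.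
Context {R : realType} {d : nat}.
Notation E := ('rV[R]_d).
Notation mu := (lebesgue_rV R d).
Implicit Types (w : set E) (f g v : E -> R) (F G : E -> E).

Definition dotv (x y : E) : R := \sum_(i < d) x ord0 i * y ord0 i.
(* the norm of the library on 'rV[R]_d is the maximum norm *)
Definition enorm (x : E) : R := Num.sqrt (dotv x x).

(* Elements of L2(w) are represented by Borel functions on R^d of which only
   the values on w matter; equality in L2(w) is [aeeq w] *)
Definition aeeq w (T : Type) (f g : E -> T) : Prop :=
  {ae mu, forall x, w x -> f x = g x}.

Definition L2 w : set (E -> R) := [set f : E -> R |
  measurable_fun w f /\ mu.-integrable w (fun x => (f x ^+ 2)%:E)].
Definition ip w f g : R := \int[mu]_(x in w) (f x * g x).
Definition normL2 w f : R := Num.sqrt (ip w f f).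

Definition L2v w : set (E -> E) := [set F : E -> E | forall i, L2 w (fun x => F x ord0 i)].
Definition ipv w F G : R := \int[mu]_(x in w) dotv (F x) (G x).
Definition normL2v w F : R := Num.sqrt (ipv w F F).

Definition pderivs (s : seq 'I_d) f : E -> R :=
  foldr (fun i g x => 'D_(delta_mx ord0 i) g x) f s.
Definition smooth f : Prop := forall s, continuous (pderivs s f) /\
  forall x i, derivable (pderivs s f) x (delta_mx ord0 i).
Definition test_function w f : Prop :=
  [/\ smooth f, compact (closure [set x | f x != 0])
    & closure [set x | f x != 0] `<=` w].
Definition cgrad f : E -> E := fun x => \row_i 'D_(delta_mx ord0 i) f x.

Definition is_wgrad w f G : Prop := L2v w G /\
  forall t, test_function w t -> forall i,
    ip w f (fun x => cgrad t x ord0 i) = - ip w (fun x => G x ord0 i) t.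
(* unique up to [aeeq w]; meaningful when f is in H1 w *)
Definition wgrad w f : E -> E := get [set G : E -> E | is_wgrad w f G].
Definition H1 w : set (E -> R) :=
  [set f : E -> R | L2 w f /\ exists G, is_wgrad w f G].
Definition H10 w : set (E -> R) := [set f : E -> R | H1 w f /\
  forall eps, 0 < eps -> exists2 t, test_function w t &
    normL2 w (f \- t) ^+ 2 + normL2v w (wgrad w (f \- t)) ^+ 2 < eps].

Definition is_wdiv w F g : Prop := L2 w g /\
  forall t, test_function w t -> ipv w F (cgrad t) = - ip w g t.
(* unique up to [aeeq w]; meaningful when F is in Hdiv w *)
Definition wdiv w F : E -> R := get [set g : E -> R | is_wdiv w F g].
Definition Hdiv w : set (E -> E) :=
  [set F : E -> E | L2v w F /\ exists g, is_wdiv w F g].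

Definition boundary w : set E := closure w `\` w°.

(* Normal trace on a part Gam of the boundary of w, in the sense of Green's
   formula <F.n, t> := (F, grad t)_w + (div F, t)_w, tested against the smooth
   functions whose support avoids the rest of the boundary *)
Definition normal_trace0 w (Gam : set E) F : Prop :=
  forall t, test_function (~` (boundary w `\` Gam)) t ->
    ipv w F (cgrad t) + ip w (wdiv w F) t = 0.

(* Sobolev-Slobodeckij spaces H^(1+delta), 0 < delta <= 1 *)
Definition slobodeckij (delta : R) w f : \bar R :=
  (\int[mu \x mu]_(z in w `*` w)
     ((f z.1 - f z.2) ^+ 2 / enorm (z.1 - z.2) `^ (d%:R + 2 * delta))%:E)%E.
Definition dpart w f (i : 'I_d) : E -> R := fun x => wgrad w f x ord0 i.
Definition H1plus (delta : R) w : set (E -> R) := [set f : E -> R | H1 w f /\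
  forall i, if delta == 1 then H1 w (dpart w f i)
            else (slobodeckij delta w (dpart w f i) < +oo)%E].
Definition H1plus_seminorm (delta : R) w f : R :=
  Num.sqrt (\sum_(i < d)
    if delta == 1 then normL2v w (wgrad w (dpart w f i)) ^+ 2
    else fine (slobodeckij delta w (dpart w f i))).

(* w is locally the strict epigraph of a Lipschitz function in the direction
   e; y - (y.e) e is the orthogonal projection on the hyperplane e^perp *)
Definition lipschitz_boundary w : Prop := forall x, boundary w x ->
  exists (e : E) (gam : E -> R) (r : R),
    [/\ enorm e = 1, 0 < r, [lipschitz gam y | y in setT] &
      forall y, enorm (y - x) < r ->
        (w y <-> gam (y - dotv y e *: e) < dotv y e)].
Definition polyhedral_domain w : Prop :=
  [/\ open w, connected w, w !=set0, bounded_set w &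
    exists s : seq (E * R), (forall q, q \in s -> q.1 != 0) /\
      forall x, boundary w x -> exists2 q, q \in s & dotv q.1 x = q.2].

Definition orthonormal_on w (K : set nat) (u : nat -> E -> R) : Prop :=
  forall j k, K j -> K k -> ip w (u j) (u k) = (j == k)%:R.

(* indices start from 1; the last clause is completeness in L2(w), so that lam
   lists all the eigenvalues with multiplicity *)
Definition dirichlet_eigenbasis w (lam : nat -> R) (u : nat -> E -> R) : Prop :=
  [/\ forall k, (1 <= k)%N -> H10 w (u k),
      forall j k, (1 <= j <= k)%N -> lam j <= lam k,
      forall k v, (1 <= k)%N -> H10 w v ->
        ipv w (wgrad w (u k)) (wgrad w v) = lam k * ip w (u k) v,
      orthonormal_on w [set k | (1 <= k)%N] u &
      forall v, L2 w v ->
        normL2 w (fun x => v x - \sum_(1 <= k < n.+1) ip w v (u k) * u k x)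
          @[n --> \oo] --> (0 : R)].

Definition has_dim w (V : set (E -> R)) (n : nat) : Prop :=
  exists b : 'I_n -> E -> R, (forall i, V (b i)) /\
    forall v, V v -> exists! c : 'rV[R]_n,
      aeeq w v (fun x => \sum_(i < n) c ord0 i * b i x).

Definition galerkin_eigenpairs w (V : set (E -> R)) (n : nat)
    (lam : nat -> R) (u : nat -> E -> R) : Prop :=
  [/\ forall k, (1 <= k <= n)%N -> V (u k) /\ 0 <= lam k,
      forall j k, (1 <= j <= k)%N -> (k <= n)%N -> lam j <= lam k,
      forall k v, (1 <= k <= n)%N -> V v ->
        ipv w (wgrad w (u k)) (wgrad w v) = lam k * ip w (u k) v &
      orthonormal_on w [set k | (1 <= k <= n)%N] u].

Definition L2proj w (Q : set (E -> R)) f : E -> R :=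
  get [set q : E -> R | Q q /\ forall g, Q g -> ip w q g = ip w f g].

(* polynomial functions of total degree at most s: msize is degree + 1 *)
Definition polyfun (s : nat) : set (E -> R) := [set f : E -> R |
  exists2 P : mpoly d R, (msize P <= s.+1)%N &
    forall x, f x = meval (fun i => x ord0 i) P].

End function_spaces.

(* A simplicial mesh: an element is the set of its vertices *)
Record mesh (R : realType) (d : nat) := Mesh {
  vertex : finType ;
  pt : vertex -> 'rV[R]_d ;
  elements : {set {set vertex}} }.

Section finite_elements.
Context {R : realType} {d : nat}.
Notation E := ('rV[R]_d).
Notation mu := (lebesgue_rV R d).
Variable (T : mesh R d).
Implicit Types (Omega : set E) (K : {set vertex T}) (a : vertex T).

(* closed simplex (convex hull) spanned by the vertices in K *)
Definition hull K : set E := [set x | exists c : vertex T -> R,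
  [/\ forall a, 0 <= c a, forall a, a \notin K -> c a = 0,
      \sum_a c a = 1 & x = \sum_a c a *: pt a]].
Definition affinely_independent K : Prop := forall c : vertex T -> R,
  (forall a, a \notin K -> c a = 0) -> \sum_a c a = 0 ->
  \sum_a c a *: pt a = 0 -> forall a, c a = 0.

Definition matching_mesh Omega : Prop :=
  [/\ forall K, K \in elements T -> #|K| = d.+1 /\ affinely_independent K,
      forall K L, K \in elements T -> L \in elements T ->
        hull K `&` hull L = hull (K :&: L),
      closure Omega = \bigcup_(K in [set` elements T]) hull K &
      forall a, exists2 K, K \in elements T & a \in K].

Definition diam (A : set E) : R := sup [set enorm (z.1 - z.2) | z in A `*` A].
Definition inball_diam (A : set E) : R := sup [set 2 * rho | rho in
  [set rho | 0 < rho /\ exists x, forall y, enorm (y - x) < rho -> A y]].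
Definition shape_regular (kappa : R) : Prop := forall K, K \in elements T ->
  diam (hull K) / inball_diam (hull K) <= kappa.
Definition mesh_size : R :=
  \big[Num.max/0]_(K in elements T) diam (hull K).

Definition broken_poly Omega (s : nat) : set (E -> R) := [set f : E -> R |
  measurable_fun Omega f /\ forall K, K \in elements T ->
    exists2 q, polyfun s q & aeeq (hull K) f q].
Definition fe_space Omega (p : nat) : set (E -> R) :=
  broken_poly Omega p `&` H10 Omega.
(* Raviart-Thomas-Nedelec space of order s: [P_s]^d + P_s x on each element *)
Definition raviart_thomas Omega (s : nat) : set (E -> E) := [set F : E -> E |
  Hdiv Omega F /\ forall K, K \in elements T ->
    exists (q : 'I_d -> E -> R) (r : E -> R),
      [/\ forall i, polyfun s (q i), polyfun s r &
        aeeq (hull K) F (fun x => (\row_i q i x) + r x *: x)]].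

Definition is_hat a (psi : E -> R) : Prop := forall K, K \in elements T ->
  (exists2 q, polyfun 1 q & forall x, hull K x -> psi x = q x) /\
  forall b, b \in K -> psi (pt b) = (b == a)%:R.

Definition vertex_patch a : set E :=
  (\bigcup_(K in [set K | K \in elements T /\ a \in K]) hull K)°.

Definition patch_flux Omega (s : nat) a : set (E -> E) := [set F : E -> E |
  [/\ exists2 G, raviart_thomas Omega s G & forall x, vertex_patch a x -> F x = G x,
      Omega (pt a) -> normal_trace0 (vertex_patch a) (boundary (vertex_patch a)) F &
      boundary Omega (pt a) ->
        normal_trace0 (vertex_patch a) (boundary (vertex_patch a) `\` boundary Omega) F]].

Definition admissible_flux Omega (p : nat) (lam : R) (u psi : E -> R) a :
    set (E -> E) := [set F : E -> E | patch_flux Omega p.+1 a F /\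
  aeeq (vertex_patch a) (wdiv (vertex_patch a) F)
    (L2proj Omega (broken_poly Omega p.+1) (fun x => lam * u x * psi x
       - dotv (wgrad Omega u x) (wgrad Omega psi x)))].
Definition is_local_flux Omega (p : nat) (lam : R) (u psi : E -> R) a
    (F : E -> E) : Prop :=
  admissible_flux Omega p lam u psi a F /\
  forall G, admissible_flux Omega p lam u psi a G ->
    normL2v (vertex_patch a) (fun x => psi x *: wgrad Omega u x + F x) <=
    normL2v (vertex_patch a) (fun x => psi x *: wgrad Omega u x + G x).

Definition flux (Fa : vertex T -> E -> E) : E -> E :=
  fun x => \sum_a \1_(vertex_patch a) x *: Fa a x.

End finite_elements.

(* Main.v *)
Require Import Defs.
From HB Require Import structures.
From mathcomp Require Import all_boot all_order all_algebra.
From mathcomp Require Import -(notations) multinomials.mpoly.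
From mathcomp Require Import all_classical all_reals all_analysis measurable_realfun.
From mathcomp Require Import ring lra.
Set Implicit Arguments.
Unset Strict Implicit.
Unset Printing Implicit Defensive.
Import Order.TTheory GRing.Theory Num.Theory.
Import numFieldNormedType.Exports.
Local Open Scope classical_set_scope.
Local Open Scope ring_scope.

(* Expand phi_ih in the exact eigenfunctions, c_ik = (phi_ih, phi_k).  Discrete
   orthonormality and Bessel give sum_i c_ik^2 <= 1 inside the cluster, and Parseval in the
   energy norm gives lambda_ih = sum_k lambda_k c_ik^2, so that
     sum_i (lambda_ih - lambda_i) <= sum_i sum_(k outside the cluster) lambda_k c_ik^2.
   Testing the residual of (phi_ih, lambda_ih) with combinations of the phi_k yields
     sum_k (lambda_ih - lambda_k)^2 c_ik^2 / lambda_k <= |grad phi_ih + sigma_ih|^2,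
   because the flux is equilibrated: (sigma_ih, grad v) + lambda_ih (phi_ih, v) = 0 for v in
   H^1_0.  Outside the cluster lambda_k <= c_h |lambda_ih - lambda_k|, which proves Case I.  In
   Case II, lambda_k c^2 <= (lambda_ih - lambda_k)^2 c^2 / lambda_k + 2 lambda_ih c^2, and the
   sum of the last terms is controlled by |r_(ih)|^2, hence by h^(2 delta) |grad r_(ih)|^2
   (Aubin-Nitsche).

   The equilibration is the sum over the vertices of the Green formulas on the patches: the
   prescribed divergences lambda phi psi_a - grad phi . grad psi_a are already in P_(p+1)(T_h),
   so the projection is the identity, and they sum to lambda phi since the psi_a sum to 1. *)

(** * Lebesgue measure on R^n *)

(** Weak gradients are values picked by [get], so nothing can be computed with them before
    uniqueness almost everywhere is known. Uniqueness rests on the fundamental lemma, hence on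
    explicit bump functions; integration by parts rests on translation invariance of the
    iterated-product Lebesgue measure. The boundary of a polyhedral domain and the skeleton of a
    mesh lie in finitely many hyperplanes, which are null, so pointwise identities are checked in
    open cells only. The lower bound 0 is the min-max comparison of exact and Galerkin eigenvalues.
    In the upper bound the estimates are made on partial sums over k, and only the energy expansion
    is passed to the limit. The exact eigenvalues enter as nonnegative numbers; where one equals 0,
    the convention 0^-1 = 0 makes the terms weighted by its inverse vanish. *)

Section lebesgue_rV_theory.
Context {R : realType}.
Implicit Types n : nat.

Lemma measurable_row_mx n :
  measurable_fun setT (fun p : R * 'rV[R]_n => row_mx (p.1%:M : 'M[R]_1) p.2).
Proof.
apply: measurable_fun_rV => i.
case: (split_ordP (i : 'I_(1 + n))) => j ->.
  rewrite (_ : (fun _ => _) = fst) //; apply/funext => q.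
  by rewrite (row_mxEl q.1%:M q.2) mxE !ord1 eqxx mulr1n.
rewrite (_ : (fun _ => _) = (fun v : 'rV[R]_n => v ord0 j) \o snd).
  exact: measurableT_comp (measurable_coord_rV j) measurable_snd.
by apply/funext => q; rewrite (row_mxEr q.1%:M q.2).
Qed.

(** Slicing along the first coordinate: a pushforward of a product measure is an integral of
    measures of sections. The inductions on the dimension (translations, hyperplanes, cubes) all
    start here. *)
Lemma lebesgue_rVS n (A : set 'rV[R]_n.+1) :
  lebesgue_rV R n.+1 A = (\int[@lebesgue_measure R]_a
    lebesgue_rV R n [set w | A (row_mx (a%:M : 'M[R]_1) w)])%E.
Proof.
rewrite /= /prod_rV /pushforward /product_measure1 /=.
apply: eq_integral => a _; apply: (f_equal (fun S => lebesgue_rV R n S)).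
by rewrite /xsection; apply/seteqP; split => w /=; rewrite inE.
Qed.

Lemma row_mxK1 n (x : 'rV[R]_n.+1) :
  row_mx ((x ord0 ord0)%:M : 'M[R]_1) (rsubmx (x : 'rV[R]_(1 + n))) = x.
Proof.
rewrite -[RHS](hsubmxK (x : 'rV[R]_(1 + n))).
suff -> : (x ord0 ord0)%:M = lsubmx (x : 'rV[R]_(1 + n)) :> 'M[R]_1 by [].
apply/matrixP => i j.
by rewrite !ord1 !mxE eqxx mulr1n; congr (x _ _); exact: val_inj.
Qed.

Lemma row_mx_scalar0 n (a : R) (w : 'rV[R]_n) :
  row_mx (a%:M : 'M[R]_1) w ord0 (ord0 : 'I_n.+1) = a.
Proof.
rewrite (_ : ord0 = @lshift 1 n ord0); last exact: val_inj.
by rewrite (row_mxEl (a%:M : 'M[R]_1) w) mxE eqxx mulr1n.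
Qed.

Lemma row_mx_scalarS n (a : R) (w : 'rV[R]_n) j :
  row_mx (a%:M : 'M[R]_1) w ord0 (lift ord0 j : 'I_n.+1) = w ord0 j.
Proof.
rewrite (_ : lift ord0 j = @rshift 1 n j); last exact: val_inj.
by rewrite (row_mxEr (a%:M : 'M[R]_1) w).
Qed.

Lemma row_mx_addr n (a : R) (w : 'rV[R]_n) (v : 'rV[R]_n.+1) :
  row_mx (a%:M : 'M[R]_1) w + v =
  row_mx ((a + v ord0 ord0)%:M : 'M[R]_1) (w + rsubmx (v : 'rV[R]_(1 + n))).
Proof.
apply/rowP => i; rewrite mxE.
case: (unliftP ord0 i) => [j ->|->]; last by rewrite !row_mx_scalar0.
rewrite !row_mx_scalarS !mxE; congr (_ + v _ _); exact: val_inj.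
Qed.

Lemma measurable_addr_rV n (v : 'rV[R]_n) :
  measurable_fun setT (fun x : 'rV[R]_n => x + v).
Proof.
apply: measurable_fun_rV => i.
rewrite (_ : (fun _ => _) = (fun x : 'rV[R]_n => x ord0 i + v ord0 i)).
  by apply: measurable_funD => //; exact: measurable_coord_rV.
by apply/funext => x; rewrite mxE.
Qed.

Lemma measurable_lebesgue_rV_section n (A : set 'rV[R]_n.+1) : measurable A ->
  measurable_fun setT
    (fun a : R => lebesgue_rV R n [set w | A (row_mx (a%:M : 'M[R]_1) w)]).
Proof.
move=> mA; pose B := [set p : R * 'rV[R]_n | A (row_mx (p.1%:M : 'M[R]_1) p.2)].
have mB : measurable B.
  by rewrite -[B]setTI; exact: measurable_row_mx.
have := measurable_fun_xsection (lebesgue_rV R n) mB.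
rewrite (_ : _ \o _ = fun a => lebesgue_rV R n [set w | A (row_mx (a%:M : 'M[R]_1) w)])//.
apply/funext => a /=; apply: (f_equal (fun S => lebesgue_rV R n S)).
by rewrite /xsection; apply/seteqP; split => w /=; rewrite inE.
Qed.

(** The translated measure agrees with Lebesgue measure on half-open intervals, which determine
    it. *)
Lemma lebesgue_measure_addr (v : R) (A : set R) : measurable A ->
  lebesgue_measure [set x | A (x + v)] = lebesgue_measure A.
Proof.
move=> mA.
have mv : measurable_fun setT (fun x : measurableTypeR R => (x + v : measurableTypeR R)).
  by apply: measurable_funD.
pose phi : {mfun _ >-> _} := HB.pack (fun x : measurableTypeR R => (x + v : measurableTypeR R))
   (isMeasurableFun.Build _ _ _ _ _ mv).
apply/esym; rewrite -[RHS]/(pushforward lebesgue_measure phi A).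
apply: lebesgue_measure_unique => //= _ [[a b]] _ <-.
rewrite /pushforward (_ : _ @^-1` _ = `]a - v, b - v]%classic); last first.
  by apply/seteqP; split => x /=; rewrite !in_itv/= ltrBlDr lerBrDr.
rewrite !lebesgue_measure_itv/= !lte_fin ltrD2r -!EFinB.
by have -> : b - v - (a - v) = b - a by rewrite opprB addrA subrK.
Qed.

Lemma ge0_integral_lebesgue_addr (v : R) (f : R -> \bar R) :
  measurable_fun setT f -> (forall x, 0 <= f x)%E ->
  (\int[@lebesgue_measure R]_x f ((x : R) + v)%R = \int[@lebesgue_measure R]_x f x)%E.
Proof.
move=> mf f0.
have mv : measurable_fun setT (fun x : measurableTypeR R => (x + v : measurableTypeR R)).
  by apply: measurable_funD.
pose phi : {mfun _ >-> _} := HB.pack (fun x : measurableTypeR R => (x + v : measurableTypeR R))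
   (isMeasurableFun.Build _ _ _ _ _ mv).
have := @ge0_integral_pushforward _ _ _ _ R phi mv (@lebesgue_measure R)
  setT f measurableT mf (fun y _ => f0 y).
rewrite preimage_setT => <-.
by apply: eq_measure_integral => A mA _; exact: lebesgue_measure_addr.
Qed.

(** The slices of a translated set are slices of the set, taken at a shifted abscissa and translated
    by the tail of [v]: the induction hypothesis handles the tail, a change of variable the
    abscissa. *)
Lemma lebesgue_rV_addr n (v : 'rV[R]_n) (A : set 'rV[R]_n) : measurable A ->
  lebesgue_rV R n [set x | A (x + v)] = lebesgue_rV R n A.
Proof.
elim: n v A => [v A _|n IH v A mA].
  by apply: (f_equal (fun S => lebesgue_rV R 0 S)); apply/seteqP; split => x /=;
    rewrite (_ : x + v = x)//; apply/matrixP => i [].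
rewrite !lebesgue_rVS.
pose F a := lebesgue_rV R n [set w | A (row_mx (a%:M : 'M[R]_1) w)].
have mF : measurable_fun setT F by exact: measurable_lebesgue_rV_section.
have F0 a : (0 <= F a)%E by exact: measure_ge0.
rewrite -(ge0_integral_lebesgue_addr (v ord0 ord0) mF F0).
apply: eq_integral => a _.
have mS : measurable [set w | A (row_mx ((a + v ord0 ord0)%:M : 'M[R]_1) w)].
  have mB := @measurable_row_mx n measurableT _ mA; rewrite setTI in mB.
  have := measurable_xsection (a + v ord0 ord0) mB.
  rewrite /xsection (_ : [set y | _] = [set w | A (row_mx (a + v ord0 ord0)%:M w)])//.
  by apply/seteqP; split => w /=; rewrite inE.
rewrite -[RHS](IH (rsubmx (v : 'rV[R]_(1 + n))) _ mS).
apply: (f_equal (fun S => lebesgue_rV R n S)).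
by apply/seteqP; split => w /=; rewrite row_mx_addr.
Qed.

Lemma dotv_row_mx n (v : 'rV[R]_n.+1) a w :
  dotv v (row_mx (a%:M : 'M[R]_1) w) =
  v ord0 ord0 * a + dotv (rsubmx (v : 'rV[R]_(1 + n))) w.
Proof.
rewrite /dotv big_ord_recl row_mx_scalar0; congr (_ + _).
apply: eq_bigr => i _; rewrite row_mx_scalarS mxE; congr (v _ _ * _).
exact: val_inj.
Qed.

Lemma measurable_dotv n (v : 'rV[R]_n) : measurable_fun setT (dotv v).
Proof.
apply: measurable_sum => i; apply: measurable_funM => //.
exact: measurable_coord_rV.
Qed.

Lemma measurable_hyperplane n (v : 'rV[R]_n) (c : R) :
  measurable [set x | dotv v x = c].
Proof.
rewrite (_ : mkset _ = setT `&` dotv v @^-1` [set c]); last by rewrite setTI.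
exact: measurable_dotv.
Qed.

(** If the tail of [v] is nonzero, every slice is a hyperplane of one dimension less; otherwise the
    only nonempty slice lies over a single point. Hyperplanes carry the boundary of the domain and
    the faces of the elements. *)
Lemma hyperplane_null n (v : 'rV[R]_n) (c : R) : v != 0 ->
  lebesgue_rV R n [set x | dotv v x = c] = 0%E.
Proof.
elim: n v c => [v c|n IH v c vn0]; first by rewrite (_ : v = 0) ?eqxx//; apply/matrixP => ? [].
rewrite lebesgue_rVS; have [v'0|v'n0] := eqVneq (rsubmx (v : 'rV[R]_(1 + n))) 0; last first.
  apply: integral0_eq => a _; rewrite -(IH _ (c - v ord0 ord0 * a) v'n0).
  apply: (f_equal (fun S => lebesgue_rV R n S)).
  apply/seteqP; split => w /=; rewrite dotv_row_mx => wc.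
    by rewrite -wc addrAC subrr add0r.
  by rewrite wc addrC subrK.
have v0 : v ord0 ord0 != 0.
  apply: contra vn0 => /eqP v0; apply/eqP; rewrite -(row_mxK1 v) v0 v'0.
  by rewrite raddf0 row_mx0.
pose F a := lebesgue_rV R n [set w | dotv v (row_mx (a%:M : 'M[R]_1) w) = c].
rewrite -[LHS]/(\int[lebesgue_measure]_a F a)%E.
rewrite (_ : F = F \_ [set c / v ord0 ord0]).
  by rewrite -integral_mkcond integral_set1.
apply/funext => a; rewrite patchE; case: ifPn => //; rewrite notin_setE => /= ac.
rewrite /F (_ : mkset _ = set0) ?measure0//; apply/seteqP; split => w //=.
rewrite dotv_row_mx v'0 (_ : dotv 0 w = 0) ?addr0; last first.
  by rewrite /dotv big1// => i _; rewrite mxE mul0r.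
by move=> vc; apply: ac; rewrite -vc mulrAC divff// mul1r.
Qed.

Definition cube n (c : 'rV[R]_n) (r : R) : set 'rV[R]_n :=
  [set x | forall i, `|x ord0 i - c ord0 i| < r].

Lemma measurable_coord_preimage n (P : 'I_n -> set R) :
  (forall i, measurable (P i)) -> measurable [set x : 'rV[R]_n | forall i, P i (x ord0 i)].
Proof.
move=> mP; rewrite (_ : mkset _ = \bigcap_(i in [set: 'I_n]) ((fun x : 'rV[R]_n => x ord0 i) @^-1` P i)).
  apply: fin_bigcap_measurable => // i _.
  by rewrite -[X in measurable X]setTI; exact: measurable_coord_rV.
by apply/seteqP; split => x /= xP i; [move=> _|]; exact: xP.
Qed.

Lemma measurable_cube n (c : 'rV[R]_n) (r : R) : measurable (cube c r).
Proof.
have := @measurable_coord_preimage n (fun i => [set t : R | `|t - c ord0 i| < r]).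
apply => i; rewrite (_ : mkset _ = ball (c ord0 i) r).
  exact: measurable_ball.
by apply/seteqP; split => t; rewrite /ball/= distrC.
Qed.

Lemma cube_finite n (r : R) : (lebesgue_rV R n (cube 0 r) < +oo)%E.
Proof.
elim: n => [|n IH]; first by rewrite /= diracE ltry.
rewrite lebesgue_rVS (_ : (fun _ => _) =
   (fun a => (\1_`]-r, r[ a)%:E * lebesgue_rV R n (cube 0 r))%E).
  rewrite ge0_integralZr//; last 1 first.
    exact/measurable_EFinP.
  rewrite integral_indic// setIT lte_mul_pinfty//=.
    by rewrite lebesgue_measure_itv/=; case: ifP.
apply/funext => a; rewrite indicE.
case: (boolP (_ \in _)); rewrite ?inE ?notin_setE/= in_itv/= -ltr_norml => ar; last first.
  rewrite mul0e (_ : mkset _ = set0) ?measure0//; apply/seteqP; split => w //=.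
  by move=> /(_ ord0); rewrite row_mx_scalar0 mxE subr0.
rewrite mul1e; apply: (f_equal (fun S => lebesgue_rV R n S)).
apply/seteqP; split => w /= wr i.
  by have := wr (lift ord0 i); rewrite row_mx_scalarS !mxE.
case: (unliftP ord0 i) => [j ->|->]; last by rewrite row_mx_scalar0 mxE subr0.
by rewrite row_mx_scalarS mxE; have := wr j; rewrite mxE.
Qed.

(** Countability comes from rational centres and radii 1/(k+1), coded by [pickle]; [None] marks an
    index that codes no admissible cube. Requiring the doubled cube to lie in U leaves room for the
    closed supports of bump functions. *)
Lemma open_cubes n (U : set 'rV[R]_n) : open U ->
  exists f : nat -> option ('rV[R]_n * R),
  (forall k c r, f k = Some (c, r) -> 0 < r /\ forall x, cube c (2 * r) x -> U x) /\
  U = \bigcup_k (if f k is Some (c, r) then cube c r else set0).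
Proof.
move=> oU.
pose ok (p : 'rV[rat]_n * nat) : Prop :=
  cube (map_mx ratr p.1) (2 * p.2.+1%:R^-1) `<=` U.
pose f k := if @unpickle ('rV[rat]_n * nat)%type k is Some p then
  if `[< ok p >] then Some (map_mx ratr p.1 : 'rV[R]_n, p.2.+1%:R^-1 : R) else None else None.
have fE k c r : f k = Some (c, r) -> 0 < r /\ cube c (2 * r) `<=` U.
  rewrite /f; case: unpickle => // q; case: asboolP => // okq [<- <-].
  by rewrite invr_gt0.
exists f; split; first by move=> k c r /fE[r0 rU]; split => // x; exact: rU.
apply/seteqP; split => [x Ux|x [k _]]; last first.
  case E : (f k) => [[c r]|] //; have [r0 rU] := fE _ _ _ E => xc; apply: rU => i.
  by apply: (lt_trans (xc i)); rewrite mulr_natl mulr2n ltrDl.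
move: oU; rewrite openE => /(_ _ Ux) /nbhs_ballP[e /= e0 xe].
(* With a centre closer than 1/(k+1) to x, the doubled cube stays within 3/(k+1) of x. *)
have [k ke] : exists k : nat, k.+1%:R^-1 * 3 < e.
  exists (Num.truncn (3 / e)); rewrite mulrC ltr_pdivrMr// mulrC -ltr_pdivrMr//.
  by apply: truncnS_gt.
pose eps : R := k.+1%:R^-1.
have eps0 : 0 < eps by rewrite invr_gt0.
have /choice[q qx] : forall i : 'I_n, exists q : rat, `|ratr q - x ord0 i| < eps.
  move=> i; have xx : x ord0 i - eps < x ord0 i + eps.
    by rewrite ltrBlDr -addrA ltrDl addr_gt0.
  have [q] := rat_in_itvoo xx; rewrite in_itv/= => /andP[q1 q2]; exists q.
  by rewrite ltr_distl q1 q2.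
pose p0 : 'rV[rat]_n * nat := (\row_i q i, k).
have okp0 : ok p0.
  move=> y yq; apply: xe; split=> // i j; rewrite !ord1 /ball/=.
  apply: le_lt_trans ke.
  rewrite -(subrK (ratr (q j)) (x ord0 j)) -addrA.
  apply: (le_trans (ler_normD _ _)).
  rewrite (_ : 3 = 1 + 2)// mulrDr mulr1 lerD//.
    by rewrite ltW// distrC.
  rewrite distrC mulrC ltW//.
  by have := yq j; rewrite !mxE.
exists (pickle p0) => //; rewrite /f pickleK; case: asboolP => // _ i.
by rewrite !mxE distrC; exact: qx.
Qed.

(** The sigma-algebra is generated by the coordinates, not by the topology; the countable cover by
    cubes links the two. *)
Lemma open_measurable_rV n (U : set 'rV[R]_n) : open U -> measurable U.
Proof.
move=> /open_cubes[f [_ ->]]; apply: bigcupT_measurable => k.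
by case: (f k) => [[c r]|]; [exact: measurable_cube|exact: measurable0].
Qed.

Lemma closed_measurable_rV n (U : set 'rV[R]_n) : closed U -> measurable U.
Proof.
move=> cU; rewrite -(setCK U); apply: measurableC; apply: open_measurable_rV.
exact: closed_openC.
Qed.

Lemma continuous_measurable_rV n (f : 'rV[R]_n -> R) :
  continuous f -> measurable_fun setT f.
Proof.
move=> cf; apply: (measurability _ (RGenOpens.measurableE R)).
move=> _ [_ [a [b ->] <-]]; rewrite setTI; apply: open_measurable_rV.
by apply: open_comp => [x _|]; [exact: cf|exact: interval_open].
Qed.

End lebesgue_rV_theory.

(** * The space L2 *)

Section l2_theory.
Context {R : realType} {d : nat}.
Notation E := ('rV[R]_d).
Notation mu := (lebesgue_rV R d).
Variable w : set E.
Hypothesis mw : measurable w.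
Implicit Types (f g h : E -> R) (F G H : E -> E).

Lemma aeeq_trans T (f g h : E -> T) : aeeq w f g -> aeeq w g h -> aeeq w f h.
Proof. by apply: filterS2 => x fg gh wx; rewrite fg// gh. Qed.

Lemma aeeqS T (w' : set E) (f g : E -> T) :
  w' `<=` w -> aeeq w f g -> aeeq w' f g.
Proof. by move=> ww'; apply: filterS => x fg wx; apply: fg; exact: ww'. Qed.

Lemma L2_measurable f : L2 w f -> measurable_fun w f.
Proof. by case. Qed.

Lemma L2M_integrable f g : L2 w f -> L2 w g ->
  mu.-integrable w (EFin \o (fun x => f x * g x)).
Proof.
move=> [mf f2] [mg g2].
apply: (le_integrable mw _ _ (integrableD mw f2 g2)).
  by apply/measurable_EFinP; exact: measurable_funM.
move=> x wx /=; rewrite lee_fin.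
have f2g2 : 0 <= f x ^+ 2 + g x ^+ 2 by rewrite addr_ge0// sqr_ge0.
rewrite (ger0_norm f2g2) ler_norml.
have := sqr_ge0 (f x + g x); have := sqr_ge0 (f x - g x).
have := sqr_ge0 (f x); have := sqr_ge0 (g x).
by rewrite sqrrB sqrrD; lra.
Qed.

Lemma L20 : L2 w (fun=> 0).
Proof.
split; first exact: measurable_cst.
by under eq_fun do rewrite expr0n; exact: integrable0.
Qed.

Lemma L2Z a f : L2 w f -> L2 w (fun x => a * f x).
Proof.
move=> [mf f2]; split; first exact: measurable_funM.
have := integrableZl mw (a ^+ 2) f2.
by apply: eq_integrable => // x _; rewrite /= -EFinM exprMn.
Qed.

Lemma L2D f g : L2 w f -> L2 w g -> L2 w (fun x => f x + g x).
Proof.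
move=> Lf Lg; split; first by apply: measurable_funD; [case: Lf|case: Lg].
have h1 := integrableD mw (proj2 Lf) (proj2 Lg).
have h2 := integrableZl mw 2 (L2M_integrable Lf Lg).
have := integrableD mw h1 h2; apply: eq_integrable => // x _ /=.
by rewrite -EFinM -!EFinD sqrrD mulr_natl addrAC.
Qed.

Lemma L2N f : L2 w f -> L2 w (fun x => - f x).
Proof. by move=> /(L2Z (-1)); under eq_fun do rewrite mulN1r. Qed.

Lemma L2B f g : L2 w f -> L2 w g -> L2 w (fun x => f x - g x).
Proof. by move=> Lf Lg; apply: L2D => //; exact: L2N. Qed.

Lemma L2_sum (I : Type) (s : seq I) (P : pred I) (f : I -> E -> R) :
  (forall i, P i -> L2 w (f i)) -> L2 w (fun x => \sum_(i <- s | P i) f i x).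
Proof.
move=> Lf; elim: s => [|i s IH]; first by under eq_fun do rewrite big_nil; exact: L20.
under eq_fun do rewrite big_cons; case: (boolP (P i)) => // Pi.
by apply: L2D => //; exact: Lf.
Qed.

Lemma L2_ae f g : L2 w f -> measurable_fun w g -> aeeq w f g -> L2 w g.
Proof.
move=> [mf f2] mg fg; split => //.
have mg2 : measurable_fun w (fun x => (g x ^+ 2)%:E).
  by apply/measurable_EFinP; under eq_fun do rewrite expr2; exact: measurable_funM.
apply/integrableP; split => //; move/integrableP : f2 => [mf2].
apply: le_lt_trans; rewrite le_eqVlt; apply/orP; left; apply/eqP.
apply: ae_eq_integral => //; [exact: measurableT_comp|exact: measurableT_comp|].
by apply: filterS fg => x /= fg wx; rewrite fg.
Qed.

Lemma ipC f g : ip w f g = ip w g f.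
Proof. by rewrite /ip; under eq_Rintegral do rewrite mulrC. Qed.

Lemma ip_ae f f' g : measurable_fun w f -> measurable_fun w f' ->
  measurable_fun w g -> aeeq w f f' -> ip w f g = ip w f' g.
Proof.
move=> mf mf' mg ff'; congr fine; apply: ae_eq_integral => //.
- by apply/measurable_EFinP; exact: measurable_funM.
- by apply/measurable_EFinP; exact: measurable_funM.
- by apply: filterS ff' => x /= ff' wx; rewrite ff'.
Qed.

Lemma ipZl a f g : L2 w f -> L2 w g -> ip w (fun x => a * f x) g = a * ip w f g.
Proof.
move=> Lf Lg; rewrite -RintegralZl//; last exact: L2M_integrable.
by apply: eq_Rintegral => x _; rewrite mulrA.
Qed.

Lemma ipDl f g h : L2 w f -> L2 w g -> L2 w h ->
  ip w (fun x => f x + g x) h = ip w f h + ip w g h.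
Proof.
move=> Lf Lg Lh; rewrite -RintegralD//; try exact: L2M_integrable.
by apply: eq_Rintegral => x _; rewrite mulrDl.
Qed.

Lemma ipBl f g h : L2 w f -> L2 w g -> L2 w h ->
  ip w (fun x => f x - g x) h = ip w f h - ip w g h.
Proof.
move=> Lf Lg Lh; rewrite -RintegralB//; try exact: L2M_integrable.
by apply: eq_Rintegral => x _; rewrite mulrBl.
Qed.

Lemma ipZr a f g : L2 w f -> L2 w g -> ip w f (fun x => a * g x) = a * ip w f g.
Proof. by move=> *; rewrite ipC ipZl// ipC. Qed.

Lemma ipDr f g h : L2 w f -> L2 w g -> L2 w h ->
  ip w h (fun x => f x + g x) = ip w h f + ip w h g.
Proof. by move=> *; rewrite ipC ipDl// ipC (ipC g). Qed.

Lemma ipBr f g h : L2 w f -> L2 w g -> L2 w h ->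
  ip w h (fun x => f x - g x) = ip w h f - ip w h g.
Proof. by move=> *; rewrite ipC ipBl// ipC (ipC g). Qed.

Lemma ip0l g : ip w (fun=> 0) g = 0.
Proof. by rewrite /ip; under eq_Rintegral do rewrite mul0r; rewrite Rintegral_cst ?mul0r. Qed.

Lemma ip_suml (I : Type) (s : seq I) (P : pred I) (f : I -> E -> R) g :
  (forall i, P i -> L2 w (f i)) -> L2 w g ->
  ip w (fun x => \sum_(i <- s | P i) f i x) g = \sum_(i <- s | P i) ip w (f i) g.
Proof.
move=> Lf Lg; elim: s => [|i s IH].
  by under [in LHS]eq_fun do rewrite big_nil; rewrite big_nil ip0l.
under [in LHS]eq_fun do rewrite big_cons; rewrite big_cons; case: (boolP (P i)) => // Pi.
by rewrite ipDl ?IH//; [exact: Lf|exact: L2_sum].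
Qed.

Lemma ip_ge0 f : 0 <= ip w f f.
Proof. by apply: Rintegral_ge0 => x _; rewrite -expr2 sqr_ge0. Qed.

Lemma normL2_sqr f : normL2 w f ^+ 2 = ip w f f.
Proof. by rewrite sqr_sqrtr// ip_ge0. Qed.

Lemma ip_eq0 f : L2 w f -> ip w f f = 0 -> aeeq w f (fun=> 0).
Proof.
move=> Lf f0.
have i2 := L2M_integrable Lf Lf.
have : (\int[mu]_(x in w) `|(f x * f x)%:E| = 0)%E.
  under eq_integral do rewrite /= -expr2 ger0_norm ?sqr_ge0// expr2.
  by rewrite -(@fineK _ (\int[mu]_(x in w) _)%E) ?[fine _]f0//; exact: integrable_fin_num.
move/(ae_eq_integral_abs mu mw (measurable_int _ i2)).
by apply: filterS => x /= fx wx; have [/eqP] := fx wx; rewrite mulf_eq0 orbb => /eqP.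
Qed.

(** Cauchy-Schwarz in scalar form, shared by [ip] and [ipv]. The minimizer is t = - b / c; if c = 0
    and b is nonzero, t = - (a + 1) / (2 b) would give the value -1. *)
Lemma discriminant_le (a b c : R) : 0 <= a -> 0 <= c ->
  (forall t, 0 <= a + 2 * t * b + t ^+ 2 * c) -> b ^+ 2 <= a * c.
Proof.
move=> a0 c0 H; have [c00|cn0] := eqVneq c 0.
  have [->|bn0] := eqVneq b 0; first by rewrite expr0n mulr_ge0.
  have := H (- (a + 1) / (2 * b)); rewrite c00 mulr0 addr0.
  rewrite (_ : 2 * _ * b = - (a + 1)); first lra.
  by field.
have cp : 0 < c by rewrite lt_neqAle eq_sym cn0.
have := H (- b / c).
rewrite (_ : _ + _ = (a * c - b ^+ 2) / c); last by field.
by rewrite pmulr_lge0 ?invr_gt0// subr_ge0.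
Qed.

Lemma ip_sqrD a f g : L2 w f -> L2 w g ->
  ip w (fun x => a * f x + g x) (fun x => a * f x + g x) =
  a ^+ 2 * ip w f f + 2 * a * ip w f g + ip w g g.
Proof.
move=> Lf Lg; have Laf := L2Z a Lf.
rewrite ipDl ?ipDr ?ipZl ?ipZr//; last exact: L2D.
by rewrite (ipC g f); ring.
Qed.

Lemma ip_CS2 f g : L2 w f -> L2 w g -> ip w f g ^+ 2 <= ip w f f * ip w g g.
Proof.
move=> Lf Lg; apply: discriminant_le; try exact: ip_ge0; move=> t.
have Ltg := L2Z t Lg.
have := ip_ge0 (fun x => f x + t * g x).
rewrite ipDl ?ipDr ?ipZl ?ipZr//; last exact: L2D.
by rewrite (ipC g f); nra.
Qed.

Lemma ip_CS f g : L2 w f -> L2 w g -> `|ip w f g| <= normL2 w f * normL2 w g.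
Proof.
move=> Lf Lg; rewrite -ler_sqr ?nnegrE ?mulr_ge0 ?sqrtr_ge0//.
by rewrite real_normK ?num_real// exprMn !normL2_sqr ip_CS2.
Qed.

Lemma dotvC (x y : E) : dotv x y = dotv y x.
Proof. by apply: eq_bigr => i _; rewrite mulrC. Qed.

Lemma ipvE F G : L2v w F -> L2v w G ->
  ipv w F G = \sum_(i < d) ip w (fun x => F x ord0 i) (fun x => G x ord0 i).
Proof.
move=> LF LG; rewrite /ipv /dotv.
elim: (index_enum _) => [|i s IH].
  by under eq_Rintegral do rewrite big_nil; rewrite big_nil Rintegral_cst ?mul0r.
rewrite big_cons -IH; under eq_Rintegral do rewrite big_cons.
have iFG j := L2M_integrable (LF j) (LG j).
rewrite RintegralD//.
elim: s {IH} => [|j s IH].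
  by under eq_fun do rewrite big_nil; exact: integrable0.
have := integrableD mw (iFG j) IH; apply: eq_integrable => // x _ /=.
by rewrite big_cons EFinD.
Qed.

Lemma ipvC F G : ipv w F G = ipv w G F.
Proof. by rewrite /ipv; under eq_Rintegral do rewrite dotvC. Qed.

Lemma L2vD F G : L2v w F -> L2v w G -> L2v w (fun x => F x + G x).
Proof. by move=> LF LG i; under eq_fun do rewrite mxE; apply: L2D; [exact: LF|exact: LG]. Qed.

Lemma L2vZ a F : L2v w F -> L2v w (fun x => a *: F x).
Proof. by move=> LF i; under eq_fun do rewrite mxE; apply: L2Z; exact: LF. Qed.

Lemma L2vB F G : L2v w F -> L2v w G -> L2v w (fun x => F x - G x).
Proof. by move=> LF LG i; under eq_fun do rewrite !mxE; apply: L2B; [exact: LF|exact: LG]. Qed.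

Lemma L2v0 : L2v w (fun=> 0).
Proof. by move=> i; under eq_fun do rewrite mxE; exact: L20. Qed.

Lemma ipvDl F G H : L2v w F -> L2v w G -> L2v w H ->
  ipv w (fun x => F x + G x) H = ipv w F H + ipv w G H.
Proof.
move=> LF LG LH; rewrite !ipvE//; last exact: L2vD.
rewrite -big_split; apply: eq_bigr => i _ /=; under [in LHS]eq_fun do rewrite mxE.
by rewrite ipDl.
Qed.

Lemma ipvZl a F G : L2v w F -> L2v w G ->
  ipv w (fun x => a *: F x) G = a * ipv w F G.
Proof.
move=> LF LG; rewrite !ipvE//; last exact: L2vZ.
rewrite mulr_sumr; apply: eq_bigr => i _; under [in LHS]eq_fun do rewrite mxE.
by rewrite ipZl.
Qed.

Lemma ipvBl F G H : L2v w F -> L2v w G -> L2v w H ->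
  ipv w (fun x => F x - G x) H = ipv w F H - ipv w G H.
Proof.
move=> LF LG LH; rewrite !ipvE//; last exact: L2vB.
rewrite -sumrB; apply: eq_bigr => i _ /=; under [in LHS]eq_fun do rewrite !mxE.
by rewrite ipBl.
Qed.

Lemma ipvZr a F G : L2v w F -> L2v w G ->
  ipv w F (fun x => a *: G x) = a * ipv w F G.
Proof. by move=> *; rewrite ipvC ipvZl// ipvC. Qed.

Lemma ipvDr F G H : L2v w F -> L2v w G -> L2v w H ->
  ipv w H (fun x => F x + G x) = ipv w H F + ipv w H G.
Proof. by move=> *; rewrite ipvC ipvDl// ipvC (ipvC G). Qed.

Lemma ipvBr F G H : L2v w F -> L2v w G -> L2v w H ->
  ipv w H (fun x => F x - G x) = ipv w H F - ipv w H G.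
Proof. by move=> *; rewrite ipvC ipvBl// ipvC (ipvC G). Qed.

Lemma ipv_ae F F' G : L2v w F -> L2v w F' -> L2v w G -> aeeq w F F' ->
  ipv w F G = ipv w F' G.
Proof.
move=> LF LF' LG FF'; rewrite !ipvE//; apply: eq_bigr => i _; apply: ip_ae.
- by case: (LF i).
- by case: (LF' i).
- by case: (LG i).
- by apply: filterS FF' => x FF' wx; rewrite FF'.
Qed.

Lemma ipv_ge0 F : 0 <= ipv w F F.
Proof. by apply: Rintegral_ge0 => x _; apply: sumr_ge0 => i _; rewrite -expr2 sqr_ge0. Qed.

Lemma normL2v_sqr F : normL2v w F ^+ 2 = ipv w F F.
Proof. by rewrite sqr_sqrtr// ipv_ge0. Qed.

Lemma ipv_CS2 F G : L2v w F -> L2v w G -> ipv w F G ^+ 2 <= ipv w F F * ipv w G G.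
Proof.
move=> LF LG; apply: discriminant_le; try exact: ipv_ge0; move=> t.
have LtG := L2vZ t LG.
have := ipv_ge0 (fun x => F x + t *: G x).
rewrite ipvDl ?ipvDr ?ipvZl ?ipvZr//; last exact: L2vD.
by rewrite (ipvC G F); nra.
Qed.

Lemma ipv_CS F G : L2v w F -> L2v w G -> `|ipv w F G| <= normL2v w F * normL2v w G.
Proof.
move=> LF LG; rewrite -ler_sqr ?nnegrE ?mulr_ge0 ?sqrtr_ge0//.
by rewrite real_normK ?num_real// exprMn !normL2v_sqr ipv_CS2.
Qed.

End l2_theory.

(** * Test functions and integration by parts *)

Section line_derivative.
Context {R : realType}.

Lemma is_derive_line (V : normedModType R) (f : V -> R) x v (s df : R) :
  is_derive (x + s *: v) v f df -> is_derive s 1 (fun s => f (x + s *: v)) df.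
Proof.
move=> fdf; have E : (fun h : R => h^-1 *: (((fun s => f (x + s *: v)) \o shift s) (h *: 1)
    - f (x + s *: v))) = (fun h => h^-1 *: ((f \o shift (x + s *: v)) (h *: v) - f (x + s *: v))).
  apply/funext => h /=; congr (_ *: (f _ - _)).
  by rewrite scalerDl addrCA /GRing.scale/= mulr1.
by case: fdf => D <-; split; rewrite ?/derivable ?/derive E.
Qed.

Lemma lipschitz_of_derive (f df : R -> R) (L : R) :
  (forall s : R, is_derive s 1 f (df s)) -> (forall s, `|df s| <= L) ->
  forall a b, `|f b - f a| <= L * `|b - a|.
Proof.
move=> fdf dfL a b; wlog ab : a b / a <= b => [H|].
  by have /orP[/H//|/H] := le_total a b; rewrite distrC (distrC a).
have [|c _ ->] := @MVT_segment R f df a b ab.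
  apply: derivable_within_continuous => x _; by case: (fdf x).
by rewrite normrM ler_wpM2r.
Qed.

Lemma lipschitz_line (V : normedModType R) (f : V -> R) v (L : R) :
  (forall x, derivable f x v) -> (forall x, `|'D_v f x| <= L) ->
  forall x h, `|f (x + h *: v) - f x| <= L * `|h|.
Proof.
move=> df dL x h.
have := @lipschitz_of_derive (fun s => f (x + s *: v)) (fun s => 'D_v f (x + s *: v)) L _ _ 0 h.
rewrite scale0r addr0 subr0; apply => // s.
by apply: is_derive_line; exact: derivableP.
Qed.

Lemma derive_near0 (V : normedModType R) (f : V -> R) v x :
  ~ closure [set y | f y != 0] x -> 'D_v f x = 0.
Proof.
move=> xf; rewrite (@near_eq_derive _ _ _ f (cst 0)) ?derive_cst//.
have : nbhs x (~` closure [set y | f y != 0]).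
  by apply: open_nbhs_nbhs; split => //; apply: closed_openC; exact: closed_closure.
apply: filterS => y yf; have [//|fy] := eqVneq (f y) 0; exfalso; apply: yf.
exact: subset_closure.
Qed.

Lemma closure_derive_subset (V : normedModType R) (f : V -> R) v :
  closure [set y | 'D_v f y != 0] `<=` closure [set y | f y != 0].
Proof.
rewrite [X in _ `<=` X](closure_id _).1; last exact: closed_closure.
apply: closureS => x /=; apply: contraPP => xf; apply/negP; rewrite negbK.
by apply/eqP; exact: derive_near0.
Qed.

Lemma bounded_of_compact_support (T : topologicalType) (f : T -> R) (K : set T) :
  continuous f -> compact K -> (forall x, ~ K x -> f x = 0) ->
  exists M, forall x, `|f x| <= M.
Proof.
move=> cf cK f0; have : compact (f @` K).
  by apply: continuous_compact => //; exact: continuous_subspaceT.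
move=> /compact_bounded[M [_ HM]]; exists (Num.max (M + 1) 0) => x; rewrite le_max.
have [Kx|/f0 ->] := pselect (K x); last by rewrite normr0 lexx orbT.
by apply/orP; left; apply: HM; [rewrite ltrDl|exists x].
Qed.

End line_derivative.

(** * Smooth functions with compact support *)

Section test_functions.
Context {R : realType} {d : nat}.
Notation E := ('rV[R]_d).
Notation mu := (lebesgue_rV R d).
Implicit Types (w : set E) (f g t : E -> R).
Notation e_ i := (delta_mx ord0 i : E).

Lemma integrable_bounded w f (M r : R) : measurable w -> measurable_fun w f ->
  (forall x, w x -> `|f x| <= M) -> (forall x, w x -> ~ cube 0 r x -> f x = 0) ->
  mu.-integrable w (EFin \o f).
Proof.
move=> mw mf fM f0.
have iM : mu.-integrable w (fun x => (M%:E * (\1_(cube 0 r : set E) x)%:E)%E).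
  apply: integrableZl => //; apply: (@integrableS _ _ _ mu setT) => //.
  have mc := @measurable_cube R d 0 r.
  apply/integrableP; split; first exact/measurable_EFinP.
  under eq_integral do rewrite gee0_abs ?lee_fin//.
  by rewrite integral_indic// setIT; exact: cube_finite.
apply: (le_integrable mw _ _ iM); first exact/measurable_EFinP.
move=> x wx /=; rewrite indicE lee_fin.
case: (boolP (_ \in _)); rewrite ?inE ?notin_setE => cx.
  by rewrite mulr1 (le_trans (fM x wx))// ler_norm.
by rewrite f0// mulr0 normr0.
Qed.

Lemma L2_bounded w f (M r : R) : measurable w -> measurable_fun w f ->
  (forall x, w x -> `|f x| <= M) -> (forall x, w x -> ~ cube 0 r x -> f x = 0) ->
  L2 w f.
Proof.
move=> mw mf fM f0; split => //.
apply: (@integrable_bounded w (fun x => f x ^+ 2) (M ^+ 2) r) => //.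
- by under eq_fun do rewrite expr2; exact: measurable_funM.
- move=> x wx; rewrite normrX lerXn2r// ?nnegrE//; last exact: fM.
  exact: le_trans (fM x wx).
- by move=> x wx cx; rewrite f0// expr0n.
Qed.

Lemma compact_cube (K : set E) : compact K -> exists r, K `<=` cube 0 r.
Proof.
move=> /compact_bounded[M [_ HM]]; exists (M + 2) => x Kx i; rewrite mxE subr0.
apply: (@le_lt_trans _ _ `|x|).
  by rewrite /Num.Def.normr/= mx_normrE; apply: (le_bigmax _ _ (ord0, i)).
apply: (@le_lt_trans _ _ (M + 1)); last by rewrite ltrD2l ltr1n.
by apply: HM => //; rewrite ltrDl.
Qed.

Lemma pderivs_rcons s i f : pderivs (rcons s i) f = pderivs s (fun x => 'D_(e_ i) f x).
Proof. by rewrite /pderivs foldr_rcons. Qed.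

Lemma smooth_continuous f : smooth f -> continuous f.
Proof. by move=> /(_ [::])[]. Qed.

Lemma smooth_derivable f i x : smooth f -> derivable f x (e_ i).
Proof. by move=> /(_ [::])[_]; exact. Qed.

Lemma smooth_derive f i : smooth f -> smooth (fun x => 'D_(e_ i) f x).
Proof. by move=> sf s; rewrite -pderivs_rcons; exact: sf. Qed.

Lemma pderivsD (a : R) f g s : smooth f -> smooth g ->
  pderivs s (fun x => a * f x + g x) = fun x => a * pderivs s f x + pderivs s g x.
Proof.
move=> sf sg; elim: s => //= i s IH; apply/funext => x; rewrite -/(pderivs _ _) IH.
have df := (sf s).2 x i; have dg := (sg s).2 x i.
by rewrite (deriveD (f := fun x => a * pderivs s f x))// ?deriveMl//;
  exact: derivableM.
Qed.

Lemma smoothD (a : R) f g : smooth f -> smooth g -> smooth (fun x => a * f x + g x).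
Proof.
move=> sf sg s; rewrite pderivsD//; split.
  by move=> x; exact: (cvgD (cvgM (cvg_cst a) ((sf s).1 x)) ((sg s).1 x)).
move=> x i; apply: derivableD; last exact: (sg s).2.
by apply: derivableM => //; exact: (sf s).2.
Qed.

Lemma test_functionD w (a : R) f g : test_function w f -> test_function w g ->
  test_function w (fun x => a * f x + g x).
Proof.
move=> [sf cf fw] [sg cg gw].
have sub : closure [set x | a * f x + g x != 0] `<=`
    closure [set x | f x != 0] `|` closure [set x | g x != 0].
  rewrite -closureU; apply: closureS => x /= afg.
  have [fx0|] := eqVneq (f x) 0; last by left.
  by right; move: afg; rewrite fx0 mulr0 add0r.
split; first exact: smoothD.
- apply: subclosed_compact sub; first exact: closed_closure.
  exact: compactU.
- by move=> x /sub[/fw|/gw].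
Qed.

Lemma test_function_derive w i f : test_function w f ->
  test_function w (fun x => 'D_(e_ i) f x).
Proof.
move=> [sf cf fw]; have sub := @closure_derive_subset _ _ f (e_ i); split.
- exact: smooth_derive.
- by apply: subclosed_compact sub => //; exact: closed_closure.
- exact: subset_trans sub fw.
Qed.

Lemma test_functionS w w' f : w `<=` w' -> test_function w f -> test_function w' f.
Proof. by move=> ww' [sf cf fw]; split => //; exact: subset_trans fw ww'. Qed.

Lemma test_function_out w f x : test_function w f -> ~ w x -> f x = 0.
Proof.
move=> [_ _ fw] wx; have [//|fx] := eqVneq (f x) 0.
by exfalso; apply: wx; apply: fw; exact: subset_closure.
Qed.

Lemma test_function_measurable w f : test_function w f -> measurable_fun setT f.
Proof. by case=> /smooth_continuous sf _ _; exact: continuous_measurable_rV. Qed.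

Lemma test_function_bounded w f : test_function w f -> exists M, forall x, `|f x| <= M.
Proof.
move=> [sf cf _]; apply: (@bounded_of_compact_support _ _ _ _ _ cf).
  exact: smooth_continuous.
move=> x fx; have [//|fx0] := eqVneq (f x) 0; exfalso; apply: fx.
exact: subset_closure.
Qed.

Lemma test_function_supp w f : test_function w f ->
  exists r, forall x, ~ cube 0 r x -> f x = 0.
Proof.
move=> [sf cf _]; have [r fr] := compact_cube cf; exists r => x xr.
have [//|fx0] := eqVneq (f x) 0; exfalso; apply: xr; apply: fr.
exact: subset_closure.
Qed.

Lemma test_function_L2 w w' f : measurable w' -> test_function w f -> L2 w' f.
Proof.
move=> mw' tf; have [M fM] := test_function_bounded tf.
have [r fr] := test_function_supp tf.
apply: (@L2_bounded _ _ M r) => //; last by move=> x _; exact: fr.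
by apply: measurable_funTS; exact: test_function_measurable tf.
Qed.

Lemma test_function_L2v w w' f : measurable w' -> test_function w f -> L2v w' (cgrad f).
Proof.
move=> mw' tf i; under eq_fun do rewrite mxE.
by apply: test_function_L2 => //; exact: test_function_derive tf.
Qed.

End test_functions.

(** * Integration by parts from translation invariance *)

Section integration_by_parts.
Context {R : realType} {d : nat}.
Notation E := ('rV[R]_d).
Notation mu := (lebesgue_rV R d).
Implicit Types (w : set E) (f g t : E -> R).
Notation e_ i := (delta_mx ord0 i : E).

Lemma cvg_harmonic_dnbhs : (n.+1%:R^-1 : R) @[n --> \oo] --> (0 : R)^'.
Proof.
move=> A [e /= e0 eA]; suff : \forall n \near \oo, A (n.+1%:R^-1) by [].
near=> n; apply: eA; last exact: invr_neq0.
by near: n; have := @cvg_harmonic R => /cvgrPdist_lt /(_ _ e0).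
Unshelve. all: by end_near. Qed.

Lemma integral_translate f (v : E) : measurable_fun setT f ->
  mu.-integrable setT (EFin \o (fun x => f (x + v))) ->
  (\int[mu]_x (f (x + v))%:E = \int[mu]_x (f x)%:E)%E.
Proof.
move=> mf fv; have mv := measurable_addr_rV v.
pose phi : {mfun _ >-> _} := HB.pack (fun x : E => x + v : E)
   (isMeasurableFun.Build _ _ _ _ _ mv).
have := @integral_pushforward _ _ _ _ R phi mv mu setT (EFin \o f).
rewrite preimage_setT => <-//; last exact/measurable_EFinP.
by apply: eq_measure_integral => A mA _; exact: lebesgue_rV_addr.
Qed.

Lemma ler_coord (x : E) i : `|x ord0 i| <= `|x|.
Proof. by rewrite /Num.Def.normr/= mx_normrE; apply: (le_bigmax _ _ (ord0, i)). Qed.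

(* Translation invariance kills the integral of each difference quotient, and the
   Lipschitz bound dominates them. *)
Lemma integral_derive0 (g Dg : E -> R) (i : 'I_d) (L r : R) :
  measurable_fun setT g -> measurable_fun setT Dg ->
  (forall x, ~ cube 0 r x -> g x = 0) ->
  (forall x h, `|g (x + h *: e_ i) - g x| <= L * `|h|) ->
  {ae mu, forall x, is_derive x (e_ i) g (Dg x)} ->
  mu.-integrable setT (EFin \o Dg) /\ \int[mu]_x Dg x = 0.
Proof.
move=> mg mDg g0 gL gD.
have L0 : 0 <= L by have := gL 0 1; rewrite normr1 mulr1; exact: le_trans.
have cubeS x (h : R) s : cube 0 s (x + h *: e_ i) -> cube 0 (s + `|h|) x.
  move=> xs j; have := xs j; rewrite !mxE !subr0 eqxx /= => xs'.
  rewrite -[x ord0 j](addrK (h * (j == i)%:R)).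
  apply: (le_lt_trans (ler_normB _ _)); apply: ltr_leD => //.
  by rewrite normrM; case: (j == i); rewrite ?normr1 ?mulr1// normr0 mulr0.
have cube_mono x (s s' : R) : s <= s' -> cube (0 : E) s x -> cube 0 s' x.
  by move=> ss xs j; exact: lt_le_trans (xs j) ss.
(* From a point of the cube, a move of length 2 |r| along [e_ i] leaves the cube, where [g]
   vanishes; the Lipschitz bound then bounds [g] itself. *)
have gM x : `|g x| <= L * (2 * `|r|).
  have [xr|xr] := pselect (cube 0 r x); last by rewrite g0// normr0 mulr_ge0// mulr_ge0.
  have h0 : ~ cube 0 r (x + (2 * `|r|) *: e_ i).
    move=> /(_ i); have := xr i; rewrite !mxE !subr0 !eqxx/= mulr1.
    have := ler_norm r; rewrite !ltr_norml => rr /andP[x1 x2] /andP[_]; lra.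
  have := gL x (2 * `|r|); rewrite (g0 _ h0) sub0r normrN.
  by rewrite (ger0_norm (_ : 0 <= 2 * `|r|)) ?mulr_ge0.
have mgs (h : R) : measurable_fun setT (fun x : E => g (x + h *: e_ i)).
  by apply: (measurableT_comp mg); exact: measurable_addr_rV.
have ig : mu.-integrable setT (EFin \o g).
  by apply: (@integrable_bounded _ _ _ _ (L * (2 * `|r|)) r) => // x _; exact: g0.
have igs (h : R) : mu.-integrable setT (EFin \o (fun x : E => g (x + h *: e_ i))).
  apply: (@integrable_bounded _ _ _ _ (L * (2 * `|r|)) (r + `|h|)) => // x _ xr.
  by apply: g0 => /cubeS.
pose f_ n (x : E) := n.+1%:R * (g (x + n.+1%:R^-1 *: e_ i) - g x).
(* The steps are at most 1, so all quotients vanish outside [cube 0 (r + 1)] and one integrable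
   function dominates them. *)
have f_L n x : `|f_ n x| <= L * \1_(cube 0 (r + 1) : set E) x.
  rewrite indicE; case: (boolP (_ \in _)); rewrite ?inE ?notin_setE => xr.
    rewrite mulr1 /f_ normrM ger0_norm// mulrC -ler_pdivlMr ?ltr0Sn//.
    by rewrite (le_trans (gL x _))// ger0_norm ?invr_ge0.
  have n1 : `|n.+1%:R^-1 : R| <= 1 by rewrite ger0_norm ?invr_ge0// invf_le1 ?ltr0Sn// ler1n.
  rewrite /f_ !g0 ?subr0 ?mulr0 ?normr0//.
  - by move=> xr'; apply: xr; apply: cube_mono xr'; rewrite lerDl.
  - by move=> /cubeS xr'; apply: xr; apply: cube_mono xr'; rewrite lerD2l.
have mf_ n : measurable_fun setT (EFin \o f_ n).
  by apply/measurable_EFinP; apply: measurable_funM => //; exact: measurable_funB.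
have iL : mu.-integrable setT (EFin \o (fun x => L * \1_(cube 0 (r + 1) : set E) x)).
  have mc := @measurable_cube R d 0 (r + 1).
  apply: (@integrable_bounded _ _ _ _ L (r + 1)) => //.
  - by apply: measurable_funM => //.
  - by move=> x _; rewrite indicE ger0_norm ?mulr_ge0// ler_piMr// lern1; case: (_ \in _).
  - by move=> x _ xr; rewrite indicE memNset// mulr0.
have cf : {ae mu, forall x, setT x -> EFin (f_ n x) @[n --> \oo] --> EFin (Dg x)}.
  apply: filterS gD => x gDx _; apply: cvg_EFin; first by exact: nearW.
  have [Dx <-] := gDx.
  have hn := cvg_harmonic_dnbhs.
  have := cvg_comp _ _ hn Dx; apply: cvg_trans; apply: near_eq_cvg; near=> n.
  by rewrite /f_ /= invrK; congr (_ * (g _ - _)); rewrite addrC.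
have mED : measurable_fun setT (EFin \o Dg) by exact/measurable_EFinP.
have bf : {ae mu, forall x, forall n, setT x ->
    (`|(EFin \o f_ n) x| <= (L * \1_(cube 0 (r + 1) : set E) x)%:E)%E}.
  by apply: nearW => x n _; rewrite lee_fin; exact: f_L.
have [iD _ cD] := dominated_convergence measurableT mf_ mED cf iL bf.
split => //; rewrite /Rintegral (_ : (\int[mu]_x (Dg x)%:E)%E = 0%E)//.
have f_0 n : (\int[mu]_x (EFin \o f_ n) x = 0)%E.
  rewrite /f_ /=; under eq_integral do rewrite EFinM EFinB.
  rewrite integralZl//; last exact: integrableB (igs _) ig.
  rewrite integralB//; last exact: igs.
  rewrite integral_translate// subee ?mule0//.
  exact: integrable_fin_num.
have : [sequence (\int[mu]_x (EFin \o f_ n) x)%E]_n @ \oo --> 0%E.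
  by apply: cvg_near_cst; exact: nearW.
by move=> c0; exact: (cvg_unique (@ereal_hausdorff R) cD c0).
Unshelve. all: by end_near. Qed.

Lemma ip_support w f t : (forall x, ~ w x -> t x = 0) -> ip w f t = ip setT f t.
Proof.
move=> t0; rewrite /ip Rintegral_mkcond; apply: eq_Rintegral => x _.
rewrite patchE; case: (boolP (_ \in _)) => //; rewrite notin_setE => /t0 ->.
by rewrite mulr0.
Qed.

(** The integral of the derivative of [q * t] vanishes by [integral_derive0]. The compact support of
    [t] provides all the bounds, so [q] may grow at infinity, as polynomials do. *)
Lemma ip_derive_test w (q t : E -> R) (i : 'I_d) : test_function w t ->
  continuous q -> (forall x, derivable q x (e_ i)) -> continuous (fun x => 'D_(e_ i) q x) ->
  ip setT q (fun x => 'D_(e_ i) t x) = - ip setT (fun x => 'D_(e_ i) q x) t.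
Proof.
move=> tt cq dq cDq.
have [st ct _] := tt.
have tt' := test_function_derive i tt.
have dt x := @smooth_derivable _ _ t i x st.
have ct' := smooth_continuous (smooth_derive i st).
have ct0 := smooth_continuous st.
have [r tr] := test_function_supp tt; have [r' tr'] := test_function_supp tt'.
pose g x := q x * t x.
have dg x : derivable g x (e_ i) by exact: derivableM.
have gE x : 'D_(e_ i) g x = q x * 'D_(e_ i) t x + t x * 'D_(e_ i) q x.
  by rewrite deriveM.
have c1 : continuous (fun x => q x * 'D_(e_ i) t x).
  by move=> x; exact: (cvgM (cq x) (ct' x)).
have c2 : continuous (fun x => t x * 'D_(e_ i) q x).
  by move=> x; exact: (cvgM (ct0 x) (cDq x)).
have [M1 HM1] : exists M, forall x, `|q x * 'D_(e_ i) t x| <= M.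
  apply: (@bounded_of_compact_support _ _ _ _ c1 ct) => x xt.
  by rewrite derive_near0// mulr0.
have [M2 HM2] : exists M, forall x, `|t x * 'D_(e_ i) q x| <= M.
  apply: (@bounded_of_compact_support _ _ _ _ c2 ct) => x xt.
  have [->|tx] := eqVneq (t x) 0; first by rewrite mul0r.
  by exfalso; apply: xt; exact: subset_closure.
have m1 := continuous_measurable_rV c1; have m2 := continuous_measurable_rV c2.
have [||| _] := @integral_derive0 g (fun x => q x * 'D_(e_ i) t x + t x * 'D_(e_ i) q x) i (M1 + M2) r
  (continuous_measurable_rV (fun x => cvgM (cq x) (ct0 x)))
  (measurable_funD m1 m2) _ _ _.
- by move=> x xr; rewrite /g tr// mulr0.
- apply: lipschitz_line => // x; rewrite gE.
  by rewrite (le_trans (ler_normD _ _))// lerD.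
- by apply: nearW => x; rewrite -gE; exact: derivableP.
rewrite RintegralD//; first last.
- by apply: (@integrable_bounded _ _ _ _ M2 r) => // x _ xr; rewrite tr// mul0r.
- by apply: (@integrable_bounded _ _ _ _ M1 r') => // x _ xr; rewrite tr'// mulr0.
rewrite -[X in X + _ = _]/(ip setT q (fun x => 'D_(e_ i) t x)).
rewrite -[X in _ + X = _]/(ip setT t (fun x => 'D_(e_ i) q x)) [in X in _ + X]ipC => h.
by apply/eqP; rewrite -subr_eq0 opprK; apply/eqP.
Qed.

End integration_by_parts.

(** * Bump functions and the fundamental lemma *)

Section bump.
Context {R : realType}.
Implicit Types (f g : R -> R) (p : {poly R}).

(** Infinite differentiability in coinductive style: [f] belongs to some set of functions closed
    under differentiation, so no formula for iterated derivatives is ever needed. *)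
Definition smooth1 f : Prop := exists S : set (R -> R), S f /\
  forall g, S g -> exists2 g', S g' & forall x : R, is_derive x 1 g (g' x).

(* This family is closed under differentiation. *)
Definition flat_exp p (x : R) : R :=
  if 0 < x then p.[x^-1] * expR (- x^-1) else 0.

(** Coefficient by coefficient, from y^(i+1) / (i+1)! <= exp y. With y = 1/x this makes [flat_exp]
    differentiable at the origin. *)
Lemma expR_poly_bound p :
  exists C, forall y, 0 < y -> `|p.[y] * expR (- y)| <= C * y^-1.
Proof.
exists (\sum_(i < size p) `|p`_i| * (i.+1)`!%:R) => y y0.
rewrite horner_coef mulr_suml mulr_suml.
apply: (le_trans (ler_norm_sum _ _ _)); apply: ler_sum => i _.
rewrite !normrM -!mulrA ler_wpM2l// normrX (gtr0_norm y0) (ger0_norm (expR_ge0 _)).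
rewrite ler_pdivlMr// mulrAC -exprSr expRN ler_pdivrMr ?expR_gt0//.
rewrite -ler_pdivrMl ?ltr0n ?fact_gt0// mulrC.
by apply: le_trans (expR_ge1Dxn i (ltW y0)); rewrite lerDr.
Qed.

Lemma is_derive_poly p (x : R) : is_derive x 1 (fun y : R => p.[y]) p^`().[x].
Proof. by split; [exact: derivable_horner|rewrite derivE derive1E]. Qed.

(** For x > 0 the chain rule gives x^-2 (p - p')(1/x) exp(-1/x), again polynomial in 1/x times the
    exponential. *)
Lemma is_derive_flat_exp p (x : R) :
  is_derive x 1 (flat_exp p) (flat_exp ('X ^+ 2 * (p - p^`())) x).
Proof.
have [x0|x0|->] := ltgtP x 0.
- rewrite /flat_exp ltNge (ltW x0)/=.
  apply: (@near_eq_is_derive _ _ _ (cst 0)); near=> y.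
  rewrite /= /flat_exp ltNge ltW//=.
  by near: y; exact: lt_nbhsl.
- rewrite [X in is_derive _ _ _ X]/flat_exp x0.
  apply: (@near_eq_is_derive _ _ _ (fun y : R => p.[y^-1] * expR (- y^-1) : R)).
    near=> y; rewrite /flat_exp ifT//.
    by near: y; exact: lt_nbhsr.
  have dV : is_derive x 1 (fun y : R => y^-1) (- x ^- 2).
    have xn0 : x != 0 by rewrite gt_eqF.
    split; first exact: derivableV.
    by rewrite (deriveV (f := id))// derive_id /GRing.scale/= mulr1.
  have dp : is_derive (x^-1) 1 (fun y => p.[y]) p^`().[x^-1].
    exact: is_derive_poly.
  have dpV : is_derive x 1 (fun y : R => p.[y^-1]) (- x ^- 2 *: p^`().[x^-1]).
    by apply: is_derive_eq (is_derive1_comp dp dV) _; rewrite /GRing.scale/= mulrC.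
  have deV : is_derive x 1 (fun y : R => expR (- y^-1)) (x ^- 2 *: expR (- x^-1)).
    have dN : is_derive x 1 (fun y : R => - y^-1) (x ^- 2).
      by apply: is_derive_eq (is_deriveN dV) _; rewrite opprK.
    by apply: is_derive_eq (is_derive1_comp (is_derive_expR _) dN) _; rewrite /GRing.scale/= mulrC.
  apply: is_derive_eq (is_deriveM dpV deV) _.
  by rewrite /GRing.scale/= !hornerE/= exprVn; ring.
(* At the origin, the difference quotient of step h > 0 is ['X * p] evaluated at 1/h times
   exp(-1/h), hence at most C h in absolute value. *)
- have [C HC] := expR_poly_bound ('X * p).
  rewrite /flat_exp ltxx.
  suff : h^-1 *: ((flat_exp p \o shift 0) (h *: (1:R)) - flat_exp p 0) @[h --> 0^'] --> (0 : R).
    move=> cD; split; first by apply/cvg_ex; exists 0.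
    exact: (cvg_lim (@Rhausdorff R) cD).
  have C0 : 0 <= C by have := HC 1 ltr01; rewrite invr1 mulr1; exact: le_trans.
  have Cp : 0 < C + 1 by rewrite ltr_wpDl.
  apply/cvgrPdist_lt => e e0; near=> h.
  rewrite sub0r normrN /= addr0 {2}/flat_exp ltxx subr0 /GRing.scale/= mulr1.
  rewrite /flat_exp; case: ifPn => h0; last by rewrite mulr0 normr0.
  have hV0 : 0 < h^-1 by rewrite invr_gt0.
  have := HC _ hV0; rewrite hornerM hornerX invrK -mulrA => hC; apply: (le_lt_trans hC).
  apply: (@le_lt_trans _ _ ((C + 1) * h)); first by rewrite ler_wpM2r ?lerDl// ltW.
  rewrite mulrC -ltr_pdivlMr// -[h]gtr0_norm//.
  by near: h; apply: dnbhs0_lt; rewrite divr_gt0.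
Unshelve. all: by end_near. Qed.

Lemma smooth1_flat_exp p : smooth1 (flat_exp p).
Proof.
exists (range flat_exp); split; first by exists p.
move=> _ [q _ <-]; exists (flat_exp ('X ^+ 2 * (q - q^`()))); first by eexists.
by move=> x; exact: is_derive_flat_exp.
Qed.

Lemma smooth1_affine f (a b : R) : smooth1 f -> smooth1 (fun x => f (a * x + b)).
Proof.
move=> [S [Sf SP]]; exists [set h | exists2 gc, S gc.1 & h = fun x : R => gc.2 * gc.1 (a * x + b)].
split; first by exists (f, 1) => //; apply/funext => x; rewrite mul1r.
move=> _ [[g c] /= Sg ->]; have [g' Sg' gg'] := SP _ Sg.
exists (fun x => (c * a) * g' (a * x + b)); first by exists (g', c * a).
move=> x.
have da : is_derive x 1 (fun x : R => a * x + b) a.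
  apply: is_derive_eq (is_deriveD (is_deriveM (is_derive_cst a x 1) (is_derive_id x (1 : R))) (is_derive_cst b x 1)) _.
  by rewrite /GRing.scale/= mulr0 !addr0 mulr1.
apply: is_derive_eq (is_deriveM (is_derive_cst c x 1) (is_derive1_comp (gg' _) da)) _.
by rewrite /GRing.scale/= mulr0 addr0; ring.
Qed.

(** By Leibniz the finite sums of products, with factors from the two given closed sets, form a set
    closed under differentiation. *)
Lemma smooth1M f g : smooth1 f -> smooth1 g -> smooth1 (fun x => f x * g x).
Proof.
move=> [S [Sf SP]] [T [Tg TP]].
pose U := [set h | exists2 s : seq ((R -> R) * (R -> R)),
  (forall k, (k < size s)%N -> S (nth (f, g) s k).1 /\ T (nth (f, g) s k).2) &
  h = fun x => \sum_(q <- s) q.1 x * q.2 x].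
exists U; split.
  exists [:: (f, g)]; first by case.
  by apply/funext => x; rewrite big_seq1.
move=> _ [s sST ->]; elim: s sST => [|[u v] s IH] sST.
  exists (fun=> 0); first by exists [::] => //; apply/funext => x; rewrite big_nil.
  by move=> x; under eq_fun do rewrite big_nil; exact: is_derive_cst.
have [h [s' sST' ->] hP] := IH (fun k ks => sST k.+1 ks).
have [/= Su Tv] := sST 0%N isT.
have [u' Su' uu'] := SP _ Su; have [v' Tv' vv'] := TP _ Tv.
exists (fun x => \sum_(q <- [:: (u, v'), (u', v) & s']) q.1 x * q.2 x).
  by exists [:: (u, v'), (u', v) & s'] => // -[|[|k]] //= ks; exact: sST'.
move=> x; under eq_fun do rewrite big_cons.
apply: is_derive_eq (is_deriveD (is_deriveM (uu' x) (vv' x)) (hP x)) _.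
by rewrite !big_cons/= /GRing.scale/= addrA (mulrC (v x)).
Qed.

(** A smooth approximation of the indicator of ]a, b[ from below: for t > 0, exp(-1 / ((n+1) t))
    tends to 1 as n grows. *)
Definition bump1 (a b : R) (n : nat) (x : R) : R :=
  flat_exp 1 (n.+1%:R * (x - a)) * flat_exp 1 (n.+1%:R * (b - x)).

Lemma smooth1_bump1 a b n : smooth1 (bump1 a b n).
Proof.
apply: smooth1M.
  have := smooth1_affine n.+1%:R (- (n.+1%:R * a)) (smooth1_flat_exp 1).
  by congr smooth1; apply/funext => x; rewrite mulrBr.
have := smooth1_affine (- n.+1%:R) (n.+1%:R * b) (smooth1_flat_exp 1).
by congr smooth1; apply/funext => x; rewrite mulNr addrC mulrBr.
Qed.

Lemma flat_exp1_bound (x : R) : 0 <= flat_exp 1 x <= 1.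
Proof.
rewrite /flat_exp; case: ifPn => x0; last by rewrite lexx ler01.
rewrite hornerC mul1r expR_ge0 -expR0 ler_expR oppr_le0 invr_ge0 ltW//.
Qed.

Lemma bump1_bound a b n x : 0 <= bump1 a b n x <= 1.
Proof.
have /andP[h1 h2] := flat_exp1_bound (n.+1%:R * (x - a)).
have /andP[h3 h4] := flat_exp1_bound (n.+1%:R * (b - x)).
by rewrite mulr_ge0// mulr_ile1.
Qed.

Lemma bump1_out a b n x : ~ (a < x < b) -> bump1 a b n x = 0.
Proof.
rewrite /bump1 /flat_exp !pmulr_rgt0 ?ltr0n// !subr_gt0.
by case: (a < x) (x < b) => -[]; rewrite ?(mul0r, mulr0).
Qed.

Lemma flat_exp1_cvg (x : R) : 0 < x -> flat_exp 1 (n.+1%:R * x) @[n --> \oo] --> (1 : R).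
Proof.
move=> x0; rewrite -[X in _ --> X]expR0.
rewrite (_ : (fun n => _) = (fun n : nat => expR (- (x^-1 * n.+1%:R^-1)))); last first.
  by apply/funext => n; rewrite /flat_exp pmulr_rgt0 ?ltr0n// x0 hornerC mul1r invfM mulrC.
have h : (- (x^-1 * n.+1%:R^-1)) @[n --> \oo] --> (0 : R).
  rewrite -[X in _ --> X]oppr0; apply: cvgN; rewrite -[X in _ --> X](mulr0 x^-1).
  by apply: cvgM; [exact: cvg_cst|exact: cvg_harmonic].
exact: (cvg_comp _ _ h (@continuous_expR R 0)).
Qed.

Lemma bump1_cvg a b x : a < x < b -> bump1 a b n x @[n --> \oo] --> (1 : R).
Proof.
move=> /andP[ax xb]; rewrite -[X in _ --> X]mulr1.
by apply: cvgM; apply: flat_exp1_cvg; rewrite subr_gt0.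
Qed.

End bump.

(** * Tensor-product bump functions *)

Section product_bump.
Context {R : realType} {d : nat}.
Notation E := ('rV[R]_d).
Notation mu := (lebesgue_rV R d).
Notation e_ i := (delta_mx ord0 i : E).

(** A set closed under all partial derivatives contains every [pderivs s f], which reduces [smooth]
    to one derivation step. *)
Lemma smooth_of_closed (T : set (E -> R)) :
  (forall f, T f -> continuous f /\
     forall i, exists2 g, T g & forall x, is_derive x (e_ i) f (g x)) ->
  forall f, T f -> smooth f.
Proof.
move=> HT f Tf s; have : T (pderivs s f).
  elim: s => //= i s IH; have [_ /(_ i)[g Tg fg]] := HT _ IH.
  rewrite (_ : (fun x => _) = g)//; apply/funext => x; by have [_ ->] := fg x.
move=> /HT[cs ds]; split => // x i; have [g _ fg] := ds i; by case: (fg x).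
Qed.

Lemma is_derive_coord (f : R -> R) (x : E) i j (df : R) :
  is_derive (x ord0 j) 1 f df ->
  is_derive x (e_ i) (fun x : E => f (x ord0 j)) ((i == j)%:R * df).
Proof.
move=> fdf; have [->|ij] := eqVneq i j; last first.
  rewrite mul0r; have h : (fun h : R => h^-1 *: (((fun x : E => f (x ord0 j)) \o shift x)
      (h *: e_ i) - f (x ord0 j))) = cst 0.
    apply/funext => h /=; rewrite !mxE eqxx/= eq_sym (negbTE ij) mulr0 add0r subrr.
    exact: scaler0.
  split; rewrite ?/derivable ?/derive h; first exact: is_cvg_cst.
  exact: lim_cst.
rewrite mul1r.
have h : (fun h : R => h^-1 *: (((fun x : E => f (x ord0 j)) \o shift x) (h *: e_ j) - f (x ord0 j)))
  = (fun h => h^-1 *: ((f \o shift (x ord0 j)) (h *: 1) - f (x ord0 j))).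
  by apply/funext => h /=; rewrite !mxE !eqxx.
by case: fdf => D <-; split; rewrite ?/derivable ?/derive h.
Qed.

Lemma continuous_prod (I : Type) (T : topologicalType) (s : seq I) (f : I -> T -> R) :
  (forall i, continuous (f i)) -> continuous (fun x => \prod_(i <- s) f i x).
Proof.
move=> cf; elim: s => [|i s IH] x.
  by under eq_fun do rewrite big_nil; exact: cvg_cst.
under eq_fun do rewrite big_cons.
exact: (cvgM (cf i x) (IH x)).
Qed.

Lemma is_derive_prod_seq (s : seq 'I_d) (i : 'I_d) (f : 'I_d -> R -> R) (df : R -> R) (x : E) :
  uniq s -> (forall y : R, is_derive y 1 (f i) (df y)) ->
  (forall j, exists df, forall y : R, is_derive y 1 (f j) (df y)) ->
  is_derive x (e_ i) (fun x : E => \prod_(j <- s) f j (x ord0 j))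
   (if i \in s then \prod_(j <- s) (if j == i then df else f j) (x ord0 j) else 0).
Proof.
move=> + fi fj; elim: s => [_|j s IH /= /andP[js us]].
  by under eq_fun do rewrite big_nil; exact: is_derive_cst.
have [dfj fjj] := fj j.
under eq_fun do rewrite big_cons.
have [ij|ij] := eqVneq i j.
  subst j; rewrite inE eqxx/= big_cons eqxx; have {IH} := IH us; rewrite (negbTE js) => IH.
  apply: is_derive_eq (is_deriveM (@is_derive_coord (f i) x i i _ (fi (x ord0 i))) IH) _.
  rewrite eqxx mul1r scaler0 add0r /GRing.scale/= mulrC.
  congr (_ * _); rewrite !big_seq; apply: eq_bigr => k ks; case: eqVneq => // ki.
  by move: js; rewrite -ki ks.
rewrite inE (negbTE ij)/=.
apply: is_derive_eq (is_deriveM (@is_derive_coord (f j) x i j _ (fjj (x ord0 j))) (IH us)) _.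
rewrite (negbTE ij) mul0r scaler0 addr0 /GRing.scale/=.
by case: ifP => _; rewrite ?mulr0// big_cons eq_sym (negbTE ij).
Qed.

Lemma smooth_prod (f : 'I_d -> R -> R) : (forall j, smooth1 (f j)) ->
  smooth (fun x : E => \prod_(j < d) f j (x ord0 j)).
Proof.
move=> /choice[S SP].
pose T := [set h : E -> R | exists2 g : 'I_d -> R -> R, (forall j, S j (g j)) &
   h = fun x => \prod_(j < d) g j (x ord0 j)].
apply: (@smooth_of_closed T); last by exists f => // j; case: (SP j).
move=> _ [g Sg ->]; split.
  apply: continuous_prod => j x; have [_ /(_ _ (Sg j))[g' _ gg']] := SP j.
  apply: (@continuous_comp _ _ _ (fun x : E => x ord0 j) (g j)).
    exact: coord_continuous.
  by apply: differentiable_continuous; apply/derivable1_diffP; case: (gg' (x ord0 j)).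
move=> i; have [_ /(_ _ (Sg i))[g' Sg' gg']] := SP i.
exists (fun x => \prod_(j < d) (if j == i then g' else g j) (x ord0 j)).
  exists (fun j => if j == i then g' else g j) => // j.
  by case: eqVneq => [->|].
move=> x; have := @is_derive_prod_seq (index_enum 'I_d) i g g' x (index_enum_uniq _) gg'.
rewrite mem_index_enum; apply => j.
by have [_ /(_ _ (Sg j))[h _ hh]] := SP j; exists h.
Qed.

Definition box (a b : E) : set E := [set x | forall j, a ord0 j < x ord0 j < b ord0 j].

Definition bump (a b : E) n (x : E) : R :=
  \prod_(j < d) bump1 (a ord0 j) (b ord0 j) n (x ord0 j).

Lemma bump_bound a b n x : 0 <= bump a b n x <= 1.
Proof.
apply/andP; split; first by apply: prodr_ge0 => j _; case/andP: (bump1_bound (a ord0 j) (b ord0 j) n (x ord0 j)).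
rewrite [leRHS](_ : 1 = \prod_(j < d) 1); last by rewrite big1.
by apply: ler_prod => j _; exact: bump1_bound.
Qed.

Lemma bump_out a b n x : ~ box a b x -> bump a b n x = 0.
Proof.
move=> /existsNP[j /bump1_out h]; rewrite /bump (bigD1 j)//= h mul0r//.
Qed.

Lemma bump_cvg a b x : bump a b n x @[n --> \oo] --> (\1_(box a b) x : R).
Proof.
rewrite indicE; case: (boolP (_ \in _)); rewrite ?inE ?notin_setE => abx.
  rewrite /= mulr1n; rewrite /bump.
  elim: (index_enum _) => [|j s IH].
    by under eq_fun do rewrite big_nil; exact: cvg_cst.
  rewrite (_ : (fun n => \prod_(k <- j :: s) _) = (fun n =>
    bump1 (a ord0 j) (b ord0 j) n (x ord0 j) *
    \prod_(k <- s) bump1 (a ord0 k) (b ord0 k) n (x ord0 k))); last first.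
    by apply/funext => n; rewrite big_cons.
  rewrite -[X in _ --> X]mulr1; apply: cvgM => //; exact: bump1_cvg.
by under eq_fun do rewrite bump_out//; exact: cvg_cst.
Qed.

Lemma test_function_bump (w : set E) (a b : E) n :
  [set x : E | forall j, x ord0 j \in `[a ord0 j, b ord0 j]] `<=` w ->
  test_function w (bump a b n).
Proof.
set B := mkset _ => Bw.
have cB : compact B.
  have := @rV_compact _ d (fun j => `[a ord0 j, b ord0 j]%classic).
  by apply => j; exact: segment_compact.
have sB : closure [set x | bump a b n x != 0] `<=` B.
  rewrite [X in _ `<=` X](closure_id _).1; last first.
    by apply: compact_closed => //; exact: norm_hausdorff.
  apply: closureS => x /= bx j; have [xj|xj] := pselect (a ord0 j < x ord0 j < b ord0 j).
    by rewrite in_itv/=; case/andP: xj => /ltW -> /ltW ->.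
  by move: bx; rewrite bump_out ?eqxx// => /(_ j).
split.
- by apply: (@smooth_prod (fun j => bump1 (a ord0 j) (b ord0 j) n)) => j; exact: smooth1_bump1.
- by apply: subclosed_compact cB sB; exact: closed_closure.
- exact: subset_trans sB Bw.
Qed.

End product_bump.

(** * The fundamental lemma of the calculus of variations *)

Section fundamental_lemma.
Context {R : realType} {d : nat}.
Notation E := ('rV[R]_d).
Notation mu := (lebesgue_rV R d).

Lemma aeeq_bigcup T (F : nat -> set E) (f g : E -> T) :
  (forall k, aeeq (F k) f g) -> aeeq (\bigcup_k F k) f g.
Proof.
move=> H; have := ae_foralln H.
by apply: filterS => x fg [k _ Fkx]; exact: fg Fkx.
Qed.

Lemma measurable_box (a b : E) : measurable (box a b).
Proof.
apply: (@measurable_coord_preimage _ _ (fun j => [set t | a ord0 j < t < b ord0 j])) => j.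
rewrite (_ : mkset _ = `]a ord0 j, b ord0 j[%classic); first exact: measurable_itv.
by apply/seteqP; split => t /=; rewrite in_itv.
Qed.

Definition boxes : set (set E) := [set A | exists a b, A = box a b].

Lemma boxI (a b a' b' : E) : box a b `&` box a' b' =
  box (\row_j Num.max (a ord0 j) (a' ord0 j)) (\row_j Num.min (b ord0 j) (b' ord0 j)).
Proof.
apply/seteqP; split => [x [xa xb] j|x xab].
  by rewrite !mxE gt_max lt_min; have /andP[-> ->] := xa j; have /andP[-> ->] := xb j.
by split=> j; have := xab j; rewrite !mxE gt_max lt_min;
  move=> /andP[/andP[h1 h2] /andP[h3 h4]]; rewrite ?h1 ?h2 ?h3 ?h4.
Qed.

Lemma setI_closed_boxes : setI_closed boxes.
Proof. by move=> _ _ [a [b ->]] [a' [b' ->]]; rewrite boxI; eexists; eexists. Qed.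

Lemma measurable_sub_boxes : (measurable : set (set E)) `<=` <<s boxes >>.
Proof.
suff : g_sigma_preimage (fun (i : 'I_d) (x : E) => x ord0 i) `<=` <<s boxes >> by [].
apply: smallest_sub; first exact: smallest_sigma_algebra.
rewrite -bigcup_seq => Z [i _ [Y mY <-]]; rewrite setTI.
suff : (measurable : set (set R)) `<=`
    image_set_system setT (fun x : E => x ord0 i) <<s boxes >>.
  by move=> /(_ _ mY); rewrite /image_set_system/= setTI.
have -> : (measurable : set (set R)) = <<s @RGenOpens.G R >> := RGenOpens.measurableE R.
apply: smallest_sub.
  exact/sigma_algebra_image/smallest_sigma_algebra.
move=> _ [x [y ->]]; rewrite /image_set_system/= setTI.
(* An open slab is the increasing union of boxes of half-width n in the other coordinates. *)
rewrite (_ : _ @^-1` _ = \bigcup_n box (\row_j if j == i then x else - n%:R)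
   (\row_j if j == i then y else n%:R)); last first.
  apply/seteqP; split => [z /= zxy|z [n _] /(_ i)]; last by rewrite !mxE eqxx/= in_itv.
  exists (Num.truncn `|z|).+1 => // j; rewrite !mxE; case: eqVneq => [->|_].
    by move: zxy; rewrite in_itv.
  rewrite -ltr_norml; apply: le_lt_trans (ler_coord z j) _.
  exact: truncnS_gt.
apply: sigma_algebra_bigcup => n; apply: sub_sigma_algebra.
by eexists; eexists.
Qed.

(** Pi-lambda argument: the measurable sets over which [f] has zero integral form a lambda-system
    containing the boxes, which are stable under intersection and generate the sigma-algebra. *)
Lemma ae0_of_box_integrals (a b : E) (f : E -> R) :
  mu.-integrable (box a b) (EFin \o f) ->
  (forall a' b' : E, (forall j, a ord0 j <= a' ord0 j) -> (forall j, b' ord0 j <= b ord0 j) ->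
     (\int[mu]_(x in box a' b') (f x)%:E = 0)%E) ->
  aeeq (box a b) f (fun=> 0).
Proof.
move=> fi f0; set B := box a b in fi *.
have mB : measurable B by exact: measurable_box.
pose H := [set A : set E | measurable A /\ (\int[mu]_(x in A `&` B) (f x)%:E = 0)%E].
have fiA A : measurable A -> mu.-integrable (A `&` B) (EFin \o f).
  by move=> mA; apply: integrableS fi => //; exact: measurableI.
have lH : lambda_system setT H.
  apply/dynkin_lambda_system; split.
  - by split; [exact: measurableT|rewrite setTI; exact: f0].
  - move=> A [mA A0]; split; first exact: measurableC.
    have mAB := measurableI _ _ mA mB; have mCAB := measurableI _ _ (measurableC mA) mB.
    have := @integral_setU_EFin _ _ _ mu (A `&` B) (~` A `&` B) f mAB mCAB.
    rewrite -setIUl setUv setTI => H'.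
    have := f0 a b (fun=> lexx _) (fun=> lexx _).
    rewrite -/B H' ?A0 ?add0e//.
      by apply/measurable_EFinP; case/integrableP : fi.
    by apply/disj_setPS => x [[? _] []].
  - move=> F tF HF; split; first by apply: bigcupT_measurable => k; case: (HF k).
    rewrite setI_bigcupl integral_bigcup.
    + by apply: eseries0 => k _ _; case: (HF k).
    + apply/trivIsetP => i j _ _ ij; move/trivIsetP : tF => /(_ i j I I ij) Fij.
      by rewrite setIACA Fij set0I.
    + by move=> k; apply: measurableI => //; case: (HF k).
    + rewrite -setI_bigcupl; apply: fiA; apply: bigcupT_measurable => k; by case: (HF k).
have GH : boxes `<=` H.
  move=> _ [a' [b' ->]]; split; first exact: measurable_box.
  rewrite /B boxI; apply: f0 => j; rewrite mxE ?le_max ?ge_min lexx ?orbT//.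
have mH A : measurable A -> H A.
  move=> mA; apply: (lambda_system_subset setI_closed_boxes lH GH) => //.
  exact: measurable_sub_boxes.
have : ae_eq mu B (EFin \o f) (cst 0%E).
  apply: integral_ae_eq => // A AB mA; rewrite integral0.
  by have [_] := mH A mA; rewrite setIidl.
by apply: filterS => x fx Bx; have := fx Bx => -[].
Qed.

(** On each cube of a countable cover, the bumps converge boundedly to indicators of boxes, so
    dominated convergence turns the hypothesis into vanishing box integrals; on a bounded box [f] is
    integrable, being square integrable. *)
Lemma fundamental_lemma (w : set E) (f : E -> R) : open w -> L2 w f ->
  (forall t, test_function w t -> ip w f t = 0) -> aeeq w f (fun=> 0).
Proof.
move=> ow Lf f0; have mw := open_measurable_rV ow.
have [F [Fw wE]] := open_cubes ow; rewrite [X in aeeq X]wE; apply: aeeq_bigcup => k.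
case Fk : (F k) => [[c r]|]; last exact: nearW.
have [r0 cw] := Fw _ _ _ Fk.
pose a : E := \row_j (c ord0 j - r); pose b : E := \row_j (c ord0 j + r).
have -> : cube c r = box a b.
  by apply/seteqP; split => x cx j; have := cx j; rewrite !mxE ltr_distl.
have bw : box a b `<=` w.
  move=> x xab; apply: cw => j; have := xab j; rewrite !mxE -ltr_distl => /lt_trans; apply.
  by rewrite ltr_pMl// ltr1n.
have fi : mu.-integrable (box a b) (EFin \o f).
  have mb := @measurable_box a b.
  have L1 : L2 (box a b) (fun=> 1 : R).
    apply: (@L2_bounded _ _ _ _ 1 (`|c| + r)) => //; first by move=> x _; rewrite normr1.
    move=> x xab xn; exfalso; apply: xn => j.
    have := xab j; rewrite !mxE -ltr_distl subr0 => xc.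
    rewrite -(subrK (c ord0 j) (x ord0 j)); apply: (le_lt_trans (ler_normD _ _)).
    by rewrite addrC ler_ltD// ler_coord.
  have Lfb : L2 (box a b) f.
    by case: Lf => mf f2; split; [exact: measurable_funS mf|exact: integrableS f2].
  by apply: eq_integrable (L2M_integrable mb Lfb L1) => // x _ /=; rewrite mulr1.
apply: ae0_of_box_integrals => // a' b' aa' bb'.
have mb' := @measurable_box a' b'.
have ab' : box a' b' `<=` box a b.
  move=> x xab j; have /andP[h1 h2] := xab j.
  by rewrite (le_lt_trans (aa' j) h1) (lt_le_trans h2 (bb' j)).
have fi' : mu.-integrable (box a' b') (EFin \o f).
  by apply: integrableS fi => //; exact: measurable_box.
have mf : measurable_fun (box a' b') f by apply/measurable_EFinP; case/integrableP : fi'.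
(* The closed box from a' to b' lies within distance r of c in each coordinate, hence in the doubled
   cube, hence in w. *)
have tb n : test_function w (bump a' b' n).
  apply: test_function_bump => x xab; apply: cw => j; have := xab j.
  have := aa' j; have := bb' j; rewrite !mxE in_itv/= ltr_distl => h1 h2 /andP[h3 h4].
  by apply/andP; split; lra.
have mbump n : measurable_fun (box a' b') (bump a' b' n).
  by apply: measurable_funTS; exact: test_function_measurable (tb n).
have [_ _ cv] : [/\ mu.-integrable (box a' b') (EFin \o f),
    [sequence (\int[mu]_(x in box a' b') `|(f x * bump a' b' n x)%:E - (EFin \o f) x|)%E]_n @ \oo --> 0%E &
    [sequence (\int[mu]_(x in box a' b') (f x * bump a' b' n x)%:E)%E]_n @ \oo --> (\int[mu]_(x in box a' b') (EFin \o f) x)%E].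
  apply: (dominated_convergence mb' _ _ _ (integrable_abse fi')).
  - by move=> n; apply/measurable_EFinP; exact: measurable_funM.
  - exact/measurable_EFinP.
  - apply: nearW => x xab; apply: cvg_EFin; first exact: nearW.
    have := @bump_cvg _ _ a' b' x; rewrite indicE mem_set//= mulr1n => h.
    by rewrite -[X in _ --> X]mulr1; apply: cvgM => //; exact: cvg_cst.
  - apply: nearW => x n xab; rewrite /= lee_fin normrM ler_piMr//.
    by have /andP[h1 h2] := bump_bound a' b' n x; rewrite ger0_norm.
have : [sequence (\int[mu]_(x in box a' b') (f x * bump a' b' n x)%:E)%E]_n @ \oo --> 0%E.
  apply: cvg_near_cst; apply: nearW => n.
  have fb0 : ip (box a' b') f (bump a' b' n) = 0.
    rewrite (ip_support (w := box a' b')) => [|x]; last exact: bump_out.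
    rewrite -(ip_support (w := w)); first exact: f0.
    by move=> x wx; exact: test_function_out (tb n) wx.
  rewrite -[LHS]fineK; first by rewrite -[fine _]/(ip (box a' b') f (bump a' b' n)) fb0.
  apply: integrable_fin_num => //.
  have Lfb : L2 (box a' b') f.
    by case: Lf => mf' f2; split; [exact: mf|apply: integrableS f2 => //; exact: subset_trans bw].
  exact: (L2M_integrable mb' Lfb (test_function_L2 mb' (tb n))).
by move=> c0; exact: (cvg_unique (@ereal_hausdorff R) cv c0).
Qed.

End fundamental_lemma.

(** * Weak gradients and H^1_0 *)

Section weak_gradient.
Context {R : realType} {d : nat}.
Notation E := ('rV[R]_d).
Notation mu := (lebesgue_rV R d).
Notation e_ i := (delta_mx ord0 i : E).
Variable w : set E.
Hypothesis ow : open w.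
Implicit Types (f g t u v : E -> R) (F G : E -> E).
Let mw : measurable w := open_measurable_rV ow.

Lemma aeeq_forall_coord (w' : set E) F G :
  (forall i, aeeq w' (fun x => F x ord0 i) (fun x => G x ord0 i)) -> aeeq w' F G.
Proof.
move=> H; have : {ae mu, forall x, forall i, w' x -> F x ord0 i = G x ord0 i}.
  by apply: filter_forall => i; exact: H.
apply: filterS => x FG wx.
by apply/rowP => i; exact: FG.
Qed.

(** The fundamental lemma applied to each component of the difference. Every later computation with
    [wgrad] escapes the choice made by [get] through this uniqueness. *)
Lemma is_wgrad_unique f G G' : is_wgrad w f G -> is_wgrad w f G' -> aeeq w G G'.
Proof.
move=> [LG fG] [LG' fG']; apply: aeeq_forall_coord => i.
have : aeeq w (fun x => G x ord0 i - G' x ord0 i) (fun=> 0).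
  apply: fundamental_lemma => //; first by apply: L2B; [exact: mw|exact: LG|exact: LG'].
  move=> t tt; have Lt := test_function_L2 mw tt.
  rewrite ipBl//.
  by have := fG _ tt i; have := fG' _ tt i; lra.
by apply: filterS => x H wx; apply/eqP; rewrite -subr_eq0 H.
Qed.

Lemma wgradP f : H1 w f -> is_wgrad w f (wgrad w f).
Proof. by move=> [_ fG]; exact: getPex fG. Qed.

Lemma wgrad_ae f G : H1 w f -> is_wgrad w f G -> aeeq w (wgrad w f) G.
Proof. by move=> /wgradP; exact: is_wgrad_unique. Qed.

Lemma L2v_wgrad f : H1 w f -> L2v w (wgrad w f).
Proof. by move=> /wgradP[]. Qed.

Lemma is_wgradD (a : R) f g F G : L2 w f -> L2 w g ->
  is_wgrad w f F -> is_wgrad w g G ->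
  is_wgrad w (fun x => a * f x + g x) (fun x => a *: F x + G x).
Proof.
move=> Lf Lg [LF fF] [LG gG]; split; first by apply: L2vD => //; exact: L2vZ.
move=> t tt i; have Lt := test_function_L2 mw tt.
have Ldt := test_function_L2v mw tt i.
under [in RHS]eq_fun do rewrite !mxE.
rewrite !ipDl ?ipZl//; [|exact: L2Z (LF i)|exact: L2Z].
by rewrite fF// gG// mulrN opprD.
Qed.

Lemma is_wgrad_test t w' : test_function w' t -> is_wgrad w t (cgrad t).
Proof.
move=> tt; split; first exact: test_function_L2v tt.
move=> s ts i; have [st ct tw] := tt; rewrite /cgrad.
under eq_fun do rewrite mxE.
have dts := test_function_derive i ts.
rewrite (ip_support (w := w)) => [|x]; last exact: test_function_out dts.
rewrite (ip_support (w := w)) => [|x]; last exact: test_function_out ts.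
rewrite (_ : (fun x => (\row_j 'D_(e_ j) t x) ord0 i) = (fun x => 'D_(e_ i) t x)); last first.
  by apply/funext => x; rewrite mxE.
rewrite (@ip_derive_test _ _ w)//.
- exact: smooth_continuous.
- by move=> x; exact: smooth_derivable.
- by apply: smooth_continuous; exact: smooth_derive.
Qed.

Lemma H1D (a : R) f g : H1 w f -> H1 w g -> H1 w (fun x => a * f x + g x).
Proof.
move=> [Lf [F fF]] [Lg [G gG]]; split; first by apply: L2D => //; exact: L2Z.
by eexists; exact: is_wgradD fF gG.
Qed.

Lemma wgradD (a : R) f g : H1 w f -> H1 w g ->
  aeeq w (wgrad w (fun x => a * f x + g x)) (fun x => a *: wgrad w f x + wgrad w g x).
Proof.
move=> Hf Hg; apply: wgrad_ae; first exact: H1D.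
by apply: is_wgradD; [case: Hf|case: Hg|exact: wgradP|exact: wgradP].
Qed.

Lemma H1_test w' t : test_function w' t -> H1 w t.
Proof. by move=> tt; split; [exact: test_function_L2 tt|eexists; exact: is_wgrad_test tt]. Qed.

Definition energy u v := ipv w (wgrad w u) (wgrad w v).

Lemma energyC u v : energy u v = energy v u.
Proof. exact: ipvC. Qed.

Lemma energyDl (a : R) u v z : H1 w u -> H1 w v -> H1 w z ->
  energy (fun x => a * u x + v x) z = a * energy u z + energy v z.
Proof.
move=> Hu Hv Hz; have [Lu Lv Lz] := And3 (L2v_wgrad Hu) (L2v_wgrad Hv) (L2v_wgrad Hz).
have Lau := L2vZ mw a Lu.
rewrite /energy (ipv_ae mw _ _ Lz (wgradD a Hu Hv)); last 2 first.
- by apply: L2v_wgrad; exact: H1D.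
- exact: L2vD.
by rewrite ipvDl// ipvZl.
Qed.

Lemma energyDr (a : R) u v z : H1 w u -> H1 w v -> H1 w z ->
  energy z (fun x => a * u x + v x) = a * energy z u + energy z v.
Proof. by move=> Hu Hv Hz; rewrite energyC (energyDl a Hu Hv Hz) (energyC u) (energyC v). Qed.

Lemma energy_sqrD (a : R) u v : H1 w u -> H1 w v ->
  energy (fun x => a * u x + v x) (fun x => a * u x + v x) =
  a ^+ 2 * energy u u + 2 * a * energy u v + energy v v.
Proof.
move=> Hu Hv; have Huv := H1D a Hu Hv.
rewrite (energyDl a Hu Hv Huv) (energyDr a Hu Hv Hu) (energyDr a Hu Hv Hv) (energyC v u).
by move: (energy u u) (energy u v) (energy v v) => x y z; ring.
Qed.

Lemma energy_ge0 u : 0 <= energy u u.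
Proof. exact: ipv_ge0. Qed.

Lemma normL2v_wgrad_sqr u : normL2v w (wgrad w u) ^+ 2 = energy u u.
Proof. exact: normL2v_sqr. Qed.

Lemma energy_CS2 u v : H1 w u -> H1 w v -> energy u v ^+ 2 <= energy u u * energy v v.
Proof. by move=> Hu Hv; apply: ipv_CS2 => //; exact: L2v_wgrad. Qed.

Lemma test_function0 : test_function w (fun=> 0).
Proof.
have s0 : [set x : E | (0 : R) != 0] = set0 by apply/seteqP; split => x //=; rewrite eqxx.
split; last by rewrite s0 closure0.
  apply: (@smooth_of_closed _ _ [set (fun=> 0)]) => // _ ->; split.
    by move=> x; exact: cst_continuous.
  by move=> i; exists (fun=> 0) => // x; exact: is_derive_cst.
by rewrite s0 closure0; exact: compact0.
Qed.

Lemma energy_test_sub v t : H1 w v -> test_function w t ->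
  aeeq w (wgrad w (v \- t)) (fun x => wgrad w v x - cgrad t x).
Proof.
move=> Hv tt; have Ht := H1_test tt.
have -> : v \- t = (fun x => -1 * t x + v x) by apply/funext => x /=; rewrite mulN1r addrC.
apply: aeeq_trans (wgradD _ Ht Hv) _.
have := wgrad_ae Ht (is_wgrad_test tt); apply: filterS => x tE wx.
by rewrite tE// scaleN1r addrC.
Qed.

Lemma H1B u v : H1 w u -> H1 w v -> H1 w (u \- v).
Proof.
move=> Hu Hv; have -> : u \- v = (fun x => -1 * v x + u x).
  by apply/funext => x /=; rewrite mulN1r addrC.
exact: H1D.
Qed.

Lemma energyBl u v z : H1 w u -> H1 w v -> H1 w z ->
  energy (u \- v) z = energy u z - energy v z.
Proof.
move=> Hu Hv Hz; have -> : u \- v = (fun x => -1 * v x + u x).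
  by apply/funext => x /=; rewrite mulN1r addrC.
by rewrite energyDl// mulN1r addrC.
Qed.

Lemma energyBr u v z : H1 w u -> H1 w v -> H1 w z ->
  energy z (u \- v) = energy z u - energy z v.
Proof. by move=> Hu Hv Hz; rewrite energyC (energyBl Hu Hv Hz) (energyC u) (energyC v). Qed.

Lemma H10_H1 v : H10 w v -> H1 w v.
Proof. by case. Qed.

Lemma H10_L2 v : H10 w v -> L2 w v.
Proof. by case=> -[]. Qed.

Lemma H10_0 : H10 w (fun=> 0).
Proof.
split; first exact: H1_test test_function0.
move=> eps eps0; exists (fun=> 0); first exact: test_function0.
have H0 : H1 w (fun=> 0) := H1_test test_function0.
have -> : (fun=> 0) \- (fun=> 0) = (fun=> 0) :> (E -> R) by apply/funext => x /=; rewrite subrr.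
rewrite normL2v_wgrad_sqr normL2_sqr// ip0l//.
have := energyDl 1 H0 H0 H0; rewrite (_ : (fun x => _) = fun=> 0); last first.
  by apply/funext => x; rewrite mul1r addr0.
by rewrite mul1r add0r; lra.
Qed.

(** Up to the factor x, the difference of the two sides is (a x - y)^2 + (x z - y^2). It absorbs the
    cross term of the square of a sum without square roots. *)
Lemma amgm_of_CS (a x y z : R) :
  0 <= x -> 0 <= z -> y ^+ 2 <= x * z -> 2 * a * y <= a ^+ 2 * x + z.
Proof.
move=> x0 z0 yxz; have [xe0|xn0] := eqVneq x 0.
  have -> : y = 0 by apply/eqP; rewrite -sqrf_eq0 eq_le sqr_ge0 andbT (le_trans yxz)// xe0 mul0r.
  by rewrite mulr0 addr_ge0// mulr_ge0// sqr_ge0.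
have xp : 0 < x by rewrite lt_neqAle eq_sym xn0.
rewrite -subr_ge0 -(pmulr_rge0 _ xp).
rewrite (_ : x * (_ - _) = (a * x - y) ^+ 2 + (x * z - y ^+ 2)); last by ring.
by rewrite addr_ge0 ?sqr_ge0// subr_ge0.
Qed.

Lemma sum_quadratic_lt (a p q p' q' x y eps : R) :
  2 * a * x <= a ^+ 2 * p + q -> 2 * a * y <= a ^+ 2 * p' + q' ->
  p + p' < eps / (2 * a ^+ 2 + 2) -> q + q' < eps / (2 * a ^+ 2 + 2) ->
  a ^+ 2 * p + 2 * a * x + q + (a ^+ 2 * p' + 2 * a * y + q') < eps.
Proof.
have a2 := sqr_ge0 a; move=> h1 h2 h3 h4.
have := ler_wpM2l a2 (ltW h3).
have : (2 * a ^+ 2 + 2) * (eps / (2 * a ^+ 2 + 2)) = eps by rewrite mulrC divfK// gt_eqF//; lra.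
lra.
Qed.

Lemma H10D (a : R) f g : H10 w f -> H10 w g -> H10 w (fun x => a * f x + g x).
Proof.
move=> [Hf fT] [Hg gT]; split; first exact: H1D.
(* With the cross terms absorbed, the squared norm of a f + g costs at most 2 a^2 times that of f
   plus 2 times that of g, whence the tolerance. *)
move=> eps eps0; pose del := eps / (2 * a ^+ 2 + 2).
have a2 := sqr_ge0 a.
have del0 : 0 < del by rewrite divr_gt0//; lra.
have [t tt tf] := fT _ del0; have [s ss sg] := gT _ del0.
exists (fun x => a * t x + s x); first exact: test_functionD.
have Ht := H1_test tt; have Hs := H1_test ss.
have Hft := H1B Hf Ht; have Hgs := H1B Hg Hs.
have -> : (fun x => a * f x + g x) \- (fun x => a * t x + s x) =
    (fun x => a * (f \- t) x + (g \- s) x).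
  by apply/funext => x /=; ring.
rewrite normL2v_wgrad_sqr normL2_sqr // in tf; rewrite normL2v_wgrad_sqr normL2_sqr// in sg.
rewrite normL2v_wgrad_sqr normL2_sqr//.
have Hafg := H1D a Hft Hgs.
have [Lft Lgs] : L2 w (f \- t) /\ L2 w (g \- s) by case: Hft; case: Hgs.
have i1 := ip_sqrD mw a Lft Lgs; have e1 := energy_sqrD a Hft Hgs.
have i2 := ip_CS2 mw Lft Lgs; have e2 := energy_CS2 Hft Hgs.
have j1 := amgm_of_CS a (ip_ge0 _ _) (ip_ge0 _ _) i2.
have j2 := amgm_of_CS a (energy_ge0 _) (energy_ge0 _) e2.
rewrite i1 e1.
exact: (sum_quadratic_lt j1 j2 tf sg).
Qed.

Lemma H10_sum (s : seq nat) (a : nat -> R) (f : nat -> E -> R) :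
  (forall k, k \in s -> H10 w (f k)) -> H10 w (fun x => \sum_(k <- s) a k * f k x).
Proof.
elim: s => [|k s IH] Hf; first by under eq_fun do rewrite big_nil; exact: H10_0.
under eq_fun do rewrite big_cons.
apply: H10D; first by apply: Hf; rewrite mem_head.
by apply: IH => j js; apply: Hf; rewrite in_cons js orbT.
Qed.

Lemma energy_suml (s : seq nat) (a : nat -> R) (f : nat -> E -> R) v :
  (forall k, k \in s -> H10 w (f k)) -> H1 w v ->
  energy (fun x => \sum_(k <- s) a k * f k x) v = \sum_(k <- s) a k * energy (f k) v.
Proof.
move=> + Hv; elim: s => [|k s IH] Hf.
  under eq_fun do rewrite big_nil; rewrite big_nil.
  have H0 := H10_H1 H10_0.
  have := energyDl 1 H0 H0 Hv; rewrite (_ : (fun x => _) = fun=> 0); last first.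
    by apply/funext => x; rewrite mul1r addr0.
  by rewrite mul1r; lra.
under eq_fun do rewrite big_cons; rewrite big_cons.
have Hs : forall j, j \in s -> H10 w (f j) by move=> j js; apply: Hf; rewrite in_cons js orbT.
rewrite energyDl; [by rewrite IH| | |exact: Hv].
- by apply: H10_H1; apply: Hf; rewrite mem_head.
- by apply: H10_H1; exact: H10_sum.
Qed.

(** Turns the gradient chosen for v - t in the definition of [H10] into the chosen gradient of v
    minus the classical gradient of t, and separates the two norms. *)
Lemma H10_approx v eps : H10 w v -> 0 < eps -> exists2 t, test_function w t &
  normL2 w (fun x => v x - t x) < eps /\ normL2v w (fun x => wgrad w v x - cgrad t x) < eps.
Proof.
move=> [Hv vT] e0; have [t tt h] := vT _ (exprn_gt0 2 e0); exists t => //.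
have Lt := L2v_wgrad Hv; have Lct := test_function_L2v mw tt.
have E2 : normL2v w (wgrad w (v \- t)) ^+ 2 =
    normL2v w (fun x => wgrad w v x - cgrad t x) ^+ 2.
  have Hvt := L2v_wgrad (H1B Hv (H1_test tt)).
  have LB := L2vB mw Lt Lct.
  rewrite !normL2v_sqr (ipv_ae mw Hvt LB Hvt (energy_test_sub Hv tt)).
  by rewrite ipvC (ipv_ae mw Hvt LB LB (energy_test_sub Hv tt)).
rewrite E2 in h; split; rewrite -(@ltr_pXn2r _ 2)// ?nnegrE ?sqrtr_ge0// ?(ltW e0)//.
  by apply: le_lt_trans h; rewrite lerDl sqr_ge0.
by apply: le_lt_trans h; rewrite lerDr sqr_ge0.
Qed.

(** Both terms are continuous in v for the H1 norm, so the identity extends from test functions to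
    their closure; the 1 in [K] only keeps it positive. *)
Lemma H10_density F g v : L2v w F -> L2 w g ->
  (forall t, test_function w t -> ipv w F (cgrad t) + ip w g t = 0) ->
  H10 w v -> ipv w F (wgrad w v) + ip w g v = 0.
Proof.
move=> LF Lg Fg Hv; have Lv := H10_L2 Hv; have Lwv := L2v_wgrad (H10_H1 Hv).
apply/eqP; rewrite -normr_eq0 eq_le normr_ge0 andbT.
apply/ler_addgt0Pr => e e0; rewrite add0r.
pose K := normL2v w F + normL2 w g + 1.
have F0 : 0 <= normL2v w F by exact: sqrtr_ge0.
have g0 : 0 <= normL2 w g by exact: sqrtr_ge0.
have K0 : 0 < K by rewrite /K; lra.
have [t tt [t1 t2]] := H10_approx Hv (divr_gt0 e0 K0).
have Lt := test_function_L2 mw tt; have Lct := test_function_L2v mw tt.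
have -> : ipv w F (wgrad w v) + ip w g v = ipv w F (fun x => wgrad w v x - cgrad t x)
   + ip w g (fun x => v x - t x).
  by rewrite ipvBr// ipBr//; have := Fg t tt; lra.
apply: (le_trans (ler_normD _ _)).
have h1 := ipv_CS mw LF (L2vB mw Lwv Lct).
have h2 := ip_CS mw Lg (L2B mw Lv Lt).
apply: (@le_trans _ _ (K * (e / K))); last by rewrite mulrC divfK// gt_eqF.
have h3 := ler_wpM2l F0 (ltW t2); have h4 := ler_wpM2l g0 (ltW t1).
have : 0 <= e / K by rewrite divr_ge0// ltW.
rewrite /K !mulrDl; lra.
Qed.

(** Replacing v by a nearby test function t costs at most sqrt C times the norm of the gradient
    error. Against t, one integration by parts moves the derivative from [u n] to t: the energy
    becomes minus the inner product of [u n] with the Laplacian of t, which tends to 0. *)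
Lemma energy_weak_cvg0 (u : nat -> E -> R) (C : R) v :
  (forall n, H1 w (u n)) -> (forall n, energy (u n) (u n) <= C) ->
  normL2 w (u n) @[n --> \oo] --> (0 : R) -> H10 w v ->
  energy (u n) v @[n --> \oo] --> (0 : R).
Proof.
move=> Hu uC u0 Hv.
have C0 : 0 <= C := le_trans (energy_ge0 _) (uC 0%N).
apply/cvgrPdist_le => e e0.
pose K := Num.sqrt C + 1.
have K0 : 0 < K by rewrite ltr_wpDl// sqrtr_ge0.
have e20 : 0 < e / 2 by rewrite divr_gt0.
have [t tt [_ t2]] := H10_approx Hv (divr_gt0 e20 K0).
have Lct := test_function_L2v mw tt; have Lwv := L2v_wgrad (H10_H1 Hv).
pose dd i x := 'D_(e_ i) (fun x => 'D_(e_ i) t x) x.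
have td i : test_function w (dd i) by do 2 apply: test_function_derive.
pose B := \sum_(i < d) normL2 w (dd i) + 1.
have B0 : 0 < B by rewrite ltr_wpDl// sumr_ge0// => i _; exact: sqrtr_ge0.
have := u0 => /cvgrPdist_le /(_ _ (divr_gt0 e20 B0)).
apply: filterS => n; rewrite !sub0r !normrN => un.
have Lwu := L2v_wgrad (Hu n); have Lu : L2 w (u n) by case: (Hu n).
have -> : energy (u n) v = ipv w (wgrad w (u n)) (fun x => wgrad w v x - cgrad t x)
    + ipv w (wgrad w (u n)) (cgrad t).
  by rewrite ipvBr// subrK.
apply: (le_trans (ler_normD _ _)); rewrite [leRHS](splitr e); apply: lerD.
  apply: (le_trans (ipv_CS mw Lwu (L2vB mw Lwv Lct))).
  have h1 : normL2v w (wgrad w (u n)) <= Num.sqrt C by apply: ler_wsqrtr; exact: uC.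
  have h2 := sqrtr_ge0 (ipv w (fun x => wgrad w v x - cgrad t x) (fun x => wgrad w v x - cgrad t x)).
  have h3 : K * (e / 2 / K) = e / 2 by rewrite mulrC divfK// gt_eqF.
  have h4 := sqrtr_ge0 C.
  apply: (@le_trans _ _ (K * (e / 2 / K))); last by rewrite h3.
  apply: ler_pM => //; [exact: sqrtr_ge0| |exact: ltW].
  by rewrite (le_trans h1)// lerDl.
rewrite ipvE//.
have -> : \sum_(i < d) ip w (fun x => wgrad w (u n) x ord0 i) (fun x => cgrad t x ord0 i) =
    - \sum_(i < d) ip w (u n) (dd i).
  rewrite -sumrN; apply: eq_bigr => i _.
  have [_ uG] := wgradP (Hu n).
  have -> : (fun x => cgrad t x ord0 i) = (fun x => 'D_(e_ i) t x).
    by apply/funext => x; rewrite mxE.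
  have := uG _ (test_function_derive i tt) i.
  have -> : (fun x => cgrad (fun x => 'D_(e_ i) t x) x ord0 i) = dd i.
    by apply/funext => x; rewrite mxE.
  by move=> ->; rewrite opprK.
rewrite normrN; apply: (le_trans (ler_norm_sum _ _ _)).
apply: (@le_trans _ _ (\sum_(i < d) normL2 w (u n) * normL2 w (dd i))).
  by apply: ler_sum => i _; apply: ip_CS => //; exact: test_function_L2 (td i).
rewrite -mulr_sumr; apply: (@le_trans _ _ (e / 2 / B * B)); last by rewrite divfK// gt_eqF.
have nu : normL2 w (u n) <= e / 2 / B by move: un; rewrite ger0_norm ?sqrtr_ge0.
apply: ler_pM => //; first exact: sqrtr_ge0.
  by apply: sumr_ge0 => i _; exact: sqrtr_ge0.
by rewrite lerDl.
Qed.

End weak_gradient.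

(** * Eigenvalue clusters *)

Lemma cvg_sum_seq (R : realType) (I : Type) (s : seq I) (P : pred I)
    (f : I -> nat -> R) (l : I -> R) :
  (forall i, P i -> f i n @[n --> \oo] --> l i) ->
  (\sum_(i <- s | P i) f i n) @[n --> \oo] --> \sum_(i <- s | P i) l i.
Proof.
move=> fl; elim: s => [|i s IH].
  by under eq_fun do rewrite big_nil; rewrite big_nil; exact: cvg_cst.
under eq_fun do rewrite big_cons; rewrite big_cons; case: ifPn => // Pi.
by apply: cvgD => //; exact: fl.
Qed.

Section cluster_estimate.
Context {R : realType}.
(** The estimate is isolated as a statement about real numbers: [c i k] stands for (phi_ih, phi_k),
    [eta i] for the squared flux error, [rho i k] for (r_(ih), phi_k) and [D i] for a bound on the
    squared norm of r_(ih). *)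
Variables (lam lamh eta D : nat -> R) (c rho : nat -> nat -> R) (m M : nat) (ulam olam c_h : R).
Hypotheses (m1 : (1 <= m)%N) (mM : (m <= M)%N).
Hypothesis lam_ge0 : forall k, (1 <= k)%N -> 0 <= lam k.
Hypothesis lam_mono : forall j k, (1 <= j <= k)%N -> lam j <= lam k.
Hypothesis lamh_ge0 : forall i, (m <= i <= M)%N -> 0 <= lamh i.
Hypothesis lamh_mono : forall i, (m <= i <= M)%N -> lamh m <= lamh i <= lamh M.
Hypothesis lower_gap : (1 < m)%N -> [/\ 0 <= olam, lam m.-1 <= olam & olam < lamh m].
Hypothesis upper_gap : lamh M < ulam /\ ulam <= lam M.+1.
Hypothesis c_hM : (1 - lamh M / ulam)^-1 <= c_h.
Hypothesis c_hm : (1 < m)%N -> (lamh m / olam - 1)^-1 <= c_h.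
Hypothesis sum_c : forall k, (m <= k <= M)%N -> \sum_(m <= i < M.+1) c i k ^+ 2 <= 1.
Hypothesis energy_c : forall i, (m <= i <= M)%N ->
  \sum_(1 <= k < n.+1) lam k * c i k ^+ 2 @[n --> \oo] --> lamh i.
Hypothesis sum_eta : forall i n, (m <= i <= M)%N ->
  \sum_(1 <= k < n.+1) (lamh i - lam k) ^+ 2 * c i k ^+ 2 / lam k <= eta i.

Let incl k : bool := (m <= k <= M)%N.

(** Below the cluster, lam / (lamh - lam) increases with lam and decreases with lamh, so it is at
    most its value at (olam, lamh m). Above it, lam / (lam - lamh) decreases with lam and increases
    with lamh, so the extreme value is at (ulam, lamh M). These two values are the terms of c_h. *)
Lemma gap_le i k : incl i -> (1 <= k)%N -> ~~ incl k -> 0 < lam k ->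
  lam k <= c_h * `|lamh i - lam k|.
Proof.
move=> ci k1 ck lk; have [hu1 hu2] := upper_gap.
have l0 := lamh_ge0 ci; have /andP[li1 li2] := lamh_mono ci.
have uM0 : 0 < ulam by apply: le_lt_trans hu1; exact: le_trans li2.
have [km|mk] := ltnP k m.
  have m1' : (1 < m)%N by exact: leq_ltn_trans km.
  have [q0 q1 q2] := lower_gap m1'.
  have lo : lam k <= olam.
    by apply: le_trans q1; apply: lam_mono; rewrite k1 -ltnS prednK.
  have op : 0 < olam by exact: lt_le_trans lo.
  rewrite gtr0_norm ?subr_gt0; last exact: (le_lt_trans lo (lt_le_trans q2 li1)).
  apply: (@le_trans _ _ ((lamh m / olam - 1)^-1 * (lamh i - lam k))); last first.
    rewrite ler_wpM2r ?c_hm// subr_ge0 (le_trans lo)// ltW//.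
    exact: lt_le_trans li1.
  have -> : lamh m / olam - 1 = (lamh m - olam) / olam by rewrite mulrBl divff// gt_eqF.
  rewrite invf_div mulrAC ler_pdivlMr ?subr_gt0//.
  have := ler_pM (ltW lk) (ltW (lt_trans op q2)) lo li1.
  by rewrite mulrBr mulrBr (mulrC olam (lam k)); lra.
have {ck}Mk : (M < k)%N by move: ck; rewrite /incl mk/= -ltnNge.
have ul : ulam <= lam k by apply: (le_trans hu2); apply: lam_mono.
rewrite ltr0_norm ?subr_lt0; last exact: (le_lt_trans li2 (lt_le_trans hu1 ul)).
rewrite opprB.
have ud : 1 - lamh M / ulam = (ulam - lamh M) / ulam by rewrite mulrBl divff// gt_eqF.
apply: (@le_trans _ _ ((1 - lamh M / ulam)^-1 * (lam k - lamh i))); last first.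
  by rewrite ler_wpM2r// subr_ge0 ltW// (le_lt_trans li2)// (lt_le_trans hu1).
rewrite ud invf_div mulrAC ler_pdivlMr ?subr_gt0//.
have := ler_pM (ltW uM0) l0 ul li2.
by rewrite !mulrBr (mulrC ulam (lam k)); lra.
Qed.

Lemma c_h_ge0 : 0 <= c_h.
Proof.
apply: le_trans c_hM; rewrite invr_ge0 subr_ge0.
have [hu1 _] := upper_gap; have h : incl M by rewrite /incl mM leqnn.
have l0 := lamh_ge0 h; have uM0 : 0 < ulam by exact: le_lt_trans hu1.
by rewrite ler_pdivrMr// mul1r ltW.
Qed.

Lemma sum_incl (F : nat -> R) n : (M <= n)%N ->
  \sum_(1 <= k < n.+1) (incl k)%:R * F k = \sum_(m <= k < M.+1) F k.
Proof.
move=> Mn; have h1 : (m <= n.+1)%N by rewrite leqW// (leq_trans mM).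
have h2 : (m <= M.+1)%N by rewrite leqW.
rewrite (big_cat_nat (n := m))//= (big_cat_nat (n := M.+1) (m := m))//=.
rewrite [X in X + _]big_nat_cond big1 ?add0r; last first.
  by move=> k /andP[/andP[_ km] _]; rewrite /incl leqNgt km mul0r.
rewrite [X in _ + X]big_nat_cond [X in _ + X]big1 ?addr0; last first.
  by move=> k /andP[/andP[Mk _] _]; rewrite /incl andbC leqNgt Mk mul0r.
by apply: eq_big_nat => k; rewrite ltnS => mkM; rewrite /incl mkM mul1r.
Qed.

(** [B] is a majorant for the terms outside the cluster, left abstract so that both cases share the
    passage to the limit. Its nonnegativity also inside the cluster allows summing it over all k. *)
Lemma cluster_bound_aux (B : nat -> nat -> R) (C : R) :
  (forall i k, incl i -> (1 <= k)%N -> 0 <= B i k) ->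
  (forall i k, incl i -> (1 <= k)%N -> ~~ incl k -> lam k * c i k ^+ 2 <= B i k) ->
  (forall n, \sum_(m <= i < M.+1) \sum_(1 <= k < n.+1) B i k <= C) ->
  \sum_(m <= i < M.+1) (lamh i - lam i) <= C.
Proof.
move=> B0 cB BC; rewrite sumrB lerBlDr.
have cv : (\sum_(m <= i < M.+1) \sum_(1 <= k < n.+1) lam k * c i k ^+ 2) @[n --> \oo]
    --> \sum_(m <= i < M.+1) lamh i.
  have -> : \sum_(m <= i < M.+1) lamh i = \sum_(i <- index_iota m M.+1 | incl i) lamh i.
    by rewrite [LHS]big_nat_cond [RHS]big_seq_cond; apply: eq_bigl => i;
      rewrite mem_index_iota ltnS /incl andbb andbT.
  rewrite (_ : (fun n : nat => _) = (fun n => \sum_(i <- index_iota m M.+1 | incl i)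
      \sum_(1 <= k < n.+1) lam k * c i k ^+ 2)); last first.
    apply/funext => n; rewrite [LHS]big_nat_cond [RHS]big_seq_cond; apply: eq_bigl => i.
    by rewrite mem_index_iota ltnS /incl andbb andbT.
  by apply: cvg_sum_seq => i ci; exact: energy_c.
rewrite -(cvg_lim (@Rhausdorff R) cv); apply: limr_le; first exact: cvgP cv.
near=> n; have Mn : (M <= n)%N by near: n; exists M.
apply: (@le_trans _ _ (\sum_(m <= i < M.+1) \sum_(1 <= k < n.+1)
    (B i k + (incl k)%:R * (lam k * c i k ^+ 2)))).
  rewrite !big_nat; apply: ler_sum => i; rewrite ltnS => ci.
  rewrite !big_nat; apply: ler_sum => k /andP[k1 _].
  case: (boolP (incl k)) => ck; rewrite ?mul1r ?mul0r ?addr0 ?cB//.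
  by rewrite lerDr B0.
under eq_bigr do rewrite big_split/=.
rewrite big_split/=; apply: lerD => //.
(* Summing over i first makes [sum_c] applicable: each k of the cluster contributes at most lam k,
   which produces the exact eigenvalues to be subtracted. *)
rewrite exchange_big/=.
rewrite (eq_bigr (fun k => (incl k)%:R * (lam k * \sum_(m <= i < M.+1) c i k ^+ 2))); last first.
  by move=> k _; rewrite !mulr_sumr.
rewrite sum_incl// !big_nat; apply: ler_sum => k; rewrite ltnS => ck.
rewrite ler_piMr ?sum_c// lam_ge0// (leq_trans m1)//; by case/andP: ck.
Unshelve. all: by end_near. Qed.

Lemma cluster_bound : \sum_(m <= i < M.+1) (lamh i - lam i) <=
  c_h ^+ 2 * \sum_(m <= i < M.+1) eta i.
Proof.
have c0 := c_h_ge0.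
apply: (@cluster_bound_aux (fun i k => c_h ^+ 2 * ((lamh i - lam k) ^+ 2 * c i k ^+ 2 / lam k))).
- by move=> i k ci k1; apply: mulr_ge0; [exact: sqr_ge0|];
    apply: divr_ge0; [apply: mulr_ge0; exact: sqr_ge0|exact: lam_ge0].
(* Both sides are 0 when lam k = 0, by the convention on the inverse; otherwise this is the square
   of [gap_le] divided by lam k. *)
- move=> i k ci k1 ck; have [->|lk0] := eqVneq (lam k) 0; first by rewrite mul0r invr0 !mulr0.
  have lk : 0 < lam k by rewrite lt_neqAle eq_sym lk0 lam_ge0.
  rewrite mulrA ler_pdivlMr// mulrAC mulrA ler_wpM2r ?sqr_ge0//.
  by rewrite -expr2 -(real_normK (num_real (lamh i - _))) -exprMn lerXn2r ?nnegrE ?mulr_ge0 ?(ltW lk)// gap_le.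
- move=> n; rewrite mulr_sumr !big_nat; apply: ler_sum => i; rewrite ltnS => ci.
  by rewrite -mulr_sumr ler_wpM2l ?sqr_ge0// sum_eta.
Qed.

Hypothesis rhoE : forall i k, (m <= i <= M)%N -> (1 <= k)%N ->
  lam k * rho i k = (lamh i - lam k) * c i k.
Hypothesis sum_rho : forall i n, (m <= i <= M)%N -> \sum_(1 <= k < n.+1) rho i k ^+ 2 <= D i.

Lemma cluster_bound_dual : \sum_(m <= i < M.+1) (lamh i - lam i) <=
  \sum_(m <= i < M.+1) eta i + 2 * lamh M * c_h ^+ 2 * \sum_(m <= i < M.+1) D i.
Proof.
have c0 := c_h_ge0.
have lM0 : 0 <= lamh M by apply: lamh_ge0; rewrite mM leqnn.
have P2 : 0 <= 2 * lamh M * c_h ^+ 2 by apply: mulr_ge0; [apply: mulr_ge0|exact: sqr_ge0].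
apply: (@cluster_bound_aux (fun i k => (lamh i - lam k) ^+ 2 * c i k ^+ 2 / lam k +
   2 * lamh M * c_h ^+ 2 * rho i k ^+ 2)).
- move=> i k ci k1; rewrite addr_ge0//.
    by apply: divr_ge0; [apply: mulr_ge0; exact: sqr_ge0|exact: lam_ge0].
  by apply: mulr_ge0 => //; exact: sqr_ge0.
- move=> i k ci k1 ck; have l0 := lamh_ge0 ci; have /andP[li1 li2] := lamh_mono ci.
  have [lk0|lk0] := eqVneq (lam k) 0.
    by rewrite lk0 mul0r invr0 mulr0 add0r; apply: mulr_ge0 => //; exact: sqr_ge0.
  have lk : 0 < lam k by rewrite lt_neqAle eq_sym lk0 lam_ge0.
  (* By [rhoE], lam rho = (lamh - lam) c, and the gap inequality trades lam for c_h |lamh - lam|;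
     the common factor lam^2 is then cancelled. *)
  have cr : c i k ^+ 2 <= c_h ^+ 2 * rho i k ^+ 2.
    have E : lam k ^+ 2 * (c_h ^+ 2 * rho i k ^+ 2) =
        c_h ^+ 2 * (lamh i - lam k) ^+ 2 * c i k ^+ 2.
      by rewrite mulrCA -[X in _ * X = _]exprMn rhoE// exprMn mulrA.
    rewrite -(ler_pM2l (exprn_gt0 2 lk)) E ler_wpM2r ?sqr_ge0//.
    by rewrite -(real_normK (num_real (lamh i - _))) -exprMn lerXn2r ?nnegrE ?mulr_ge0 ?(ltW lk)// gap_le.
  (* The expanded square is lam + lamh^2 / lam - 2 lamh: the middle term is nonnegative, and the
     last is compensated by the [rho] part of the majorant. *)
  have -> : (lamh i - lam k) ^+ 2 * c i k ^+ 2 / lam k =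
      lam k * c i k ^+ 2 + (lamh i ^+ 2 / lam k - 2 * lamh i) * c i k ^+ 2 by field.
  have h1 : 0 <= lamh i ^+ 2 / lam k * c i k ^+ 2 by rewrite mulr_ge0 ?divr_ge0 ?sqr_ge0// ltW.
  have h2 : 2 * lamh i * c i k ^+ 2 <= 2 * lamh M * c_h ^+ 2 * rho i k ^+ 2.
    rewrite -[leRHS]mulrA; apply: ler_pM => //; rewrite ?sqr_ge0 ?mulr_ge0//.
    by rewrite ler_wpM2l.
  by rewrite mulrBl; lra.
- move=> n; rewrite mulr_sumr -big_split/= !big_nat; apply: ler_sum => i; rewrite ltnS => ci.
  rewrite big_split/= lerD ?sum_eta// -mulr_sumr ler_wpM2l ?sum_rho//.
Qed.

End cluster_estimate.

(** * Expansions in eigenfunctions *)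

Section spectral.
Context {R : realType} {d : nat}.
Notation E := ('rV[R]_d).
Variable w : set E.
Hypothesis ow : open w.
Let mw : measurable w := open_measurable_rV ow.
Implicit Types u v r : E -> R.

Lemma L2_lincomb (s : seq nat) (a : nat -> R) (f : nat -> E -> R) :
  (forall k, k \in s -> L2 w (f k)) -> L2 w (fun x => \sum_(k <- s) a k * f k x).
Proof.
elim: s => [|k s IH] Lf; first by under eq_fun do rewrite big_nil; exact: L20.
under eq_fun do rewrite big_cons; apply: L2D => //.
  by apply: L2Z => //; apply: Lf; rewrite mem_head.
by apply: IH => j js; apply: Lf; rewrite in_cons js orbT.
Qed.

Lemma ip_lincomb (s : seq nat) (a : nat -> R) (f : nat -> E -> R) v :
  (forall k, k \in s -> L2 w (f k)) -> L2 w v ->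
  ip w (fun x => \sum_(k <- s) a k * f k x) v = \sum_(k <- s) a k * ip w (f k) v.
Proof.
move=> + Lv; elim: s => [|k s IH] Lf.
  by under eq_fun do rewrite big_nil; rewrite big_nil ip0l.
under eq_fun do rewrite big_cons; rewrite big_cons.
have Lk : L2 w (f k) by apply: Lf; rewrite mem_head.
have Ls j : j \in s -> L2 w (f j) by move=> js; apply: Lf; rewrite in_cons js orbT.
by rewrite ipDl ?ipZl ?IH//; [exact: L2Z|exact: L2_lincomb].
Qed.

(** Pythagoras: the partial sum S satisfies (S, u) = (S, S). Keeping the equality lets it serve for
    Bessel's inequality and for Parseval's identity. *)
Lemma bessel (s : seq nat) (f : nat -> E -> R) u : uniq s ->
  (forall k, k \in s -> L2 w (f k)) ->
  (forall j k, j \in s -> k \in s -> ip w (f j) (f k) = (j == k)%:R) -> L2 w u ->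
  ip w (fun x => u x - \sum_(k <- s) ip w u (f k) * f k x)
       (fun x => u x - \sum_(k <- s) ip w u (f k) * f k x) =
  ip w u u - \sum_(k <- s) ip w u (f k) ^+ 2.
Proof.
move=> us Lf fo Lu; pose S x := \sum_(k <- s) ip w u (f k) * f k x.
rewrite -[X in ip w X _]/(fun x => u x - S x) -[X in ip w _ X]/(fun x => u x - S x).
have LS : L2 w S by exact: L2_lincomb.
have Sv v : L2 w v -> ip w S v = \sum_(k <- s) ip w u (f k) * ip w (f k) v.
  by move=> Lv; rewrite ip_lincomb.
have Su : ip w S u = \sum_(k <- s) ip w u (f k) ^+ 2.
  by rewrite Sv//; apply: eq_bigr => k _; rewrite (ipC _ (f k)) expr2.
have Sf k : k \in s -> ip w S (f k) = ip w u (f k).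
  move=> ks; rewrite Sv; last exact: Lf.
  rewrite (bigD1_seq k)//= fo// eqxx mulr1 big_seq_cond big1 ?addr0// => j /andP[js jk].
  by rewrite fo// (negbTE jk) mulr0.
have SS : ip w S S = \sum_(k <- s) ip w u (f k) ^+ 2.
  rewrite Sv// [LHS]big_seq [RHS]big_seq; apply: eq_bigr => k ks.
  by rewrite (ipC _ (f k)) Sf// expr2.
have LuS := L2B mw Lu LS.
rewrite (ipBl mw Lu LS LuS) (ipBr mw Lu LS Lu) (ipBr mw Lu LS LS) (ipC _ u S) Su SS.
by rewrite subrr subr0.
Qed.

Lemma bessel_le (s : seq nat) (f : nat -> E -> R) u : uniq s ->
  (forall k, k \in s -> L2 w (f k)) ->
  (forall j k, j \in s -> k \in s -> ip w (f j) (f k) = (j == k)%:R) -> L2 w u ->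
  \sum_(k <- s) ip w u (f k) ^+ 2 <= ip w u u.
Proof. by move=> us Lf fo Lu; rewrite -subr_ge0 -(bessel us Lf fo Lu) ip_ge0. Qed.

Variables (lam : nat -> R) (phi : nat -> E -> R).
Hypothesis Heig : dirichlet_eigenbasis w lam phi.

Let phi_H10 k : (1 <= k)%N -> H10 w (phi k). Proof. by case: Heig => H _ _ _ _; exact: H. Qed.
Let phi_L2 k : (1 <= k)%N -> L2 w (phi k). Proof. by move/phi_H10/H10_L2. Qed.
Let phi_energy k v : (1 <= k)%N -> H10 w v -> energy w (phi k) v = lam k * ip w (phi k) v.
Proof. by case: Heig => _ _ H _ _; exact: H. Qed.
Let phi_ortho j k : (1 <= j)%N -> (1 <= k)%N -> ip w (phi j) (phi k) = (j == k)%:R.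
Proof. by case: Heig => _ _ _ H _; exact: H. Qed.
Let phi_iota n k : k \in index_iota 1 n.+1 -> (1 <= k)%N.
Proof. by rewrite mem_index_iota => /andP[]. Qed.

Lemma eigenvalue_ge0 k : (1 <= k)%N -> 0 <= lam k.
Proof.
move=> k1; have := phi_energy k1 (phi_H10 k1).
by rewrite phi_ortho// eqxx mulr1 => <-; exact: energy_ge0.
Qed.

Lemma eigen_bessel n u : L2 w u -> \sum_(1 <= k < n.+1) ip w u (phi k) ^+ 2 <= ip w u u.
Proof.
move=> Lu; apply: bessel_le => //; first exact: iota_uniq.
- by move=> k /phi_iota; exact: phi_L2.
- by move=> j k /phi_iota j1 /phi_iota; exact: phi_ortho.
Qed.

Let rest u n : E -> R := fun x => u x - \sum_(1 <= k < n.+1) ip w u (phi k) * phi k x.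

Lemma rest_cvg0 u : L2 w u -> normL2 w (rest u n) @[n --> \oo] --> (0 : R).
Proof. by case: Heig => _ _ _ _; exact. Qed.

Lemma parseval u : L2 w u -> \sum_(1 <= k < n.+1) ip w u (phi k) ^+ 2 @[n --> \oo] --> ip w u u.
Proof.
move=> Lu; have h : (fun n => \sum_(1 <= k < n.+1) ip w u (phi k) ^+ 2) =
    (fun n => ip w u u - normL2 w (rest u n) * normL2 w (rest u n)).
  apply/funext => n; rewrite -expr2 normL2_sqr// bessel//.
  - by rewrite opprB addrC subrK.
  - exact: iota_uniq.
  - by move=> k /phi_iota; exact: phi_L2.
  - by move=> j k /phi_iota j1 /phi_iota; exact: phi_ortho.
rewrite h -[X in _ --> X]subr0; apply: cvgB; first exact: cvg_cst.
by rewrite -[X in _ --> X](mulr0 0); apply: cvgM; exact: rest_cvg0.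
Qed.

(* The remainders u - S_n tend to 0 in L2 and are bounded in energy, hence tend to 0
   weakly in energy against H^1_0; no Poincare inequality is involved. *)
Lemma energy_parseval u : H10 w u ->
  \sum_(1 <= k < n.+1) lam k * ip w u (phi k) ^+ 2 @[n --> \oo] --> energy w u u.
Proof.
move=> Hu; have Lu := H10_L2 Hu; have Hu1 := H10_H1 Hu.
pose S n x := \sum_(1 <= k < n.+1) ip w u (phi k) * phi k x.
have Hphi n k : k \in index_iota 1 n.+1 -> H10 w (phi k) by move=> /phi_iota; exact: phi_H10.
have HS n : H10 w (S n) := H10_sum ow (fun k => ip w u (phi k)) (@Hphi n).
have Sv n v : H10 w v ->
    energy w (S n) v = \sum_(1 <= k < n.+1) ip w u (phi k) * (lam k * ip w (phi k) v).
  move=> Hv; rewrite (energy_suml ow (fun k => ip w u (phi k)) (@Hphi n) (H10_H1 Hv)).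
  by rewrite !big_nat; apply: eq_bigr => k /andP[k1 _]; rewrite phi_energy.
have Su n : energy w (S n) u = \sum_(1 <= k < n.+1) lam k * ip w u (phi k) ^+ 2.
  by rewrite (Sv _ _ Hu); apply: eq_bigr => k _; rewrite (ipC _ (phi k)); ring.
have SS n : energy w (S n) (S n) = \sum_(1 <= k < n.+1) lam k * ip w u (phi k) ^+ 2.
  rewrite (Sv _ _ (HS n)) !big_nat; apply: eq_bigr => k /andP[k1 kn].
  rewrite (ipC _ (phi k)) (_ : ip w (S n) (phi k) = ip w u (phi k)); first by rewrite mulrCA expr2.
  rewrite ip_lincomb; [|by move=> j /phi_iota; exact: phi_L2|exact: phi_L2].
  rewrite (bigD1_seq k) ?iota_uniq ?mem_index_iota ?k1//=.
  rewrite phi_ortho// eqxx mulr1 big_seq_cond big1 ?addr0// => j /andP[/phi_iota j1 jk].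
  by rewrite phi_ortho// (negbTE jk) mulr0.
have Hr n : H1 w (rest u n).
  have -> : rest u n = u \- S n by [].
  exact: (H1B ow Hu1 (H10_H1 (HS n))).
have S0 n : 0 <= \sum_(1 <= k < n.+1) lam k * ip w u (phi k) ^+ 2.
  rewrite big_nat; apply: sumr_ge0 => k /andP[k1 _]; apply: mulr_ge0; last exact: sqr_ge0.
  exact: eigenvalue_ge0.
have ru n : energy w (rest u n) u = energy w u u - \sum_(1 <= k < n.+1) lam k * ip w u (phi k) ^+ 2.
  by have := energyBl ow Hu1 (H10_H1 (HS n)) Hu1; rewrite Su.
(* Since the energies (S_n, u) and (S_n, S_n) coincide, the remainder is energy-orthogonal to S_n,
   and its energy is that of u minus a nonnegative partial sum. *)
have rS n : energy w (rest u n) (S n) = 0.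
  have := energyBl ow Hu1 (H10_H1 (HS n)) (H10_H1 (HS n)).
  by rewrite (energyC w u (S n)) Su SS subrr.
have rr n : energy w (rest u n) (rest u n) <= energy w u u.
  have := energyBr ow Hu1 (H10_H1 (HS n)) (Hr n); rewrite rS ru.
  have <- : rest u n = u \- S n by [].
  move=> ->; rewrite subr0.
  by rewrite lerBlDr lerDl.
have := energy_weak_cvg0 ow Hr rr (rest_cvg0 Lu) Hu => cv.
rewrite (_ : (fun n => _) = (fun n => energy w u u - energy w (rest u n) u)); last first.
  by apply/funext => n; rewrite ru opprB addrC subrK.
rewrite -[X in _ --> X]subr0; apply: cvgB => //; exact: cvg_cst.
Qed.

(* Min-max: some combination of n + 1 discrete eigenfunctions is orthogonal to the
   first n exact ones. *)
Lemma eigenvalue_le_galerkin (uh : nat -> E -> R) (lamh : nat -> R) n :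
  (forall j, (1 <= j <= n.+1)%N -> H10 w (uh j)) ->
  (forall j k, (1 <= j <= n.+1)%N -> (1 <= k <= n.+1)%N ->
    ip w (uh j) (uh k) = (j == k)%:R) ->
  (forall j k, (1 <= j <= n.+1)%N -> (1 <= k <= n.+1)%N ->
    energy w (uh j) (uh k) = lamh j * (j == k)%:R) ->
  (forall j, (1 <= j <= n.+1)%N -> lamh j <= lamh n.+1) ->
  lam n.+1 <= lamh n.+1.
Proof.
move=> Huh uo ue lh; have lam_mono j k : (1 <= j <= k)%N -> lam j <= lam k.
  by case: Heig => _ H _ _ _; exact: H.
(* With more rows than columns, [A] has a nonzero left kernel vector, the source of the coefficients
   [b]; the shifts convert matrix indices, from 0, into eigenvalue indices, from 1. *)
pose A : 'M[R]_(n.+1, n) := \matrix_(j, k) ip w (uh j.+1) (phi k.+1).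
have : kermx A != 0.
  rewrite -mxrank_eq0 mxrank_ker -lt0n subn_gt0.
  by apply: leq_ltn_trans (rank_leq_col A) _.
move=> /rowV0Pn[a /sub_kermxP aA a0].
pose b j := a ord0 (inord j.-1).
pose v x := \sum_(1 <= j < n.+2) b j * uh j x.
have Hj j : j \in index_iota 1 n.+2 -> H10 w (uh j).
  by rewrite mem_index_iota => jn; apply: Huh.
have Lj j : j \in index_iota 1 n.+2 -> L2 w (uh j) by move/Hj/H10_L2.
have Hv : H10 w v := H10_sum ow b Hj.
have Lv := H10_L2 Hv.
have c0 k : (1 <= k <= n)%N -> ip w v (phi k) = 0.
  move=> /andP[k1 kn]; rewrite ip_lincomb//; last exact: phi_L2.
  have k1n : (k.-1 < n)%N by rewrite prednK.
  have := congr1 (fun B : 'rV[R]_n => B ord0 (Ordinal k1n)) aA; rewrite !mxE => aAk.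
  rewrite -[RHS]aAk big_add1/= big_mkord; apply: eq_bigr => j _.
  by rewrite /A mxE/= prednK// /b/= inord_val.
have bj j : (1 <= j <= n.+1)%N -> ip w v (uh j) = b j.
  move=> jn; rewrite ip_lincomb//; last by apply: Lj; rewrite mem_index_iota.
  rewrite (bigD1_seq j) ?iota_uniq ?mem_index_iota//= uo// eqxx mulr1.
  rewrite big_seq_cond big1 ?addr0// => i /andP[]; rewrite mem_index_iota => ij ijn.
  by rewrite uo// (negbTE ijn) mulr0.
have vv : ip w v v = \sum_(1 <= j < n.+2) b j ^+ 2.
  rewrite ip_lincomb// !big_nat; apply: eq_bigr => j jn.
  by rewrite (ipC _ (uh j)) bj// expr2.
have ev : energy w v v = \sum_(1 <= j < n.+2) lamh j * b j ^+ 2.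
  rewrite (energy_suml ow b Hj (H10_H1 Hv)) !big_nat; apply: eq_bigr => j jn.
  have jI : j \in index_iota 1 n.+2 by rewrite mem_index_iota.
  rewrite energyC (energy_suml ow b Hj (H10_H1 (Hj j jI))).
  rewrite (bigD1_seq j) ?iota_uniq//= ue// eqxx mulr1.
  rewrite big_seq_cond big1 ?addr0; first by ring.
  by move=> i /andP[]; rewrite mem_index_iota => ij ijn; rewrite ue// (negbTE ijn) !mulr0.
have vp : 0 < ip w v v.
  rewrite lt_neqAle ip_ge0 andbT eq_sym; apply: contra a0; rewrite vv.
  rewrite big_add1/= big_mkord psumr_eq0 => [/allP H|j _]; last exact: sqr_ge0.
  apply/eqP/rowP => j; rewrite mxE; have := H j (mem_index_enum j).
  by rewrite /b/= inord_val sqrf_eq0 => /eqP.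
have up : energy w v v <= lamh n.+1 * ip w v v.
  rewrite ev vv mulr_sumr !big_nat; apply: ler_sum => j jn.
  by rewrite ler_wpM2r ?sqr_ge0// lh.
(* In the expansions of the energy and of the squared norm only the indices k > n contribute, and
   there lam k is at least lam n.+1. *)
have lo : lam n.+1 * ip w v v <= energy w v v.
  rewrite -subr_ge0.
  have cv : (\sum_(1 <= k < N.+1) lam k * ip w v (phi k) ^+ 2 -
       lam n.+1 * \sum_(1 <= k < N.+1) ip w v (phi k) ^+ 2) @[N --> \oo] -->
      energy w v v - lam n.+1 * ip w v v.
    apply: cvgB; first exact: energy_parseval.
    by apply: cvgM; [exact: cvg_cst|exact: parseval].
  rewrite -(cvg_lim (@Rhausdorff R) cv); apply: limr_ge; first exact: cvgP cv.
  apply: nearW => N; rewrite mulr_sumr -sumrB big_nat; apply: sumr_ge0 => k /andP[k1 _].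
  rewrite -mulrBl; have [kn|nk] := leqP k n; first by rewrite c0 ?k1// expr0n mulr0.
  by apply: mulr_ge0; [rewrite subr_ge0; apply: lam_mono|exact: sqr_ge0].
by have := le_trans lo up; rewrite ler_pM2r.
Qed.

(** * Residual of an approximate eigenpair *)

Section residual.
Variables (lamh eta2 : R) (u : E -> R).
Hypothesis Hu : H10 w u.
Hypothesis eta2_ge0 : 0 <= eta2.
Hypothesis residual_bound : forall v, H10 w v ->
  (lamh * ip w u v - energy w u v) ^+ 2 <= eta2 * energy w v v.

Lemma residual_phi k : (1 <= k)%N ->
  lamh * ip w u (phi k) - energy w u (phi k) = (lamh - lam k) * ip w u (phi k).
Proof. by move=> k1; rewrite energyC phi_energy// (ipC _ (phi k)) mulrBl. Qed.

(** The test function carries the coefficients (lamh - lam_k) (u, phi_k) / lam_k, those of the Riesz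
    representative of the residual, truncated. The residual at it and its energy both equal the sum
    S, so S^2 <= eta2 S. *)
Lemma residual_sum n :
  \sum_(1 <= k < n.+1) (lamh - lam k) ^+ 2 * ip w u (phi k) ^+ 2 / lam k <= eta2.
Proof.
have Lu := H10_L2 Hu.
pose a k := (lamh - lam k) * ip w u (phi k) / lam k.
pose v x := \sum_(1 <= k < n.+1) a k * phi k x.
have Hphi k : k \in index_iota 1 n.+1 -> H10 w (phi k) by move=> /phi_iota; exact: phi_H10.
have Hv : H10 w v := H10_sum ow a Hphi.
set S := (X in X <= _).
have S0 : 0 <= S.
  rewrite /S big_nat; apply: sumr_ge0 => k /andP[k1 _].
  apply: divr_ge0; last exact: eigenvalue_ge0.
  by apply: mulr_ge0; exact: sqr_ge0.
have uv : ip w u v = \sum_(1 <= k < n.+1) a k * ip w u (phi k).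
  rewrite ipC ip_lincomb//; last by move=> k /phi_iota; exact: phi_L2.
  by apply: eq_bigr => k _; rewrite (ipC _ u).
have e1 : energy w u v = \sum_(1 <= k < n.+1) a k * energy w u (phi k).
  rewrite energyC (energy_suml ow a Hphi (H10_H1 Hu)).
  by apply: eq_bigr => k _; rewrite energyC.
have resv : lamh * ip w u v - energy w u v = S.
  rewrite uv e1 mulr_sumr -sumrB /S !big_nat; apply: eq_bigr => k /andP[k1 _].
  rewrite mulrCA -mulrBr residual_phi// /a; ring.
have vv : energy w v v = S.
  rewrite (energy_suml ow a Hphi (H10_H1 Hv)).
  rewrite /S !big_nat; apply: eq_bigr => k /andP[k1 kn].
  rewrite energyC (energy_suml ow a Hphi (H10_H1 (phi_H10 k1))).
  rewrite (bigD1_seq k) ?iota_uniq ?mem_index_iota ?k1//= big_seq_cond big1 ?addr0; last first.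
    by move=> j /andP[/phi_iota j1 jk]; rewrite (phi_energy j1 (phi_H10 k1)) phi_ortho// (negbTE jk) !mulr0.
  rewrite (phi_energy k1 (phi_H10 k1)) phi_ortho// eqxx mulr1 /a.
  (* For lam k = 0 the coefficient and the corresponding term of S are both 0. *)
  by have [->|l0] := eqVneq (lam k) 0; [rewrite invr0 !mulr0|field].
have := residual_bound Hv; rewrite resv vv.
have [->|Sn0] := eqVneq S 0; first by move=> _.
by rewrite expr2 ler_pM2r// lt_neqAle eq_sym Sn0.
Qed.

(** The residual bound is tested at its own Riesz representative, and one factor of the energy
    cancels. *)
Lemma dual_norm_bound r : H10 w r ->
  (forall v, H10 w v -> energy w r v = lamh * ip w u v - energy w u v) ->
  energy w r r <= eta2.
Proof.
move=> Hr rE; have := residual_bound Hr; rewrite -rE//.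
have [->|r0] := eqVneq (energy w r r) 0; first by move=> _.
by rewrite expr2 ler_pM2r// lt_neqAle eq_sym r0 energy_ge0.
Qed.

Lemma riesz_coef r k : H10 w r -> (1 <= k)%N ->
  (forall v, H10 w v -> energy w r v = lamh * ip w u v - energy w u v) ->
  lam k * ip w r (phi k) = (lamh - lam k) * ip w u (phi k).
Proof.
move=> Hr k1 rE; rewrite -residual_phi// -rE; last exact: phi_H10.
by rewrite energyC phi_energy// (ipC _ r).
Qed.

End residual.
End spectral.

(** * Polynomials and simplices *)

Section polynomial_functions.
Context {R : realType} {d : nat}.
Notation E := ('rV[R]_d).
Notation mu := (lebesgue_rV R d).
Notation e_ i := (delta_mx ord0 i : E).
Implicit Types (f g : E -> R) (s : nat).

Definition monomial (m : multinom d) (x : E) : R := \prod_(j < d) x ord0 j ^+ m j.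

Lemma polyfun_monomials s f : polyfun s f ->
  exists (S : seq (multinom d)) (c : multinom d -> R),
    (forall m, m \in S -> (mdeg m <= s)%N) /\
    forall x, f x = \sum_(m <- S) c m * monomial m x.
Proof.
move=> [P Ps fE]; exists (msupp P), (fun m => mcoeff m P); split.
  by move=> m /msize_mdeg_lt mP; rewrite -ltnS (leq_trans mP).
by move=> x; rewrite fE mevalE.
Qed.

Lemma polyfun_monomial m s : (mdeg m <= s)%N -> polyfun s (monomial m).
Proof.
move=> ms; exists (mpolyX R m); first by rewrite msizeX ltnS.
by move=> x; rewrite mevalX.
Qed.

Lemma polyfunD s f g : polyfun s f -> polyfun s g -> polyfun s (fun x => f x + g x).
Proof.
move=> [P Ps fE] [Q Qs gE]; exists (P + Q).
  by rewrite (leq_trans (msizeD_le _ _))// geq_max Ps.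
by move=> x; rewrite mevalD fE gE.
Qed.

Lemma polyfunZ s (a : R) f : polyfun s f -> polyfun s (fun x => a * f x).
Proof.
move=> [P Ps fE]; exists (a *: P); first by rewrite (leq_trans (msizeZ_le _ _)).
by move=> x; rewrite mevalZ fE.
Qed.

Lemma polyfunM s s' f g : polyfun s f -> polyfun s' g ->
  polyfun (s + s') (fun x => f x * g x).
Proof.
move=> [P Ps fE] [Q Qs gE]; exists (P * Q); last by move=> x; rewrite mevalM fE gE.
have [->|P0] := eqVneq P 0; first by rewrite mul0r msize0.
have [->|Q0] := eqVneq Q 0; first by rewrite mulr0 msize0.
by rewrite msizeM// -subn1 leq_subLR add1n -addnS -addSn leq_add.
Qed.

Lemma polyfunC s (a : R) : polyfun s (fun _ : E => a).
Proof.
exists (@mpolyC d R a); last by move=> x; rewrite mevalC.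
by rewrite msizeC; case: (_ != _).
Qed.

Lemma polyfunS s s' f : (s <= s')%N -> polyfun s f -> polyfun s' f.
Proof. by move=> ss' [P Ps fE]; exists P => //; exact: leq_trans Ps _. Qed.

Lemma polyfun_sum (I : Type) (r : seq I) s (f : I -> E -> R) :
  (forall i, polyfun s (f i)) -> polyfun s (fun x => \sum_(i <- r) f i x).
Proof.
move=> sf; elim: r => [|i r IH].
  by under eq_fun do rewrite big_nil; exact: polyfunC.
by under eq_fun do rewrite big_cons; exact: polyfunD.
Qed.

Lemma is_derive_monomial m s i : (mdeg m <= s)%N ->
  exists2 g, polyfun s g & forall x, is_derive x (e_ i) (monomial m) (g x).
Proof.
move=> ms; pose m' : multinom d := mnm_sub m (mnm1 i).
exists (fun x => (m i)%:R * monomial m' x).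
  by apply/polyfunZ/polyfun_monomial; exact: leq_trans (mdegB _ _) ms.
move=> x.
pose df (y : R) := (m i)%:R * y ^+ (m i).-1.
have fX (k : nat) (y : R) : is_derive y 1 (fun y : R => y ^+ k) (k%:R * y ^+ k.-1).
  have := is_derive_poly 'X^k y.
  by under eq_fun do rewrite hornerXn; rewrite derivXn hornerMn hornerXn mulr_natl.
apply: is_derive_eq.
  apply: (@is_derive_prod_seq _ _ (index_enum 'I_d) i (fun j y => y ^+ m j) df x).
  - exact: index_enum_uniq.
  - by move=> j; exists (fun y => (m j)%:R * y ^+ (m j).-1) => y; exact: fX.
rewrite mem_index_enum /monomial (bigD1 i)//= eqxx /df [in RHS](bigD1 i)//= mulrA.
rewrite mnmBE mnm1E eqxx subn1; congr (_ * _).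
by apply: eq_bigr => j /negbTE ji; rewrite ji mnmBE mnm1E eq_sym ji subn0.
Qed.

Lemma is_derive_polyfun s f i : polyfun s f ->
  exists2 g, polyfun s g & forall x, is_derive x (e_ i) f (g x).
Proof.
move=> /polyfun_monomials[S [c [Ss fE]]].
have -> : f = fun x => \sum_(m <- S) c m * monomial m x by exact/funext.
elim: S Ss {fE} => [_|m S IH Ss].
  exists (fun=> 0); first exact: polyfunC.
  by move=> x; under eq_fun do rewrite big_nil; exact: is_derive_cst.
have [|g sg gE] := IH; first by move=> k kS; apply: Ss; rewrite inE kS orbT.
have [|h sh hE] := @is_derive_monomial m s i; first by apply: Ss; rewrite inE eqxx.
exists (fun x => c m * h x + g x); first by apply: polyfunD => //; exact: polyfunZ.
move=> x; under eq_fun do rewrite big_cons.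
have hx := hE x; have gx := gE x.
exact: (is_deriveD (is_deriveZ _ hx) gx).
Qed.

Lemma continuous_monomial m : continuous (monomial m).
Proof.
apply: continuous_prod => j x.
apply: (@continuous_comp _ _ _ (fun y : E => y ord0 j) (fun y : R => y ^+ m j)).
  exact: coord_continuous.
exact: exprn_continuous.
Qed.

Lemma continuous_polyfun s f : polyfun s f -> continuous f.
Proof.
move=> /polyfun_monomials[S [c [Ss fE]]].
have -> : f = fun x => \sum_(m <- S) c m * monomial m x by exact/funext.
elim: S Ss {fE} => [_|m S IH Ss x].
  by under eq_fun do rewrite big_nil; exact: cst_continuous.
under eq_fun do rewrite big_cons.
have cm : continuous (fun x => c m * monomial m x).
  by move=> y; apply: (@continuousM _ _ (fun=> c m)); [exact: cst_continuous|exact: continuous_monomial].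
apply: (cvgD (cm x)).
by apply: IH => k kS; apply: Ss; rewrite inE kS orbT.
Qed.

Lemma polyfun1_affine f : polyfun 1 f -> exists v c, forall x, f x = dotv v x + c.
Proof.
move=> /polyfun_monomials[S [c [Ss fE]]].
have -> : f = fun x => \sum_(m <- S) c m * monomial m x by exact/funext.
elim: S Ss {fE} => [_|m S IH Ss].
  exists 0, 0 => x; rewrite big_nil addr0 /dotv big1// => i _.
  by rewrite mxE mul0r.
have [|v [b vb]] := IH; first by move=> k kS; apply: Ss; rewrite inE kS orbT.
have dotvDl v1 v2 (x : E) : dotv (v1 + v2) x = dotv v1 x + dotv v2 x.
  by rewrite /dotv -big_split/=; apply: eq_bigr => i _; rewrite mxE mulrDl.
have : (mdeg m <= 1)%N by apply: Ss; rewrite inE eqxx.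
rewrite leq_eqVlt => /orP[|].
  move=> /mdeg1P[i /eqP ->].
  exists (c (mnm1 i) *: e_ i + v), b => x.
  rewrite big_cons vb dotvDl addrA; congr (_ + _ + _).
  rewrite /dotv (bigD1 i)//= big1 => [|j ji]; last first.
    by rewrite !mxE eqxx/= (negbTE ji) mulr0 mul0r.
  rewrite !mxE !eqxx mulr1 addr0 /monomial (bigD1 i)//= mnm1E eqxx expr1.
  rewrite big1 ?mulr1// => j ji.
  by rewrite mnm1E eq_sym (negbTE ji) expr0.
rewrite ltnS leqn0 mdeg_eq0 => /eqP ->.
exists v, (c mnm0 + b) => x; rewrite big_cons vb addrCA; congr (_ + _).
rewrite /monomial big1 ?mulr1// => j _.
by rewrite mnm0E expr0.
Qed.

End polynomial_functions.

(** * Barycentric coordinates *)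

Section simplex.
Context {R : realType} {d : nat}.
Notation E := ('rV[R]_d).
Notation mu := (lebesgue_rV R d).
Variable T : mesh R d.
Implicit Types (K : {set vertex T}) (a b : vertex T) (x : E).

(** Converts sums over an enumeration of the vertices of one simplex into sums over all vertices of
    the mesh. *)
Lemma sum_fiber (V : lmodType R) (I : finType) n (e : 'I_n -> I) (u : 'I_n -> R) (f : I -> V) :
  \sum_b (\sum_(i < n | e i == b) u i) *: f b = \sum_(i < n) u i *: f (e i).
Proof.
rewrite [RHS](partition_big e predT)//=; apply: eq_bigr => b _.
by rewrite scaler_suml; apply: eq_bigr => i /eqP ->.
Qed.

(** The matrix with rows (1, a), for a a vertex, is invertible by affine independence, and with
    inverse B the coordinates of x are the entries of (1, x) B. A B = 1 gives the values at the
    vertices; B A = 1 gives the partition of unity and the reproduction of x. *)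
Lemma barycentric K : #|K| = d.+1 -> affinely_independent K ->
  exists (v : vertex T -> E) (c : vertex T -> R),
  [/\ forall a b, a \in K -> dotv (v b) (pt a) + c b = (a == b)%:R,
      forall b, b \notin K -> v b = 0 /\ c b = 0,
      forall x, \sum_b (dotv (v b) x + c b) = 1 &
      forall x, \sum_b (dotv (v b) x + c b) *: pt b = x].
Proof.
move=> cK affK; pose e (i : 'I_#|K|) : vertex T := enum_val i.
have eK i : e i \in K by exact: enum_valP.
pose A : 'M[R]_(#|K|, 1 + d) := \matrix_(i, j) row_mx (1%:M : 'M[R]_1) (pt (e i)) ord0 j.
have rowA i : row i A = row_mx (1%:M : 'M[R]_1) (pt (e i)).
  by apply/rowP => j; rewrite !mxE.
have mulA (u : 'rV[R]_#|K|) : u *m A =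
    row_mx ((\sum_i u ord0 i)%:M : 'M[R]_1) (\sum_i u ord0 i *: pt (e i)).
  rewrite mulmx_sum_row; under eq_bigr do rewrite rowA scale_row_mx.
  have row_mx_sum (r : seq 'I_#|K|) (X : 'I_#|K| -> 'M[R]_1) (Y : 'I_#|K| -> E) :
      \sum_(i <- r) row_mx (X i) (Y i) = row_mx (\sum_(i <- r) X i) (\sum_(i <- r) Y i).
    elim: r => [|i r IH]; first by rewrite !big_nil row_mx0.
    by rewrite !big_cons IH add_row_mx.
  rewrite row_mx_sum; congr row_mx; rewrite raddf_sum; apply: eq_bigr => i _.
  by rewrite scalemx1.
have freeA : row_free A.
  apply: inj_row_free => u; rewrite mulA -[RHS](@row_mx0 _ 1 1 d) => /eq_row_mx[u0 uA].
  have sumu : \sum_i u ord0 i = 0.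
    by have /matrixP/(_ ord0 ord0) := u0; rewrite !mxE eqxx mulr1n.
  pose c b := \sum_(i < #|K| | e i == b) u ord0 i.
  apply/rowP => i; rewrite mxE.
  have <- : c (e i) = u 0 i.
    by rewrite /c (big_pred1 i)// => j; rewrite /= (inj_eq enum_val_inj).
  apply: affK => [a aK||].
  - rewrite /c big1// => j /eqP ja; by move: aK; rewrite -ja eK.
  - have := @sum_fiber R^o _ _ e (fun i => u ord0 i) (fun=> 1).
    rewrite /GRing.scale/=; under eq_bigr do rewrite mulr1.
    by under [X in _ = X]eq_bigr do rewrite mulr1; rewrite sumu.
  - by rewrite sum_fiber.
have fullA : row_full A by rewrite /row_full (eqP freeA) cK.
have [B AB] := row_freeP freeA; have [B' BA] := row_fullP fullA.
(* The sizes [#|K|] and [1 + d] are equal only through [cK], so the left inverse is obtained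
   separately, from full rank, and identified with B. *)
have {B' BA} BA : B *m A = 1%:M.
  by rewrite -[B in LHS]mul1mx -BA -(mulmxA B') AB mulmx1.
pose beta x := row_mx (1%:M : 'M[R]_1) x *m B.
pose v b : E := \row_j \sum_(i < #|K| | e i == b) B (rshift 1 j) i.
pose c b := \sum_(i < #|K| | e i == b) B (lshift d ord0) i.
have vcE b x : dotv (v b) x + c b = \sum_(i < #|K| | e i == b) beta x ord0 i.
  rewrite /beta; under [RHS]eq_bigr do rewrite mxE big_split_ord/=.
  rewrite big_split/= addrC; congr (_ + _).
    rewrite exchange_big/= /dotv; apply: eq_bigr => j _.
    by rewrite mxE mulr_suml; apply: eq_bigr => i _; rewrite row_mxEr mulrC.
  by apply: eq_bigr => i _; rewrite big_ord1 row_mxEl mxE eqxx mul1r.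
have betaA x : beta x *m A = row_mx (1%:M : 'M[R]_1) x by rewrite -mulmxA BA mulmx1.
exists v, c; split.
- move=> a b aK; rewrite vcE.
  have -> : a = e (enum_rank_in aK a) by rewrite /e enum_rankK_in.
  set k := enum_rank_in aK a.
  rewrite /beta -rowA -row_mul AB; under eq_bigr do rewrite !mxE.
  have [<-|kb] := eqVneq (e k) b.
    rewrite (big_pred1 k) => [|j]; last by rewrite /= (inj_eq enum_val_inj).
    by rewrite eqxx.
  rewrite big1// => j /eqP jb; case: eqP => // kj.
  by move: kb; rewrite kj jb eqxx.
- move=> b bK; have eb i : (e i == b) = false.
    by apply/negbTE; apply: contraNneq bK => <-.
  split; first by apply/rowP => j; rewrite !mxE big_pred0.
  by rewrite /c big_pred0.
- move=> x; under eq_bigr do rewrite vcE.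
  have := @sum_fiber R^o _ _ e (fun i => beta x ord0 i) (fun=> 1).
  rewrite /GRing.scale/=; under eq_bigr do rewrite mulr1.
  under [X in _ = X]eq_bigr do rewrite mulr1; move=> ->.
  have := betaA x; rewrite mulA => /eq_row_mx[/matrixP/(_ ord0 ord0)].
  by rewrite !mxE !mulr1n.
- move=> x; under eq_bigr do rewrite vcE.
  by rewrite sum_fiber; have := betaA x; rewrite mulA => /eq_row_mx[].
Qed.

End simplex.

Section affine_functions.
Context {R : realType} {d : nat}.
Notation E := ('rV[R]_d).
Notation e_ i := (delta_mx ord0 i : E).

Lemma dotv_sumr (I : finType) (v : E) (c : I -> R) (p : I -> E) :
  dotv v (\sum_a c a *: p a) = \sum_a c a * dotv v (p a).
Proof.
rewrite /dotv; under [RHS]eq_bigr do rewrite mulr_sumr.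
rewrite exchange_big/=; apply: eq_bigr => i _.
rewrite summxE mulr_sumr; apply: eq_bigr => a _.
by rewrite mxE mulrCA.
Qed.

Lemma dotv_delta (v : E) i : dotv v (e_ i) = v ord0 i.
Proof.
rewrite /dotv (bigD1 i)//= mxE !eqxx mulr1 big1 ?addr0// => j ji.
by rewrite mxE eqxx (negbTE ji) mulr0.
Qed.

Lemma dotvDr (v x y : E) : dotv v (x + y) = dotv v x + dotv v y.
Proof. by rewrite /dotv -big_split/=; apply: eq_bigr => i _; rewrite mxE mulrDr. Qed.

Lemma dotvZr a (v x : E) : dotv v (a *: x) = a * dotv v x.
Proof. by rewrite /dotv mulr_sumr; apply: eq_bigr => i _; rewrite mxE mulrCA. Qed.

Lemma is_derive_affine (v : E) (c : R) (x : E) i :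
  is_derive x (e_ i) (fun x => dotv v x + c) (v ord0 i).
Proof.
have h (j : 'I_d) : is_derive x (e_ i) (fun x : E => v ord0 j * x ord0 j)
    (v ord0 j * (i == j)%:R).
  have h1 := @is_derive_coord R d id x i j 1 (is_derive_id _ _).
  by apply: is_derive_eq (is_deriveZ (v ord0 j) h1) _; rewrite mulr1.
have hs := is_derive_sum h.
have -> : (fun x => dotv v x + c) =
    (\sum_(j < d) (fun x : E => v ord0 j * x ord0 j)) + cst c.
  by apply/funext => y; rewrite /dotv -[RHS]/(_ y + c) fct_sumE.
apply: is_derive_eq (is_deriveD hs (is_derive_cst c x (e_ i))) _.
rewrite addr0 (bigD1 i)//= eqxx mulr1 big1 ?addr0// => j /negbTE ji.
by rewrite eq_sym ji mulr0.
Qed.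

Lemma affine_polyfun (v : E) (c : R) : polyfun 1 (fun x => dotv v x + c).
Proof.
apply: polyfunD; last exact: polyfunC.
apply: polyfun_sum => i; apply: polyfunZ.
have := @polyfun_monomial R d (mnm1 i) 1; rewrite mdeg1 => /(_ isT).
congr polyfun; apply/funext => x.
rewrite /monomial (bigD1 i)//= mnm1E eqxx expr1 big1 ?mulr1// => j ji.
by rewrite mnm1E eq_sym (negbTE ji) expr0.
Qed.

Lemma continuous_affine (v : E) (c : R) : continuous (fun x => dotv v x + c).
Proof. exact: continuous_polyfun (affine_polyfun v c). Qed.

End affine_functions.

(** * Simplices as intersections of half-spaces *)

Section hull.
Context {R : realType} {d : nat}.
Notation E := ('rV[R]_d).
Notation mu := (lebesgue_rV R d).
Variable T : mesh R d.
Implicit Types (K : {set vertex T}) (a b : vertex T) (x : E).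

Lemma affine_combination (v : E) (c : R) (t : vertex T -> R) : \sum_a t a = 1 ->
  dotv v (\sum_a t a *: pt a) + c = \sum_a t a * (dotv v (pt a) + c).
Proof.
move=> t1; rewrite dotv_sumr; under [RHS]eq_bigr do rewrite mulrDr.
by rewrite big_split/= -mulr_suml t1 mul1r.
Qed.

Lemma hull_bounded K : exists r, hull K `<=` cube 0 r.
Proof.
exists (\sum_(a : vertex T) \sum_(i < d) `|pt a ord0 i| + 1) => x [c [c0 _ c1 ->]] i.
rewrite mxE subr0 summxE; apply: le_lt_trans (ler_norm_sum _ _ _) _.
rewrite ltr_pwDr// ler_sum// => a _.
rewrite mxE normrM ger0_norm//.
have ca1 : c a <= 1.
  by rewrite -c1 (bigD1 a)//= lerDl sumr_ge0.
apply: (@le_trans _ _ `|pt a ord0 i|); first by rewrite ler_piMl.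
by rewrite (bigD1 i)//= lerDl sumr_ge0.
Qed.

Section coordinates.
Variables (K : {set vertex T}) (v : vertex T -> E) (c : vertex T -> R).
Hypothesis vcK : forall a b, a \in K -> dotv (v b) (pt a) + c b = (a == b)%:R.
Hypothesis vcN : forall b, b \notin K -> v b = 0 /\ c b = 0.
Hypothesis vc1 : forall x, \sum_b (dotv (v b) x + c b) = 1.
Hypothesis vcx : forall x, \sum_b (dotv (v b) x + c b) *: pt b = x.

Lemma coord_out b x : b \notin K -> dotv (v b) x + c b = 0.
Proof. by case/vcN => -> ->; rewrite addr0 /dotv big1// => i _; rewrite mxE mul0r. Qed.

Lemma hull_coord (t : vertex T -> R) b : (forall a, a \notin K -> t a = 0) ->
  \sum_a t a = 1 -> dotv (v b) (\sum_a t a *: pt a) + c b = t b.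
Proof.
move=> tN t1; rewrite affine_combination// (bigD1 b)//=.
rewrite big1 ?addr0 => [|a ab].
  have [bK|bK] := boolP (b \in K); first by rewrite vcK// eqxx mulr1.
  by rewrite tN// mul0r.
have [aK|aK] := boolP (a \in K); first by rewrite vcK// (negbTE ab) mulr0.
by rewrite tN// mul0r.
Qed.

(** Half-spaces replace convex combinations: closedness and the null boundary of an element are read
    off this form. *)
Lemma hullE : hull K = [set x | forall b, 0 <= dotv (v b) x + c b].
Proof.
apply/seteqP; split => x /=.
  by move=> [t [t0 tN t1 ->]] b; rewrite hull_coord.
move=> x0; exists (fun b => dotv (v b) x + c b); split => // a.
exact: coord_out.
Qed.

(** In positive dimension there is a second vertex, where the coordinate of b is 0 while it is 1 at
    b; hence it is not constant. *)
Lemma coord_neq0 b : (0 < d)%N -> #|K| = d.+1 -> b \in K -> v b != 0.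
Proof.
move=> d0 cK bK; apply/eqP => vb0.
have : (0 < #|K :\ b|)%N by have := cardsD1 b K; rewrite bK cK add1n => -[<-].
case/card_gt0P => a; rewrite !inE => /andP[ab aK].
have := vcK b aK; have := vcK b bK; rewrite vb0 eqxx (negbTE ab).
have dot0 x : dotv 0 x = 0 :> R by rewrite /dotv big1// => i _; rewrite mxE mul0r.
by rewrite !dot0 => -> /eqP; rewrite oner_eq0.
Qed.

Lemma hull_interior_sub : [set x | forall b, b \in K -> 0 < dotv (v b) x + c b] `<=` (hull K)°.
Proof.
move=> x xK; rewrite /interior/=.
have : \forall y \near x, forall b, b \in K -> 0 < dotv (v b) y + c b.
  apply: (@filter_forall _ _ (fun b y => b \in K -> 0 < dotv (v b) y + c b) (nbhs x)) => b.
  have [bK|bK] := boolP (b \in K); last by near=> y.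
  have : \forall y \near x, 0 < dotv (v b) y + c b.
    have h : nbhs (dotv (v b) x + c b) [set y | 0 < y].
      by apply: lt_nbhsr; exact: xK.
    exact: (@continuous_affine R d (v b) (c b) x _ h).
  by apply: filterS.
apply: filterS => y yK; rewrite hullE/= => b.
have [bK|bK] := boolP (b \in K); first exact/ltW/yK.
by rewrite coord_out.
Unshelve. all: by end_near. Qed.

(** A point of the simplex outside its interior lies on one of the hyperplanes where a barycentric
    coordinate of a vertex of K vanishes. *)
Lemma ae_hull_interior : (0 < d)%N -> #|K| = d.+1 ->
  {ae mu, forall x, hull K x -> (hull K)° x}.
Proof.
move=> d0 cK.
have : {ae mu, forall x, forall b, b \in K -> dotv (v b) x <> - c b}.
  apply: filter_forall => b; have [bK|bK] := boolP (b \in K); last first.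
    exact: aeW.
  exists [set x | dotv (v b) x = - c b]; split.
  - exact: measurable_hyperplane.
  - exact/hyperplane_null/coord_neq0.
  - by move=> x /=; apply: contra_notP => h _.
apply: filterS => x xv; rewrite {1}hullE => x0.
apply: hull_interior_sub => b bK; rewrite lt_neqAle x0 andbT eq_sym addr_eq0.
exact/eqP/xv.
Qed.

End coordinates.

Lemma hull_closed K : #|K| = d.+1 -> affinely_independent K -> closed (hull K).
Proof.
move=> cK affK; have [v [c [vcK vcN vc1 vcx]]] := barycentric cK affK.
rewrite (hullE vcK vcN vc1 vcx).
have -> : [set x | forall b, 0 <= dotv (v b) x + c b] =
    \bigcap_(b in [set: vertex T]) ((fun x => dotv (v b) x + c b) @^-1` [set y | 0 <= y]).
  by apply/seteqP; split => [x h b _|x h b]; [exact: h|exact: (h b I)].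
apply: closed_bigI => b _; apply: preimage_closed; last exact: closed_ge.
by move=> x _; exact: continuous_affine.
Qed.

End hull.

(** * Hat functions *)

(* Let s be the last point of [a, b] in the set containing a; the other sets
   still cover [s, b], s included since they are closed. *)
Lemma lipschitz_glue (R : realType) (I : finType) (F : I -> set R) (f : R -> R)
    (L : R) (J : {set I}) (a b : R) :
  (forall i, i \in J -> closed (F i)) ->
  (forall i x y, i \in J -> F i x -> F i y -> `|f x - f y| <= L * `|x - y|) ->
  a <= b -> (forall x, a <= x <= b -> exists2 i, i \in J & F i x) ->
  `|f b - f a| <= L * (b - a).
Proof.
move: {2}#|J| (erefl #|J|) => n; elim: n J a => [|n IH] J a cJ Fc Flip ab cov.
  have [|i] := cov a; first by rewrite lexx.
  by move/cards0_eq : cJ => ->; rewrite inE.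
have [|k kJ Fka] := cov a; first by rewrite lexx.
pose S : set R := [set s | a <= s <= b /\ F k s].
have Sa : S a by split => //; rewrite lexx.
have Sb : ubound S b by move=> x [/andP[]].
have hS : has_sup S by split; [exists a|exists b].
pose s := sup S.
have as_ : a <= s by apply: ub_le_sup => //; exists b.
have sb : s <= b by apply: ge_sup => //; exists a.
have Fks : F k s.
  have : closure S s by apply: closure_sup; [exists a|exists b].
  have /closure_id -> : closed (F k) by exact: Fc.
  by apply: closure_subset => x [].
have fas : `|f s - f a| <= L * (s - a).
  by rewrite -[s - a]ger0_norm ?subr_ge0//; exact: (Flip k).
have [->//|sb'] := eqVneq b s.
have {sb' sb} sb : s < b by rewrite lt_neqAle eq_sym sb' sb.
have out x : s < x <= b -> exists2 i, i \in J :\ k & F i x.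
  move=> /andP[sx xb]; have [|i iJ Fix] := cov x; first by rewrite xb (le_trans as_ (ltW sx)).
  exists i => //; rewrite !inE iJ andbT; apply/eqP => ik.
  suff : x <= s by rewrite leNgt sx.
  apply: ub_le_sup; first by exists b.
  by split; rewrite ?xb ?(le_trans as_ (ltW sx))//; rewrite -ik.
have cJk : #|J :\ k| = n by have := cardsD1 k J; rewrite cJ kJ add1n => -[].
(* The point s itself: if no remaining set contained it, closedness would keep them all off a
   neighbourhood of s, yet they cover the points just to its right. *)
have covs x : s <= x <= b -> exists2 i, i \in J :\ k & F i x.
  move=> /andP[]; rewrite le_eqVlt => /orP[/eqP <- _|sx xb]; last by apply: out; rewrite sx.
  apply: contrapT => noti.
  have : \forall x \near s, forall i, i \in J :\ k -> ~ F i x.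
    apply: (@filter_forall _ _ (fun i x => i \in J :\ k -> ~ F i x) (nbhs s)) => i.
    have [iJ|iJ] := boolP (i \in J :\ k); last by near=> y.
    have Fis : (~` F i) s by move=> Fis; apply: noti; exists i.
    have oF : open (~` F i).
      by apply: closed_openC; apply: Fc; move: iJ; rewrite !inE => /andP[].
    by have := open_nbhs_nbhs (conj oF Fis); apply: filterS => y Fy _.
  move=> /nbhs_ballP[e /= e0 He].
  pose y := Num.min (s + e / 2) b.
  have sy : s < y by rewrite lt_min sb andbT ltrDl divr_gt0.
  have [|i iJ Fiy] := out y; first by rewrite sy ge_min lexx orbT.
  apply: (He y _ i iJ Fiy); rewrite /ball/= distrC gtr0_norm ?subr_gt0//.
  rewrite ltrBlDl gt_min ltrD2l; apply/orP; left.
  by rewrite ltr_pdivrMr// ltr_pMr// ltr1n.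
have fsb : `|f b - f s| <= L * (b - s).
  apply: (IH (J :\ k)) => //; last exact: ltW.
    by move=> i; rewrite !inE => /andP[_]; exact: Fc.
  by move=> i x y; rewrite !inE => /andP[_]; exact: Flip.
rewrite -(subrKA (f s)) (le_trans (ler_normD _ _))//.
by rewrite -[X in _ <= L * X](subrKA s) mulrDr lerD.
Unshelve. all: by end_near. Qed.

Lemma measurable_fun_fin_bigcup d1 d2 (T1 : measurableType d1) (T2 : measurableType d2)
    (I : finType) (J : set I) (F : I -> set T1) (f : T1 -> T2) :
  (forall i, J i -> measurable (F i)) -> (forall i, J i -> measurable_fun (F i) f) ->
  measurable_fun (\bigcup_(i in J) F i) f.
Proof.
move=> mF mf mD A mA; rewrite setI_bigcupl.
apply: fin_bigcup_measurable; first exact: finite_finset.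
by move=> i Ji; exact: (mf i Ji (mF i Ji)).
Qed.

Section hat_functions.
Context {R : realType} {d : nat}.
Notation E := ('rV[R]_d).
Notation mu := (lebesgue_rV R d).
Notation e_ i := (delta_mx ord0 i : E).
Variables (T : mesh R d) (Omega : set E).
Hypotheses (d0 : (0 < d)%N) (oO : open Omega) (hT : matching_mesh T Omega).
Implicit Types (K : {set vertex T}) (a b : vertex T) (x : E) (psi : E -> R).

Lemma element_closed K : K \in elements T -> closed (hull K).
Proof. by move=> KT; case: hT => /(_ K KT)[cK aK] _ _ _; exact: hull_closed. Qed.

Lemma element_measurable K : K \in elements T -> measurable (hull K).
Proof. by move=> /element_closed; exact: closed_measurable_rV. Qed.

Lemma ae_element_interior K : K \in elements T ->
  {ae mu, forall x, hull K x -> (hull K)° x}.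
Proof.
move=> KT; case: hT => /(_ K KT)[cK aK] _ _ _.
by have [v [c [vcK vcN vc1 vcx]]] := barycentric cK aK; exact: ae_hull_interior vcK _ _ _ _ _.
Qed.

Lemma element_sub K : K \in elements T -> hull K `<=` closure Omega.
Proof. by move=> KT x Kx; case: hT => _ _ -> _; exists K. Qed.

Lemma closure_cover x : closure Omega x -> exists2 K, K \in elements T & hull K x.
Proof. by case: hT => _ _ -> _ [K /=]; exists K. Qed.

Definition open_cells : set E := \bigcup_(K in [set` elements T]) (hull K)°.

Lemma open_open_cells : open open_cells.
Proof. by apply: bigcup_open => K _; exact: open_interior. Qed.

Lemma ae_open_cells : {ae mu, forall x, closure Omega x -> open_cells x}.
Proof.
have : {ae mu, forall x, forall K, K \in elements T -> hull K x -> (hull K)° x}.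
  apply: filter_forall => K; have [KT|KT] := boolP (K \in elements T).
    by have := ae_element_interior KT; apply: filterS => x.
  exact: aeW.
apply: filterS => x xK /closure_cover[K KT Kx]; exists K => //.
exact: xK.
Qed.

Lemma mesh_bounded : exists r, closure Omega `<=` cube 0 r.
Proof.
have /choice[r rP] : forall K, exists r, hull K `<=` cube 0 r by move=> K; exact: hull_bounded.
exists (\sum_K `|r K|) => x /closure_cover[K KT Kx] i.
apply: lt_le_trans (rP K x Kx i) _; apply: le_trans (ler_norm _) _.
by rewrite (bigD1 K)//= lerDl sumr_ge0.
Qed.

(** One affine formula per element and vertex, fixed once for all hat functions. Vertices outside
    the element get zero data, so that sums can range over all vertices of the mesh. *)
Definition hat_coords (v : {set vertex T} -> vertex T -> E) (c : {set vertex T} -> vertex T -> R) :=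
  forall K, K \in elements T ->
  [/\ forall b, b \notin K -> v K b = 0 /\ c K b = 0,
      forall x, \sum_b (dotv (v K b) x + c K b) = 1,
      forall b x, hull K x -> 0 <= dotv (v K b) x + c K b <= 1 &
      forall a psi, is_hat a psi -> forall x, hull K x -> psi x = dotv (v K a) x + c K a].

(** An affine function on a simplex is determined by its values at the vertices, and [is_hat]
    prescribes those of a barycentric coordinate. *)
Lemma hat_coords_exists : exists v c, hat_coords v c.
Proof.
have /choice[f fP] : forall K, exists fK : (vertex T -> E) * (vertex T -> R),
    K \in elements T ->
  [/\ forall b, b \notin K -> fK.1 b = 0 /\ fK.2 b = 0,
      forall x, \sum_b (dotv (fK.1 b) x + fK.2 b) = 1,
      forall b x, hull K x -> 0 <= dotv (fK.1 b) x + fK.2 b <= 1 &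
      forall a psi, is_hat a psi -> forall x, hull K x -> psi x = dotv (fK.1 a) x + fK.2 a].
  move=> K; have [KT|KT] := boolP (K \in elements T); last by exists (fun=> 0, fun=> 0).
  have [cK aK] : #|K| = d.+1 /\ affinely_independent K by case: hT => /(_ K KT).
  have [v [c [vcK vcN vc1 vcx]]] := barycentric cK aK.
  exists (v, c) => _; split => //=.
    move=> b x; rewrite (hullE vcK vcN vc1 vcx)/= => x0; rewrite x0/=.
    by rewrite -(vc1 x) (bigD1 b)//= lerDl sumr_ge0.
  move=> a psi /(_ K KT)[[q /polyfun1_affine[w [e qE]] psiq] psib] x Kx.
  rewrite psiq// qE; case: Kx => t [t0 tN t1 ->].
  rewrite affine_combination// (hull_coord vcK _ tN t1) (bigD1 a)//= big1 => [|b ba].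
    have [aK'|aK'] := boolP (a \in K); last by rewrite tN// mul0r addr0.
    rewrite -qE -psiq ?psib// ?eqxx ?mulr1 ?addr0//.
    exists (fun b => (b == a)%:R); split => [b|b bK||].
    - exact: ler0n.
    - by case: eqP => // ba; move: bK; rewrite ba aK'.
    - by rewrite (bigD1 a)//= eqxx big1 ?addr0// => b /negbTE ->.
    - by rewrite (bigD1 a)//= eqxx scale1r big1 ?addr0// => b /negbTE ->; rewrite scale0r.
  have [bK|bK] := boolP (b \in K); last by rewrite tN// mul0r.
  rewrite -qE -psiq ?psib// ?(negbTE ba) ?mulr0//.
  exists (fun b' => (b' == b)%:R); split => [b'|b' b'K||].
  - exact: ler0n.
  - by case: eqP => // b'b; move: b'K; rewrite b'b bK.
  - by rewrite (bigD1 b)//= eqxx big1 ?addr0// => b' /negbTE ->.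
  - by rewrite (bigD1 b)//= eqxx scale1r big1 ?addr0// => b' /negbTE ->; rewrite scale0r.
by exists (fun K => (f K).1), (fun K => (f K).2).
Qed.

End hat_functions.

(** * Weak gradient of a hat function *)

Section hat_gradient.
Context {R : realType} {d : nat}.
Notation E := ('rV[R]_d).
Notation mu := (lebesgue_rV R d).
Notation e_ i := (delta_mx ord0 i : E).
Variables (T : mesh R d) (Omega : set E).
Hypotheses (d0 : (0 < d)%N) (oO : open Omega) (hT : matching_mesh T Omega).
Implicit Types (K : {set vertex T}) (x : E).
Variables (v : {set vertex T} -> vertex T -> E) (c : {set vertex T} -> vertex T -> R).
Hypothesis hvc : hat_coords v c.
Variables (a : vertex T) (psi : E -> R).
Hypothesis hpsi : is_hat a psi.

Let psiE K x : K \in elements T -> hull K x -> psi x = dotv (v K a) x + c K a.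
Proof. by move=> KT Kx; have [_ _ _ h] := hvc KT; exact: h. Qed.

Lemma hat_bound x : closure Omega x -> 0 <= psi x <= 1.
Proof.
move=> /(closure_cover hT)[K KT Kx]; rewrite (psiE KT Kx).
by have [_ _ h _] := hvc KT; exact: h.
Qed.

Lemma hat_measurable : measurable_fun (closure Omega) psi.
Proof.
case: hT => _ _ -> _; apply: measurable_fun_fin_bigcup => K /= KT.
  exact: element_measurable hT _ KT.
apply: (@eq_measurable_fun _ _ _ _ _ (fun x => dotv (v K a) x + c K a)).
  by move=> x; rewrite inE => Kx; rewrite (psiE KT Kx).
apply: (@measurable_funS _ _ _ _ setT) => //.
exact: continuous_measurable_rV (@continuous_affine _ _ _ _).
Qed.

Lemma hat_L2 : L2 Omega psi.
Proof.
have mO : measurable Omega by exact: open_measurable_rV.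
have [r rO] := mesh_bounded hT.
apply: (@L2_bounded _ _ _ _ 1 r) => //.
- apply: (@measurable_funS _ _ _ _ (closure Omega)) hat_measurable.
    by apply: closed_measurable_rV; exact: closed_closure.
  exact: subset_closure.
- move=> x /subset_closure/hat_bound/andP[p0 p1].
  by rewrite ger0_norm.
- by move=> x /subset_closure/rO.
Qed.

Lemma hat_is_derive K x i : K \in elements T -> (hull K)° x ->
  is_derive x (e_ i) psi (v K a ord0 i).
Proof.
move=> KT Kx; apply: near_eq_is_derive (is_derive_affine (v K a) (c K a) x i).
by have := Kx; rewrite /interior/=; apply: filterS => y Ky; rewrite (psiE KT Ky).
Qed.

(** The value 0 off the open cells replaces derivatives over which [is_hat] gives no control; the
    function is then Borel and bounded on the whole space. *)
Definition hat_grad x : E := if x \in open_cells T then cgrad psi x else 0.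

Lemma hat_gradE K x : K \in elements T -> (hull K)° x -> hat_grad x = v K a.
Proof.
move=> KT Kx; rewrite /hat_grad ifT; last by rewrite inE; exists K.
by apply/rowP => i; rewrite mxE; have := hat_is_derive i KT Kx => -[_ ->].
Qed.

Lemma hat_grad_out x : ~ open_cells T x -> hat_grad x = 0.
Proof. by move=> h; rewrite /hat_grad ifF//; apply/negbTE; rewrite notin_setE. Qed.

Let mcells : measurable (open_cells T).
Proof. by apply: open_measurable_rV; exact: open_open_cells. Qed.

Lemma hat_grad_measurable i : measurable_fun setT (fun x => hat_grad x ord0 i).
Proof.
rewrite -(setUv (open_cells T)).
apply/measurable_funU => //; first exact: measurableC.
split.
  apply: measurable_fun_fin_bigcup => K /= KT.
    by apply: open_measurable_rV; exact: open_interior.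
  apply: (@eq_measurable_fun _ _ _ _ _ (fun=> v K a ord0 i)).
    by move=> x; rewrite inE => Kx; rewrite (hat_gradE KT Kx).
  exact: measurable_cst.
apply: (@eq_measurable_fun _ _ _ _ _ (fun _ : E => 0 : R)).
  by move=> x; rewrite inE => /hat_grad_out ->; rewrite mxE.
exact: measurable_cst.
Qed.

Let B i : R := \sum_(K : {set vertex T}) `|v K a ord0 i|.

Lemma ler_slope K i : `|v K a ord0 i| <= B i.
Proof. by rewrite /B (bigD1 K)//= lerDl sumr_ge0. Qed.

Lemma hat_grad_bound i x : `|hat_grad x ord0 i| <= B i.
Proof.
have [[K KT Kx]|nx] := pselect (open_cells T x).
  by rewrite (hat_gradE KT Kx) ler_slope.
by rewrite hat_grad_out// mxE normr0 sumr_ge0.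
Qed.

Lemma hat_grad_L2v : L2v Omega hat_grad.
Proof.
move=> i; have mO : measurable Omega by exact: open_measurable_rV.
have [r rO] := mesh_bounded hT.
apply: (@L2_bounded _ _ _ _ (B i) r) => //.
- exact: (@measurable_funS _ _ _ _ setT) (hat_grad_measurable i).
- by move=> x _; exact: hat_grad_bound.
- by move=> x /subset_closure/rO.
Qed.

Section product.
Variables (t : E -> R) (ht : test_function Omega t).

Let t_out x : ~ Omega x -> t x = 0. Proof. exact: test_function_out ht. Qed.

Let smooth_t : smooth t. Proof. by case: ht. Qed.

Lemma hat_test_lipschitz i : exists L, forall x h,
  `|psi (x + h *: e_ i) * t (x + h *: e_ i) - psi x * t x| <= L * `|h|.
Proof.
have [M tM] := test_function_bounded ht.
have [L0 tL0] := test_function_bounded (test_function_derive i ht).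
have tL x h : `|t (x + h *: e_ i) - t x| <= L0 * `|h|.
  by apply: (lipschitz_line (v := e_ i)) => // y; exact: smooth_derivable.
have M0 : 0 <= M by exact: le_trans (tM 0).
have L00 : 0 <= L0 by exact: le_trans (tL0 0).
have B0 : 0 <= B i by exact: sumr_ge0.
exists (L0 + M * B i).
suff mono x h : 0 <= h ->
    `|psi (x + h *: e_ i) * t (x + h *: e_ i) - psi x * t x| <= (L0 + M * B i) * h.
  move=> x h; have [h0|h0] := leP 0 h; first by rewrite (ger0_norm h0); exact: mono.
  have := mono (x + h *: e_ i) (- h).
  rewrite scaleNr addrK distrC (ltr0_norm h0); apply.
  by rewrite oppr_ge0 ltW.
move=> h0; pose f s := psi (x + s *: e_ i) * t (x + s *: e_ i).
(* [None] indexes the zero set of [t], which takes care of the points of the line outside [Omega],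
   where [psi] may be arbitrary. *)
pose F (o : option {set vertex T}) : set R := if o is Some K
  then [set s | hull K (x + s *: e_ i)] else [set s | t (x + s *: e_ i) = 0].
pose J := finset (fun o : option {set vertex T} => if o is Some K then K \in elements T else true).
have cl : continuous (fun s : R => x + s *: e_ i).
  by move=> s; apply: cvgD; [exact: cvg_cst|exact: scalel_continuous].
have := @lipschitz_glue R _ F f (L0 + M * B i) J 0 h.
rewrite /f scale0r addr0 subr0; apply => //.
- move=> [K|]; rewrite inE => KT.
    rewrite /F -[X in closed X]/((fun s => x + s *: e_ i) @^-1` hull K).
    by apply: preimage_closed; [move=> s _; exact: cl|exact: element_closed hT _ KT].
  rewrite /F -[X in closed X]/((fun s => t (x + s *: e_ i)) @^-1` [set 0]).
  apply: preimage_closed; last exact: closed_eq.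
  move=> s _; apply: continuous_comp; first exact: cl.
  exact: smooth_continuous.
- move=> [K|] s s'; rewrite inE => KT /=; last first.
    by move=> -> ->; rewrite !mulr0 subr0 normr0 mulr_ge0// addr_ge0// mulr_ge0.
  move=> Ks Ks'.
  set y := x + s *: e_ i; set y' := x + s' *: e_ i.
  have -> : psi y * t y - psi y' * t y' = psi y * (t y - t y') + (psi y - psi y') * t y' by ring.
  apply: le_trans (ler_normD _ _) _; rewrite [leRHS]mulrDl; apply: lerD.
    have tyy : `|t y - t y'| <= L0 * `|s - s'|.
      have := tL y' (s - s'); congr (`|t _ - _| <= _).
      by rewrite /y /y' -addrA [s' *: _ + _]addrC scalerBl subrK.
    have /andP[p0 p1] := hat_bound (element_sub hT KT Ks).
    by rewrite normrM -[X in _ <= X]mul1r ler_pM// ger0_norm.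
  have -> : psi y - psi y' = v K a ord0 i * (s - s').
    rewrite (psiE KT Ks) (psiE KT Ks') /y /y' !dotvDr !dotvZr dotv_delta.
    by ring.
  rewrite !normrM [leLHS]mulrC -[M * B i * _]mulrA ler_pM//.
  by rewrite ler_wpM2r// ler_slope.
- move=> s _; have [ts|ts] := eqVneq (t (x + s *: e_ i)) 0.
    by exists None; rewrite ?inE.
  have /subset_closure/(closure_cover hT)[K KT Ks] : Omega (x + s *: e_ i).
    by apply: contrapT => /t_out/eqP; rewrite (negbTE ts).
  by exists (Some K); rewrite ?inE.
Qed.

(** Almost every point of the closure of [Omega] is in an open cell, where [psi] is affine and the
    product rule applies; off the closure [t] vanishes in a neighbourhood. *)
Lemma hat_test_derive i : {ae mu, forall x,
  is_derive x (e_ i) (fun x => psi x * t x) (hat_grad x ord0 i * t x + psi x * 'D_(e_ i) t x)}.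
Proof.
have := ae_open_cells d0 hT; apply: filterS => x xcell.
have [cx|cx] := pselect (closure Omega x).
  have [K KT Kx] := xcell cx.
  rewrite (hat_gradE KT Kx).
  have h1 := hat_is_derive i KT Kx.
  have h2 : is_derive x (e_ i) t ('D_(e_ i) t x).
    by apply: DeriveDef => //; exact: smooth_derivable.
  apply: is_derive_eq (is_deriveM h1 h2) _.
  by rewrite /GRing.scale/= addrC [t x * _]mulrC.
have -> : 'D_(e_ i) t x = 0.
  by apply: (test_function_out (test_function_derive i ht)) => /subset_closure.
rewrite t_out ?mulr0 ?addr0; last by move=> /subset_closure.
apply: near_eq_is_derive (is_derive_cst 0 x (e_ i)).
have oc : open (~` closure Omega) by apply: closed_openC; exact: closed_closure.
have := open_nbhs_nbhs (conj oc cx); apply: filterS => y cy.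
by rewrite t_out ?mulr0// => /subset_closure.
Qed.

End product.

(* psi * t is Lipschitz along coordinate lines although psi is only controlled element
   by element: each line is covered by the traces of the closed elements and of the zero
   set of t. *)
Lemma is_wgrad_hat : is_wgrad Omega psi hat_grad.
Proof.
split; first exact: hat_grad_L2v.
move=> t ht i.
have mO : measurable Omega by exact: open_measurable_rV.
have mcO : measurable (closure Omega) by apply: closed_measurable_rV; exact: closed_closure.
have mpsi (f : E -> R) : measurable_fun setT f -> (forall x, ~ Omega x -> f x = 0) ->
    measurable_fun setT (fun x => psi x * f x).
  move=> mf f0; rewrite -(setUv (closure Omega)).
  apply/measurable_funU => //; first exact: measurableC.
  split.
    apply: measurable_funM; first exact: hat_measurable.
    exact: (@measurable_funS _ _ _ _ setT).
  apply: (@eq_measurable_fun _ _ _ _ _ (fun _ : E => 0 : R)); last exact: measurable_cst.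
  move=> x; rewrite inE => cx; rewrite f0 ?mulr0//.
  by move=> /subset_closure.
have hdt := test_function_derive i ht.
have [r tr] := test_function_supp ht.
have [L HL] := hat_test_lipschitz ht i.
have mt := test_function_measurable ht.
have mdt := test_function_measurable hdt.
have [_ int0] : mu.-integrable setT (EFin \o (fun x => hat_grad x ord0 i * t x + psi x * 'D_(e_ i) t x))
    /\ \int[mu]_x (hat_grad x ord0 i * t x + psi x * 'D_(e_ i) t x) = 0.
  apply: (@integral_derive0 R d (fun x => psi x * t x) _ i L r) => //.
  - by apply: mpsi => // x; exact: test_function_out ht.
  - apply: measurable_funD; last by apply: mpsi => // x; exact: test_function_out hdt.
    by apply: measurable_funM => //; exact: hat_grad_measurable.
  - by move=> x /tr ->; rewrite mulr0.
  - exact: hat_test_derive.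
have L2t := test_function_L2 mO ht.
have L2dt := test_function_L2 mO hdt.
have int0' : ip Omega (fun x => hat_grad x ord0 i) t + ip Omega psi (fun x => 'D_(e_ i) t x) = 0.
  rewrite -int0 /ip -RintegralD//; last 2 first.
  - exact: (L2M_integrable mO (hat_grad_L2v i) L2t).
  - exact: (L2M_integrable mO hat_L2 L2dt).
  pose H x := hat_grad x ord0 i * t x + psi x * 'D_(e_ i) t x.
  have e w : ip w (fun=> 1) H = \int[mu]_(x in w) H x.
    by rewrite /ip; apply: eq_Rintegral => x _; rewrite mul1r.
  rewrite -[LHS]/(\int[mu]_(x in Omega) H x) -[RHS]/(\int[mu]_x H x) -!e.
  apply: ip_support => x nx.
  by rewrite /H (test_function_out ht nx) (test_function_out hdt nx) !mulr0 addr0.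
rewrite -[LHS]/(ip Omega psi (fun x => cgrad t x ord0 i)).
have -> : (fun x => cgrad t x ord0 i) = (fun x => 'D_(e_ i) t x).
  by apply/funext => x; rewrite mxE.
by apply/eqP; rewrite -addr_eq0 addrC int0'.
Qed.

End hat_gradient.

(** * Equilibrated fluxes *)

Section restriction.
Context {R : realType} {d : nat}.
Notation E := ('rV[R]_d).
Notation mu := (lebesgue_rV R d).
Implicit Types (w P : set E) (f g t : E -> R).

Lemma Rintegral_restrict w P (h : E -> R) : (forall x, w x -> ~ P x -> h x = 0) ->
  \int[mu]_(x in w) h x = \int[mu]_(x in w `&` P) h x.
Proof.
move=> h0; rewrite /Rintegral integral_mkcond [in RHS]integral_mkcond.
congr (fine _); congr (integral _ _ _); apply/funext => x.
rewrite /patch; case: ifPn => wx; case: ifPn => wPx//.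
  by rewrite h0//; [rewrite inE in wx|move=> Px; move: wPx; rewrite notin_setE/=; apply; split => //; rewrite inE in wx].
by move: wPx wx; rewrite !inE notin_setE => -[].
Qed.

Lemma L2_indic w P f : measurable w -> measurable P -> L2 w f ->
  L2 w (fun x => \1_P x * f x).
Proof.
move=> mw mP [mf f2]; have m1 : measurable_fun w (fun x => \1_P x * f x).
  by apply: measurable_funM => //; exact: measurable_indic.
split=> //; apply: le_integrable f2 => //.
  by apply/measurable_EFinP; under eq_fun do rewrite expr2; exact: measurable_funM.
move=> x wx /=; rewrite lee_fin exprMn normrM ler_piMl// indicE.
by case: (x \in P); rewrite ?expr1n ?expr0n ?normr1 ?normr0.
Qed.

Lemma L2S w w' f : measurable w -> measurable w' -> w' `<=` w -> L2 w f -> L2 w' f.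
Proof.
move=> mw mw' ww' [mf if_]; split; first exact: measurable_funS mf.
exact: integrableS if_.
Qed.

Lemma L2_ae_bounded w f (M r : R) : measurable w -> w `<=` cube 0 r ->
  measurable_fun w f -> {ae mu, forall x, w x -> `|f x| <= M} -> L2 w f.
Proof.
move=> mw wr mf fM.
(* Clipping f at |M| yields a function bounded everywhere and equal to f almost everywhere on w. *)
pose g x := Num.max (- `|M|) (Num.min (f x) `|M|).
have mg : measurable_fun w g.
  apply: measurable_maxr; first exact: measurable_cst.
  by apply: measurable_minr => //; exact: measurable_cst.
have gM x : `|g x| <= `|M|.
  rewrite ler_norml /g le_max lexx/= ge_max ge_min lexx orbT andbT.
  by rewrite (le_trans _ (normr_ge0 M))// oppr_le0.
have gL2 : L2 w g by apply: (@L2_bounded _ _ w g `|M| r) => // x /wr.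
apply: (L2_ae mw gL2 mf); move: fM; apply: filterS => x fM wx.
have := le_trans (fM wx) (ler_norm M); rewrite ler_norml => /andP[h1 h2].
by rewrite /g (min_idPl h2) (max_idPr h1).
Qed.

End restriction.

(** * Weak gradients of piecewise polynomials *)

Section element_gradient.
Context {R : realType} {d : nat}.
Notation E := ('rV[R]_d).
Notation mu := (lebesgue_rV R d).
Notation e_ i := (delta_mx ord0 i : E).
Variables (T : mesh R d) (Omega : set E).
Hypotheses (d0 : (0 < d)%N) (oO : open Omega) (hT : matching_mesh T Omega).
Hypothesis aeO : {ae mu, forall x, closure Omega x -> Omega x}.
Implicit Types (K : {set vertex T}) (a : vertex T) (x : E).

Let mO : measurable Omega := open_measurable_rV oO.

Lemma cgrad_polyfun s (q : E -> R) i : polyfun s q -> polyfun s (fun x => cgrad q x ord0 i).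
Proof.
move=> /(is_derive_polyfun i)[g sg qg].
suff -> : (fun x => cgrad q x ord0 i) = g by [].
by apply/funext => x; rewrite mxE; have [_ ->] := qg x.
Qed.

Lemma polyfun_bounded s (q : E -> R) (r : R) : polyfun s q ->
  exists M, forall x, cube 0 r x -> `|q x| <= M.
Proof.
move=> /polyfun_monomials[S [c [_ qE]]].
exists (\sum_(m <- S) `|c m| * \prod_(j < d) `|r| ^+ m j) => x xr.
rewrite qE; apply: le_trans (ler_norm_sum _ _ _) _; apply: ler_sum => m _.
rewrite normrM ler_wpM2l// /monomial normr_prod; apply: ler_prod => j _.
rewrite normr_ge0 normrX lerXn2r ?nnegrE//=.
by have := xr j; rewrite mxE subr0 => /ltW/le_trans; apply; exact: ler_norm.
Qed.

(** In the interior W of the element within [Omega], both gradients satisfy the same integration by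
    parts against test functions supported in W, so the fundamental lemma identifies them. The rest
    of the element is null: it lies in faces or in the boundary of [Omega]. *)
Lemma element_wgrad K s u (q : E -> R) : K \in elements T -> H1 Omega u -> polyfun s q ->
  aeeq (hull K) u q -> aeeq (hull K) (wgrad Omega u) (cgrad q).
Proof.
move=> KT Hu sq uq; pose W := Omega `&` (hull K)°.
have oW : open W by apply: openI => //; exact: open_interior.
have mW : measurable W := open_measurable_rV oW.
have WO : W `<=` Omega by move=> x [].
have WK : W `<=` hull K by move=> x [_ /interior_subset].
have mu_ : measurable_fun Omega u by case: (Hu) => -[].
have [L2G wG] := wgradP Hu.
suff : aeeq W (wgrad Omega u) (cgrad q).
  move=> h; move: (ae_element_interior d0 hT KT) aeO h.
  apply: filterS3 => x h1 h2 h3 Kx; apply: h3; split; last exact: h1.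
  by apply: h2; exact: (element_sub hT KT Kx).
apply: aeeq_forall_coord => i.
have [dq sdq qdq] := is_derive_polyfun i sq.
have cgE : (fun x => cgrad q x ord0 i) = dq.
  by apply/funext => x; rewrite mxE; have [_ ->] := qdq x.
have DqE : (fun x => 'D_(e_ i) q x) = dq.
  by apply/funext => x; have [_ ->] := qdq x.
have [r Kr] := hull_bounded K.
have bounded_L2 s' (f : E -> R) : polyfun s' f -> L2 W f.
  move=> sf; have [M fM] := polyfun_bounded r sf.
  apply: (@L2_bounded _ _ _ _ M r) => //.
  - apply: (@measurable_funS _ _ _ _ setT) => //.
    exact: continuous_measurable_rV (continuous_polyfun sf).
  - by move=> x /WK/Kr/fM.
  - by move=> x /WK/Kr.
have L2Gi : L2 W (fun x => wgrad Omega u x ord0 i) := L2S mO mW WO (L2G i).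
have L2dq : L2 W dq := bounded_L2 _ _ sdq.
rewrite cgE.
have : aeeq W (fun x => wgrad Omega u x ord0 i - dq x) (fun=> 0).
  apply: fundamental_lemma => //; first exact: L2B.
  move=> t tW; have tO := test_functionS WO tW.
  have L2t : L2 W t := test_function_L2 mW tW.
  rewrite ipBl// (ip_support _ (fun x => test_function_out tW (x := x))).
  rewrite -(ip_support _ (fun x => test_function_out tO (x := x))).
  have := wG t tO i => /eqP; rewrite -[X in _ == X]mulN1r eq_sym mulN1r eqr_oppLR => /eqP ->.
  have cgt : (fun x => cgrad t x ord0 i) = (fun x => 'D_(e_ i) t x).
    by apply/funext => x; rewrite mxE.
  have tdW := test_function_derive i tW; have tdO := test_function_derive i tO.
  rewrite cgt (ip_support _ (fun x => test_function_out tdO (x := x))).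
  rewrite -(ip_support _ (fun x => test_function_out tdW (x := x))).
  have -> : ip W u (fun x => 'D_(e_ i) t x) = ip W q (fun x => 'D_(e_ i) t x).
    apply: ip_ae => //; [exact: measurable_funS mu_|exact: L2_measurable (bounded_L2 _ _ sq)|
      exact: L2_measurable (test_function_L2 mW tdW)|exact: aeeqS WK uq].
  rewrite (ip_support _ (fun x => test_function_out tdW (x := x))).
  rewrite (ip_derive_test tW (continuous_polyfun sq)); last 2 first.
  - by move=> x; have [] := qdq x.
  - by rewrite DqE; exact: continuous_polyfun sdq.
  rewrite DqE -(ip_support _ (fun x => test_function_out tW (x := x))).
  by rewrite opprK subrr.
apply: filterS => x h Wx; apply/eqP; rewrite -subr_eq0; exact/eqP/h.
Qed.

End element_gradient.

(** * Local flux problems on vertex patches *)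

Section flux.
Context {R : realType} {d : nat}.
Notation E := ('rV[R]_d).
Notation mu := (lebesgue_rV R d).
Notation e_ i := (delta_mx ord0 i : E).
Variables (T : mesh R d) (Omega : set E).
Hypotheses (d0 : (0 < d)%N) (oO : open Omega) (hT : matching_mesh T Omega).
Hypothesis aeO : {ae mu, forall x, closure Omega x -> Omega x}.
Implicit Types (K : {set vertex T}) (a : vertex T) (x : E).

Let mO : measurable Omega := open_measurable_rV oO.

Lemma broken_polyB s f g : broken_poly T Omega s f -> broken_poly T Omega s g ->
  broken_poly T Omega s (fun x => f x - g x).
Proof.
move=> [mf fq] [mg gq]; split; first exact: measurable_funB.
move=> K KT; have [q sq fK] := fq K KT; have [r sr gK] := gq K KT.
exists (fun x => q x + -1 * r x); first exact: (polyfunD sq (polyfunZ (-1) sr)).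
by move: fK gK; apply: filterS2 => x h1 h2 Kx; rewrite h1// h2// mulN1r.
Qed.

Lemma broken_poly_L2 s f : broken_poly T Omega s f -> L2 Omega f.
Proof.
move=> [mf fq]; have [r rO] := mesh_bounded hT.
have /choice[M MP] : forall K, exists M, K \in elements T ->
    {ae mu, forall x, hull K x -> `|f x| <= M}.
  move=> K; have [KT|KT] := boolP (K \in elements T); last by exists 0.
  have [q sq fK] := fq K KT; have [rK Kr] := hull_bounded K.
  have [M qM] := polyfun_bounded rK sq; exists M => _.
  by move: fK; apply: filterS => x h Kx; rewrite h//; exact/qM/Kr.
apply: (@L2_ae_bounded _ _ _ _ (\sum_K `|M K|) r) => //.
  by apply: subset_trans rO; exact: subset_closure.
have : {ae mu, forall x, forall K, K \in elements T -> hull K x -> `|f x| <= M K}.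
  apply: filter_forall => K; have [KT|KT] := boolP (K \in elements T); last exact: aeW.
  by move: (MP K KT); apply: filterS => x h _.
apply: filterS => x h /subset_closure/(closure_cover hT)[K KT Kx].
apply: le_trans (h K KT Kx) _; apply: le_trans (ler_norm _) _.
by rewrite (bigD1 K)//= lerDl sumr_ge0.
Qed.

(** f itself witnesses that the set inspected by [get] is nonempty; the chosen projection minus f is
    again a broken polynomial, and is orthogonal to itself. *)
Lemma L2proj_broken_poly s f : broken_poly T Omega s f ->
  measurable_fun Omega (L2proj Omega (broken_poly T Omega s) f) /\
  aeeq Omega (L2proj Omega (broken_poly T Omega s) f) f.
Proof.
move=> sf; pose Q := broken_poly T Omega s.
have [Qg gf] : Q (L2proj Omega Q f) /\ forall h, Q h -> ip Omega (L2proj Omega Q f) h = ip Omega f h.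
  exact: (@getPex _ [set q : E -> R | Q q /\ forall h, Q h -> ip Omega q h = ip Omega f h]
    (ex_intro _ f (conj sf (fun _ _ => erefl)))).
split; first by case: Qg.
set g := L2proj _ _ f in Qg gf *.
have L2f := broken_poly_L2 sf; have L2g := broken_poly_L2 Qg.
have Qgf := broken_polyB Qg sf; have L2gf := broken_poly_L2 Qgf.
have : ip Omega (fun x => g x - f x) (fun x => g x - f x) = 0.
  by rewrite ipBl// gf// subrr.
move/(ip_eq0 mO L2gf); apply: filterS => x h Ox.
by apply/eqP; rewrite -subr_eq0 h.
Qed.

(** The source of the local mixed problem at a vertex, before projection. *)
Definition flux_data (lam : R) (u psi : E -> R) : E -> R := fun x =>
  lam * u x * psi x - dotv (wgrad Omega u x) (wgrad Omega psi x).

(* Without a weak divergence, [get] returns a constant junk value. *)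
Lemma measurable_wdiv (P : set E) F : measurable_fun P (wdiv P F).
Proof.
have [[g Hg]|no] := pselect (exists g, is_wdiv P F g).
  by have [[]] := @getPex _ [set g : E -> R | is_wdiv P F g] (ex_intro _ g Hg).
rewrite /wdiv getPN; first exact: measurable_cst.
by move=> g Hg; apply: no; exists g.
Qed.

Section vertex_data.
Variables (v : {set vertex T} -> vertex T -> E) (c : {set vertex T} -> vertex T -> R).
Hypothesis hvc : hat_coords v c.

Lemma hat_H1 a psi : is_hat a psi -> H1 Omega psi.
Proof.
move=> hpsi; split; first exact: (hat_L2 oO hT hvc hpsi).
by exists (hat_grad T psi); exact: (is_wgrad_hat d0 oO hT hvc hpsi).
Qed.

Lemma ae_hat_wgrad a psi : is_hat a psi ->
  {ae mu, forall x, Omega x -> wgrad Omega psi x = hat_grad T psi x}.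
Proof.
by move=> hpsi; apply: (wgrad_ae oO (hat_H1 hpsi)); exact: (is_wgrad_hat d0 oO hT hvc hpsi).
Qed.

Variables (lam : R) (u : E -> R) (p : nat).
Hypotheses (pu : broken_poly T Omega p u) (Hu : H1 Omega u).

(** On an element [psi] is affine, so u psi has degree at most p + 1 and the gradient term at most
    p: this is what the order p + 1 of the flux spaces is chosen for. *)
Lemma flux_data_broken_poly a psi : is_hat a psi ->
  broken_poly T Omega p.+1 (flux_data lam u psi).
Proof.
move=> hpsi; have Hpsi := hat_H1 hpsi; split.
  apply: measurable_funB.
    apply: measurable_funM; last by case: Hpsi => -[].
    by apply: measurable_funM => //; case: Hu => -[].
  rewrite /dotv; apply: measurable_sum => i; apply: measurable_funM.
    by case: (L2v_wgrad Hu i).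
  by case: (L2v_wgrad Hpsi i).
move=> K KT; case: pu => _ /(_ K KT)[q sq uq].
have psiK : aeeq (hull K) psi (fun x => dotv (v K a) x + c K a).
  by apply: aeW => x Kx; have [_ _ _ h] := hvc KT; exact: h.
have sK := affine_polyfun (v K a) (c K a).
have gu := element_wgrad d0 oO hT aeO KT Hu sq uq.
have gpsi := element_wgrad d0 oO hT aeO KT Hpsi sK psiK.
exists (fun x => lam * (q x * (dotv (v K a) x + c K a)) +
   -1 * \sum_(i < d) v K a ord0 i * cgrad q x ord0 i).
  apply: polyfunD.
    by apply: polyfunZ; rewrite -addn1; exact: polyfunM.
  apply: polyfunZ; apply: polyfun_sum => i; apply: polyfunZ.
  by apply: (@polyfunS _ _ p) => //; exact: cgrad_polyfun.
move: uq gu gpsi; apply: filterS3 => x h1 h3 h4 Kx.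
have [_ _ _ psiE] := hvc KT.
rewrite /flux_data h1// (psiE _ _ hpsi)// h3// h4// mulN1r mulrA; congr (_ - _).
rewrite /dotv; apply: eq_bigr => i _; rewrite mulrC; congr (_ * _).
by rewrite mxE; have [_ ->] := is_derive_affine (v K a) (c K a) x i.
Qed.

(** A hat function and its gradient vanish in the cells that do not contain its vertex; the patch
    balance can thus be written over all of [Omega]. *)
Lemma flux_data_out a psi : is_hat a psi ->
  {ae mu, forall x, Omega x -> ~ vertex_patch a x -> flux_data lam u psi x = 0}.
Proof.
move=> hpsi; move: (ae_open_cells d0 hT) (ae_hat_wgrad hpsi); apply: filterS2 => x hc hg Ox nP.
have [K KT Kx] := hc (subset_closure Ox).
have aK : a \notin K.
  apply/negP => aK; apply: nP; apply: interiorS Kx => y Ky.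
  by exists K.
have [vcN _ _ psiE] := hvc KT; have [v0 c0] := vcN a aK.
rewrite /flux_data (psiE _ _ hpsi x (interior_subset Kx)) hg// (hat_gradE hvc hpsi KT Kx) v0 c0.
have dot0 y : dotv 0 y = 0 :> R by rewrite /dotv big1// => i _; rewrite mxE mul0r.
by rewrite [dotv _ 0]dotvC !dot0 addr0 mulr0 subr0.
Qed.

Lemma vertex_in_closure a : closure Omega (pt a).
Proof.
case: hT => _ _ _ /(_ a)[K KT aK]; apply: (element_sub hT KT).
exists (fun b => (b == a)%:R); split => [b|b bK||].
- exact: ler0n.
- by case: eqP => // ba; move: bK; rewrite ba aK.
- by rewrite (bigD1 a)//= eqxx big1 ?addr0// => b /negbTE ->.
- by rewrite (bigD1 a)//= eqxx scale1r big1 ?addr0// => b /negbTE ->; rewrite scale0r.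
Qed.

(** At an interior vertex the normal trace vanishes on the whole patch boundary, so every test
    function is admissible. At a boundary vertex the part left free lies in the boundary of [Omega],
    which the support of t avoids since [Omega] is open. *)
Lemma patch_green a F s t : patch_flux Omega s a F -> test_function Omega t ->
  ipv (vertex_patch a) F (cgrad t) + ip (vertex_patch a) (wdiv (vertex_patch a) F) t = 0.
Proof.
move=> [_ int_a bnd_a] ht; have [Oa|Oa] := pselect (Omega (pt a)).
  by apply: (int_a Oa); rewrite setDv setC0; exact: test_functionS ht.
have iO : Omega° = Omega by apply/seteqP; split; [exact: interior_subset|rewrite -open_subsetE].
apply: bnd_a; first by split; [exact: vertex_in_closure|rewrite iO].
apply: test_functionS ht => x Ox [bPx]; apply; split => //.
by move=> [_]; rewrite iO.
Qed.

(* The patch need not be contained in Omega (a face may be interior to the closure of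
   Omega), so both sides are first restricted to their intersection. *)
Lemma local_balance a psi F : is_hat a psi ->
  admissible_flux Omega p lam u psi a F ->
  L2v Omega (fun x => \1_(vertex_patch a) x *: F x) /\
  forall t, test_function Omega t ->
    ipv Omega (fun x => \1_(vertex_patch a) x *: F x) (cgrad t) +
    ip Omega (flux_data lam u psi) t = 0.
Proof.
move=> hpsi [pF divF]; set P := vertex_patch a in pF divF *.
have mP : measurable P by apply: open_measurable_rV; exact: open_interior.
have mOP : measurable (Omega `&` P) by exact: measurableI.
split.
  case: pF => -[G [[L2G _] _] FG] _ _ i.
  have -> : (fun x => (\1_P x *: F x) ord0 i) = (fun x => \1_P x * G x ord0 i).
    apply/funext => x; rewrite mxE indicE; case: (boolP (x \in P)); last by rewrite !mul0r.
    by rewrite inE => Px; rewrite FG.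
  exact: L2_indic.
move=> t ht; have := patch_green pF ht; rewrite -/P.
have dF := flux_data_broken_poly hpsi; have [mproj projE] := L2proj_broken_poly dF.
have mdata : measurable_fun Omega (flux_data lam u psi) by case: dF.
have mt := test_function_measurable ht.
have t0 x : ~ Omega x -> t x = 0 by exact: test_function_out ht.
have cg0 x : ~ Omega x -> cgrad t x = 0.
  move=> Ox; apply/rowP => i; rewrite !mxE.
  exact: test_function_out (test_function_derive i ht) Ox.
have dotr0 (y : E) : dotv y 0 = 0 :> R by rewrite /dotv big1// => i _; rewrite mxE mulr0.
have dotl0 (y : E) : dotv 0 y = 0 :> R by rewrite dotvC dotr0.
have <- : ipv Omega (fun x => \1_P x *: F x) (cgrad t) = ipv P F (cgrad t).
  rewrite /ipv (@Rintegral_restrict _ _ P Omega) => [|x _ /cg0 ->//].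
  rewrite (@Rintegral_restrict _ _ Omega P) => [|x _ Px]; last first.
    by rewrite indicE memNset// scale0r.
  rewrite setIC; apply: eq_Rintegral => x; rewrite inE => -[Px _].
  by rewrite indicE mem_set// scale1r.
suff -> : ip P (wdiv P F) t = ip Omega (flux_data lam u psi) t by [].
rewrite /ip (@Rintegral_restrict _ _ P Omega) => [|x _ /t0 ->]; last by rewrite mulr0.
have -> : \int[mu]_(x in Omega) (flux_data lam u psi x * t x) =
    ip Omega (fun x => \1_P x * flux_data lam u psi x) t.
  apply: ip_ae => //; first by apply: measurable_funM => //; exact: measurable_indic.
    exact: (@measurable_funS _ _ _ _ setT).
  move: (flux_data_out hpsi); apply: filterS => x h Ox; rewrite indicE.
  by case: (boolP (x \in P)) => Px; rewrite ?mul1r// mul0r h//; move: Px; rewrite notin_setE.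
rewrite /ip (@Rintegral_restrict _ _ Omega P) => [|x _ Px]; last first.
  by rewrite indicE memNset// !mul0r.
rewrite setIC -[LHS]/(ip (Omega `&` P) (wdiv P F) t).
have -> : ip (Omega `&` P) (wdiv P F) t = ip (Omega `&` P) (flux_data lam u psi) t.
  apply: ip_ae => //.
  - by apply: (measurable_funS mP _ (@measurable_wdiv P F)) => x [].
  - by apply: (measurable_funS mO _ mdata) => x [].
  - exact: (@measurable_funS _ _ _ _ setT).
  - by move: divF projE; apply: filterS2 => x h1 h2 [Ox Px]; rewrite h1// h2.
apply: eq_Rintegral => x; rewrite inE => -[_ Px].
by rewrite indicE mem_set// mul1r.
Qed.

End vertex_data.

End flux.

(** * Equilibration of the reconstructed flux *)

Section reconstruction.
Context {R : realType} {d : nat}.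
Notation E := ('rV[R]_d).
Notation mu := (lebesgue_rV R d).
Notation e_ i := (delta_mx ord0 i : E).

Lemma ae_polyhedral (Omega : set E) : polyhedral_domain Omega ->
  {ae mu, forall x, closure Omega x -> Omega x}.
Proof.
move=> [oO _ _ _ [s [s0 bs]]].
have : {ae mu, forall x, forall i : 'I_(size s),
    dotv (tnth (in_tuple s) i).1 x <> (tnth (in_tuple s) i).2}.
  apply: filter_forall => i; set q := tnth _ i.
  exists [set x | dotv q.1 x = q.2]; split.
  - exact: measurable_hyperplane.
  - by apply/hyperplane_null/s0; exact: mem_tnth.
  - by move=> x /=; apply: contra_notP.
apply: filterS => x h cx; apply: contrapT => Ox.
have [|q qs qx] := bs x.
  by split => // /interior_subset.
have /tnthP[i qi] : q \in in_tuple s by [].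
by apply: (h i); rewrite -qi.
Qed.

Lemma L2v_sum (w : set E) (I : Type) (r : seq I) (G : I -> E -> E) : measurable w ->
  (forall a, L2v w (G a)) -> L2v w (fun x => \sum_(a <- r) G a x).
Proof.
move=> mw LG; elim: r => [|a r IH].
  by under eq_fun do rewrite big_nil; exact: L2v0.
by under eq_fun do rewrite big_cons; exact: L2vD.
Qed.

Lemma ipv_suml (w : set E) (I : Type) (r : seq I) (G : I -> E -> E) H : measurable w ->
  (forall a, L2v w (G a)) -> L2v w H ->
  ipv w (fun x => \sum_(a <- r) G a x) H = \sum_(a <- r) ipv w (G a) H.
Proof.
move=> mw LG LH; elim: r => [|a r IH].
  under eq_fun do rewrite big_nil.
  have := ipvZl mw 0 LH LH; rewrite mul0r big_nil => h0; rewrite -[RHS]h0.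
  by congr (ipv w _ H); apply/funext => x; rewrite scale0r.
under eq_fun do rewrite big_cons.
by rewrite big_cons ipvDl// ?IH//; exact: L2v_sum.
Qed.

Variables (T : mesh R d) (Omega : set E).
Hypotheses (d0 : (0 < d)%N) (oO : open Omega) (hT : matching_mesh T Omega).
Hypothesis aeO : {ae mu, forall x, closure Omega x -> Omega x}.
Implicit Types (K : {set vertex T}) (a : vertex T) (x : E).

Let mO : measurable Omega := open_measurable_rV oO.

Variables (psi : vertex T -> E -> R) (hpsi : forall a, is_hat a (psi a)).
Variables (p : nat) (lam : R) (u : E -> R) (Fa : vertex T -> E -> E).
Hypotheses (pu : broken_poly T Omega p u) (Hu : H10 Omega u).
Hypothesis hFa : forall a, admissible_flux Omega p lam u (psi a) a (Fa a).

Lemma ae_sum_flux_data :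
  {ae mu, forall x, Omega x -> \sum_a flux_data Omega lam u (psi a) x = lam * u x}.
Proof.
have [v [c hvc]] := hat_coords_exists hT.
have : {ae mu, forall x, forall a, Omega x -> wgrad Omega (psi a) x = hat_grad T (psi a) x}.
  by apply: filter_forall => a; exact: (ae_hat_wgrad d0 oO hT hvc).
move: (ae_open_cells d0 hT); apply: filterS2 => x hc hg Ox.
have [K KT Kx] := hc (subset_closure Ox).
have [_ sum1 _ psiE] := hvc K KT.
rewrite /flux_data sumrB -mulr_sumr.
have -> : \sum_a psi a x = 1.
  rewrite -(sum1 x); apply: eq_bigr => a _.
  exact: (psiE _ _ (hpsi a)) (interior_subset Kx).
rewrite mulr1 (eq_bigr (fun a => dotv (wgrad Omega u x) (v K a))) => [|a _]; last first.
  by rewrite hg// (hat_gradE hvc (hpsi a) KT Kx).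
rewrite /dotv exchange_big/= big1 ?subr0// => i _.
(* The slopes of the hat functions sum to zero: compare the partition of unity at [e_ i] and at
   0. *)
rewrite -mulr_sumr; have := sum1 (e_ i); rewrite -(sum1 0) !big_split/=.
move=> /addIr; under eq_bigr do rewrite dotv_delta; move=> ->.
by rewrite big1 ?mulr0// => b _; rewrite /dotv big1// => j _; rewrite mxE mulr0.
Qed.

Lemma flux_balance : L2v Omega (flux Fa) /\ forall t, test_function Omega t ->
  ipv Omega (flux Fa) (cgrad t) + ip Omega (fun x => lam * u x) t = 0.
Proof.
have [v [c hvc]] := hat_coords_exists hT.
have loc a := local_balance d0 oO hT aeO hvc pu (H10_H1 Hu) (hpsi a) (hFa a).
have L2F a : L2v Omega (fun x => \1_(vertex_patch a) x *: Fa a x) by case: (loc a).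
split; first exact: (@L2v_sum _ _ _ (fun a x => \1_(vertex_patch a) x *: Fa a x)).
move=> t ht.
have L2t := test_function_L2 mO ht; have L2ct := test_function_L2v mO ht.
have L2d a : L2 Omega (flux_data Omega lam u (psi a)).
  apply: (broken_poly_L2 oO hT).
  exact: (flux_data_broken_poly d0 oO hT aeO hvc lam pu (H10_H1 Hu) (hpsi a)).
rewrite /flux (ipv_suml _ mO L2F L2ct).
have -> : ip Omega (fun x => lam * u x) t = \sum_a ip Omega (flux_data Omega lam u (psi a)) t.
  rewrite -ip_suml//; apply: ip_ae => //.
  - by apply: measurable_funM => //; case: (H10_L2 Hu).
  - by apply: L2_measurable; apply: L2_sum.
  - by case: L2t.
  - by move: ae_sum_flux_data; apply: filterS => x h Ox; rewrite h.
by rewrite -big_split/= big1// => a _; case: (loc a) => _; exact.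
Qed.

(** Equilibration rewrites the residual at v as minus the inner product of grad u + sigma with grad
    v; Cauchy-Schwarz concludes. *)
Lemma flux_residual_bound v : H10 Omega v ->
  (lam * ip Omega u v - energy Omega u v) ^+ 2 <=
  normL2v Omega (fun x => wgrad Omega u x + flux Fa x) ^+ 2 * energy Omega v v.
Proof.
move=> Hv; have [L2F bal] := flux_balance.
have L2u := H10_L2 Hu; have L2v_ := H10_L2 Hv.
have L2lu : L2 Omega (fun x => lam * u x) by exact: L2Z.
have := H10_density oO L2F L2lu bal Hv; rewrite ipZl// => balv.
have L2gu := L2v_wgrad (H10_H1 Hu); have L2gv := L2v_wgrad (H10_H1 Hv).
have L2s : L2v Omega (fun x => wgrad Omega u x + flux Fa x) by exact: L2vD.
rewrite normL2v_sqr; have := ipv_CS2 mO L2s L2gv; rewrite ipvDl//.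
rewrite -[ipv Omega (wgrad Omega u) (wgrad Omega v)]/(energy Omega u v).
rewrite -[ipv Omega (wgrad Omega v) (wgrad Omega v)]/(energy Omega v v).
apply: le_trans; move: balv; set a := ipv _ _ _; set b := lam * _; set e := energy _ _ _.
move=> /eqP; rewrite addr_eq0 => /eqP ->.
by rewrite -[X in _ <= X ^+ 2]opprK sqrrN opprD opprK addrC.
Qed.

End reconstruction.

(** * The eigenvalue bounds *)

(** Duality: |r|^2 = (grad zeta, grad r) = (grad (zeta - v), grad r) for every v in V, as r is
    energy-orthogonal to V. Passing to the infimum over v and cancelling one factor |r| gives the
    bound. *)
Lemma aubin_nitsche (R : realType) (d : nat) (w : set 'rV[R]_d) (V : set ('rV[R]_d -> R))
    (r zeta : 'rV[R]_d -> R) (B : R) : open w ->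
  H10 w r -> H10 w zeta -> V !=set0 -> V `<=` H10 w ->
  (forall v, V v -> energy w r v = 0) ->
  energy w zeta r = ip w r r -> 0 <= B ->
  inf [set normL2v w (wgrad w (zeta \- v)) | v in V] <= B * normL2 w r ->
  ip w r r <= B ^+ 2 * energy w r r.
Proof.
move=> ow Hr Hz V0 VH rV zr B0 infB.
have Er := energy_ge0 w r.
pose s := normL2v w (wgrad w r).
have s0 : 0 <= s by exact: sqrtr_ge0.
have sE : s ^+ 2 = energy w r r by exact: normL2v_wgrad_sqr.
pose n := normL2 w r.
have n0 : 0 <= n by exact: sqrtr_ge0.
have nE : n ^+ 2 = ip w r r by exact: normL2_sqr.
have bound v : V v -> n ^+ 2 <= normL2v w (wgrad w (zeta \- v)) * s.
  move=> Vv; have Hzr := H10_H1 Hz; have Hrr := H10_H1 Hr; have Hv := H10_H1 (VH _ Vv).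
  have Hzv : H1 w (zeta \- v) := H1B ow Hzr Hv.
  have := energyBl ow Hzr Hv Hrr; rewrite zr (energyC w v r) (rV v Vv) subr0 -nE => <-.
  apply: le_trans (ler_norm _) _.
  exact: (ipv_CS (open_measurable_rV ow) (L2v_wgrad Hzv) (L2v_wgrad Hrr)).
(* Passing to the infimum divides by s; if s = 0, a single v already forces n = 0. *)
have nBs : n ^+ 2 <= B * n * s.
  have [s00|sn0] := eqVneq s 0.
    have [v Vv] := V0; have := bound v Vv; rewrite s00 !mulr0.
    by [].
  have sp : 0 < s by rewrite lt_neqAle eq_sym sn0.
  rewrite -ler_pdivrMr//; apply: le_trans infB.
  apply: lb_le_inf.
    by have [v Vv] := V0; exists (normL2v w (wgrad w (zeta \- v))); exists v.
  by move=> _ [v Vv <-]; rewrite ler_pdivrMr//; exact: bound.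
rewrite -nE -sE -exprMn; have [->|nn0] := eqVneq n 0.
  by rewrite expr0n/= sqr_ge0.
have np : 0 < n by rewrite lt_neqAle eq_sym nn0.
rewrite lerXn2r ?nnegrE ?mulr_ge0// -(ler_pM2l np) -expr2.
by apply: le_trans nBs _; rewrite mulrAC mulrC mulrA.
Qed.

Theorem theorem5p3 (R : realType) (d : nat) (hd : d = 2%N \/ d = 3%N)
  (* continuous problem *)
  (Omega : set 'rV[R]_d)
  (hOmega : polyhedral_domain Omega) (hLip : lipschitz_boundary Omega)
  (lam : nat -> R) (phi0 : nat -> 'rV[R]_d -> R)
  (hphi0 : dirichlet_eigenbasis Omega lam phi0)
  (* discretization *)
  (T : mesh R d) (hT : matching_mesh T Omega)
  (kappa : R) (hkappa : shape_regular T kappa)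
  (p : nat) (hp : (1 <= p)%N)
  (N : nat) (hN : has_dim Omega (fe_space T Omega p) N)
  (lamh : nat -> R) (phih : nat -> 'rV[R]_d -> R)
  (hphih : galerkin_eigenpairs Omega (fe_space T Omega p) N lamh phih)
  (* cluster of eigenvalues *)
  (m M : nat) (hm : (1 <= m)%N) (hmM : (m <= M)%N) (hMN : (M <= N)%N)
  (gap_m : (1 < m)%N -> lam m.-1 < lam m) (gap_M : lam M < lam M.+1)
  (ulam : R)
  (hlow : (1 < m)%N -> lam m.-1 <= lamh m.-1 /\ lamh m.-1 < lamh m)
  (hup : lamh M < ulam /\ ulam <= lam M.+1)
  (* equilibrated fluxes *)
  (psi : vertex T -> 'rV[R]_d -> R) (hpsi : forall a, is_hat a (psi a))
  (sigma : nat -> vertex T -> 'rV[R]_d -> 'rV[R]_d)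
  (hsigma : forall i a, (m <= i <= M)%N ->
     is_local_flux Omega p (lamh i) (phih i) (psi a) a (sigma i a)) :
  let olam := lamh m.-1 in
  let eta_res2 := \sum_(m <= i < M.+1)
    normL2v Omega (fun x => wgrad Omega (phih i) x + flux (sigma i) x) ^+ 2 in
  let c_h :=
    let tM := (1 - lamh M / ulam)^-1 in
    if m == 1%N then tM else Num.max (lamh m / olam - 1)^-1 tM in
  let ct_h :=
    let tM := ulam `^ (- 2^-1) * (1 - lamh M / ulam)^-1 in
    if m == 1%N then tM
    else Num.max (olam `^ (- 2^-1) * (lamh m / olam - 1)^-1) tM in
  let err := \sum_(m <= i < M.+1) (lamh i - lam i) in
  let gamma_h v := fun x =>
    \sum_(m <= i < M.+1) ip Omega v (phih i) * phih i x in
  (* Case I *)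
  ((forall c : nat -> R,
      let v := fun x => \sum_(m <= k < M.+1) c k * phi0 k x in
      normL2 Omega v <> 0 -> normL2 Omega (gamma_h v) <> 0) ->
   0 <= err /\
   err <= (2 * c_h ^+ 2 + 2 * lamh M * ct_h ^+ 4 * eta_res2) * eta_res2) /\
  (* Case II *)
  (forall (r zeta : nat -> 'rV[R]_d -> R) (delta C_I C_S : R),
   (forall i, (m <= i <= M)%N -> H10 Omega (r i) /\
      forall v, H10 Omega v -> ipv Omega (wgrad Omega (r i)) (wgrad Omega v) =
        lamh i * ip Omega (phih i) v
        - ipv Omega (wgrad Omega (phih i)) (wgrad Omega v)) ->
   (forall i, (m <= i <= M)%N -> H10 Omega (zeta i) /\
      forall v, H10 Omega v ->
        ipv Omega (wgrad Omega (zeta i)) (wgrad Omega v) = ip Omega (r i) v) ->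
   0 < delta <= 1 ->
   (forall i, (m <= i <= M)%N ->
      [/\ H1plus delta Omega (zeta i),
          inf [set normL2v Omega (wgrad Omega (zeta i \- v))
              | v in fe_space T Omega p]
            <= C_I * mesh_size T `^ delta * H1plus_seminorm delta Omega (zeta i)
        & H1plus_seminorm delta Omega (zeta i) <= C_S * normL2 Omega (r i)]) ->
   0 <= err /\
   err <= (1 + 4 * lamh M * c_h ^+ 2 * C_I ^+ 2 * C_S ^+ 2
               * mesh_size T `^ (2 * delta)) * eta_res2).
Proof.
move=> olam eta_res2 c_h ct_h err gamma_h.
have d0 : (0 < d)%N by case: hd => ->.
have oO : open Omega by case: hOmega.
have mO : measurable Omega := open_measurable_rV oO.
have aeO := ae_polyhedral hOmega.
have [hV hmono hen hort] := hphih.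
pose eta i := normL2v Omega (fun x => wgrad Omega (phih i) x + flux (sigma i) x) ^+ 2.
have eta0 i : 0 <= eta i by exact: sqr_ge0.
have iN i : (m <= i <= M)%N -> (1 <= i <= N)%N.
  by move=> /andP[mi iM]; rewrite (leq_trans hm mi) (leq_trans iM hMN).
have H10h j : (1 <= j <= N)%N -> H10 Omega (phih j) by move=> /hV[[]].
have L2h j : (1 <= j <= N)%N -> L2 Omega (phih j) by move=> /H10h/H10_L2.
have enh j k : (1 <= j <= N)%N -> (1 <= k <= N)%N ->
    energy Omega (phih j) (phih k) = lamh j * (j == k)%:R.
  by move=> jN kN; rewrite -(hort j k)//; apply: hen => //; case: (hV k kN).
have ge i : (m <= i <= M)%N -> lam i <= lamh i.
  move=> /iN/andP[]; case: i => // i _ iN'.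
  have le j : (1 <= j <= i.+1)%N -> (1 <= j <= N)%N.
    by move=> /andP[-> ji]; rewrite (leq_trans ji iN').
  apply: (eigenvalue_le_galerkin oO hphi0 (uh := phih)).
  - by move=> j /le; exact: H10h.
  - by move=> j k /le jN /le kN; exact: hort.
  - by move=> j k /le jN /le kN; exact: enh.
  - by move=> j /andP[j1 ji]; apply: hmono; rewrite ?j1.
have err0 : 0 <= err.
  rewrite /err big_nat; apply: sumr_ge0 => i /andP[mi iM].
  by rewrite subr_ge0 ge// mi -ltnS.
have MN : (1 <= M <= N)%N by apply: iN; rewrite hmM leqnn.
have lamM0 : 0 <= lamh M by case: (hV M MN).
have lower : (1 < m)%N -> [/\ 0 <= olam, lam m.-1 <= olam & olam < lamh m].
  move=> m1; have [h1 h2] := hlow m1; split => //.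
  have : (1 <= m.-1 <= N)%N.
    by rewrite -ltnS (ltn_predK m1) m1 (leq_trans (leq_pred m))// (leq_trans hmM hMN).
  by case/hV.
have chM : (1 - lamh M / ulam)^-1 <= c_h by rewrite /c_h; case: ifP => // _; rewrite le_max lexx orbT.
have chm : (1 < m)%N -> (lamh m / olam - 1)^-1 <= c_h.
  by move=> m1; rewrite /c_h ifF ?le_max ?lexx//; apply/negbTE; rewrite neq_ltn m1 orbT.
have resid i : (m <= i <= M)%N -> forall v, H10 Omega v ->
    (lamh i * ip Omega (phih i) v - energy Omega (phih i) v) ^+ 2 <= eta i * energy Omega v v.
  move=> iM v Hv; have [[bp Hi] _] := hV i (iN i iM).
  apply: (flux_residual_bound d0 oO hT aeO hpsi bp Hi _ Hv) => a.
  by case: (hsigma i a iM).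
pose c i k := ip Omega (phih i) (phi0 k).
have [phiH lmono _ phiort _] := hphi0.
have lam0 k : (1 <= k)%N -> 0 <= lam k by exact: (eigenvalue_ge0 hphi0).
have lamh0 i : (m <= i <= M)%N -> 0 <= lamh i by move=> /iN/hV[].
have lamhm i : (m <= i <= M)%N -> lamh m <= lamh i <= lamh M.
  move=> /andP[mi iM]; apply/andP; split; apply: hmono => //.
  - by rewrite hm.
  - exact: leq_trans iM hMN.
  - by rewrite (leq_trans hm mi).
(* Bessel with the roles exchanged: the exact eigenfunction is expanded in the discrete orthonormal
   family. *)
have sumc k : (m <= k <= M)%N -> \sum_(m <= i < M.+1) c i k ^+ 2 <= 1.
  move=> /andP[mk kM]; have k1 : (1 <= k)%N := leq_trans hm mk.
  have inI i : i \in index_iota m M.+1 -> (1 <= i <= N)%N.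
    by rewrite mem_index_iota ltnS; exact: iN.
  have := @bessel_le R d Omega oO (index_iota m M.+1) phih (phi0 k) (iota_uniq _ _).
  rewrite (phiort k k) ?eqxx//= => bes.
  rewrite (eq_bigr (fun i => ip Omega (phi0 k) (phih i) ^+ 2)) => [|i _]; last by rewrite /c ipC.
  apply: bes.
  - by move=> i /inI/L2h.
  - by move=> i j /inI iI /inI jI; exact: hort.
  - exact/H10_L2/phiH.
have enc i : (m <= i <= M)%N ->
    \sum_(1 <= k < n.+1) lam k * c i k ^+ 2 @[n --> \oo] --> lamh i.
  move=> iM; have := energy_parseval oO hphi0 (H10h i (iN i iM)).
  by rewrite enh ?iN// eqxx mulr1.
have sume i n : (m <= i <= M)%N ->
    \sum_(1 <= k < n.+1) (lamh i - lam k) ^+ 2 * c i k ^+ 2 / lam k <= eta i.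
  by move=> iM; apply: (residual_sum oO hphi0 (H10h i (iN i iM)) (eta0 i) (resid i iM)).
have eta_sum : eta_res2 = \sum_(m <= i < M.+1) eta i by [].
have eta_res0 : 0 <= eta_res2 by rewrite eta_sum sumr_ge0.
split=> [_|r zeta delta C_I C_S Hr Hzeta delta01 Hreg]; split=> //.
  (* The cluster estimate gives this quantity; the rest of the stated bound is nonnegative. *)
  apply: (@le_trans _ _ (c_h ^+ 2 * eta_res2)).
    by rewrite eta_sum; apply: (cluster_bound hm hmM lam0 lmono lamh0 lamhm lower hup chM chm sumc enc sume).
  rewrite ler_wpM2r//.
  have h1 : 0 <= 2 * lamh M * ct_h ^+ 4 * eta_res2.
    by apply: mulr_ge0 => //; apply: mulr_ge0; [exact: mulr_ge0|exact: exprn_even_ge0].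
  have h2 := sqr_ge0 c_h; lra.
(* C_I and C_S have no prescribed sign: absolute values make [B] nonnegative and leave its square
   unchanged. *)
pose B := `|C_I| * mesh_size T `^ delta * `|C_S|.
have B0 : 0 <= B by rewrite !mulr_ge0// powR_ge0.
have BE : B ^+ 2 = C_I ^+ 2 * C_S ^+ 2 * mesh_size T `^ (2 * delta).
  rewrite /B !exprMn !real_normK ?num_real// [2 * delta]mulrC powRrM.
  by rewrite powR_mulrn ?powR_ge0// mulrAC.
have rE i v : (m <= i <= M)%N -> H10 Omega v ->
    energy Omega (r i) v = lamh i * ip Omega (phih i) v - energy Omega (phih i) v.
  by move=> iM Hv; case: (Hr i iM) => _; exact.
have rr i : (m <= i <= M)%N -> ip Omega (r i) (r i) <= B ^+ 2 * eta i.
  move=> iM; have [Hri _] := Hr i iM; have [Hzi zE] := Hzeta i iM.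
  have [_ hinf hsem] := Hreg i iM.
  apply: (@le_trans _ _ (B ^+ 2 * energy Omega (r i) (r i))); last first.
    rewrite ler_wpM2l ?sqr_ge0//.
    exact: (dual_norm_bound (eta0 i) (resid i iM) Hri (fun v => rE i v iM)).
  have V0 : fe_space T Omega p !=set0 by exists (phih i); case: (hV i (iN i iM)).
  have VH : fe_space T Omega p `<=` H10 Omega by move=> v [].
  (* Galerkin orthogonality: the discrete eigenvalue equation says that the residual vanishes on the
     finite element space. *)
  have rV v : fe_space T Omega p v -> energy Omega (r i) v = 0.
    move=> Vv; rewrite (rE i v iM (VH v Vv)) /energy (hen i v (iN i iM) Vv).
    by rewrite subrr.
  apply: (aubin_nitsche oO Hri Hzi V0 VH rV (zE _ Hri) B0).
  apply: le_trans hinf _; rewrite /B -[leRHS]mulrA.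
  have sem0 : 0 <= H1plus_seminorm delta Omega (zeta i) by exact: sqrtr_ge0.
  have n0 : 0 <= normL2 Omega (r i) by exact: sqrtr_ge0.
  apply: (@le_trans _ _ (`|C_I| * mesh_size T `^ delta * H1plus_seminorm delta Omega (zeta i))).
    by rewrite !ler_wpM2r ?powR_ge0 ?ler_norm.
  apply: ler_wpM2l; first by rewrite mulr_ge0 ?powR_ge0.
  apply: le_trans hsem _.
  by rewrite ler_wpM2r// ler_norm.
have := @cluster_bound_dual R lam lamh eta (fun i => B ^+ 2 * eta i) c
  (fun i k => ip Omega (r i) (phi0 k)) m M ulam olam c_h hm hmM lam0 lmono lamh0 lamhm
  lower hup chM chm sumc enc sume.
move=> bnd; apply: le_trans (bnd _ _) _.
- move=> i k iM k1; case: (Hr i iM) => Hri _.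
  exact: (riesz_coef hphi0 (H10h i (iN i iM)) Hri k1 (fun v => rE i v iM)).
- move=> i n iM; apply: le_trans (rr i iM).
  by apply: (eigen_bessel oO hphi0); case: (Hr i iM) => /H10_L2.
rewrite -mulr_sumr -eta_sum BE.
(* The dual estimate carries the constant 2; nonnegativity of this product accounts for the 4 of the
   statement. *)
have h1 : 0 <= lamh M * c_h ^+ 2 * (C_I ^+ 2 * C_S ^+ 2 * mesh_size T `^ (2 * delta)) * eta_res2.
  by rewrite -BE; apply: mulr_ge0 => //; apply: mulr_ge0; [apply: mulr_ge0 => //; exact: sqr_ge0|exact: sqr_ge0].
set X := _ `^ _ in h1 *; clear -h1.
have -> : (1 + 4 * lamh M * c_h ^+ 2 * C_I ^+ 2 * C_S ^+ 2 * X) * eta_res2 =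
   eta_res2 + 4 * (lamh M * c_h ^+ 2 * (C_I ^+ 2 * C_S ^+ 2 * X) * eta_res2) by ring.
have -> : 2 * lamh M * c_h ^+ 2 * (C_I ^+ 2 * C_S ^+ 2 * X * eta_res2) =
   2 * (lamh M * c_h ^+ 2 * (C_I ^+ 2 * C_S ^+ 2 * X) * eta_res2) by ring.
lra.
Qed.
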